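(* Let $\rho$ be a probability measure on $\mathbb{R}$, symmetric about $0$, and let $\xi\sim\rho$ satisfy $\mathrm{E}\xi^2=1$ and $\mathrm{E}\exp(\beta\xi^2/2)<\infty$ for $\beta\ge 0$. Assume: (1) $\rho$ has compact support: $\rho([-L,L])=1$ for some $L<\infty$; (2) with $h(s)=\frac{s^2}{2}-\log\int\exp(sx)\,d\rho(x)$, the equation $h'(s)=0$ has the unique root $s=0$; (3) $k\ge 2$ is an integer such that $h^{(i)}(0)=0$ for $0\le i\le 2k-1$ and $h^{(2k)}(0)>0$. Let $\mathbf{X}=(X_1,\dots,X_n)$ follow the general Curie--Weiss model $\mathrm{CW}(\rho)$ at inverse temperature $\beta=1$, and let $W=n^{\frac{1}{2k}}m(\mathbf{X})$, where $m(\mathbf{X})=\frac1n\sum_{i=1}^nX_i$. Let $Y$ be a random variable with density $p(y)=c_1\exp\bigl(-h^{(2k)}(0)y^{2k}/(2k)!\bigr)$, $y\in\mathbb{R}$, with $c_1$ the normalizing constant. Then $$\frac{\mathrm{P}(W>z)}{\mathrm{P}(Y>z)}=1+O(1)\,n^{-1/k}\bigl(1+z^{2k+2}\bigr)$$ uniformly in $z\in\bigl(0,n^{\frac{1}{k(2k+2)}}\bigr)$; that is, $O(1)$ is bounded in absolute value by a constant not depending on $n$ or $z$.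
   Context: The general Curie--Weiss model $\mathrm{CW}(\rho)$ at inverse temperature $\beta$ is the random vector $\mathbf{X}=(X_1,\dots,X_n)$ with joint law $$d\mathrm{P}_n(\mathbf{x})=Z_n^{-1}\exp\Bigl(\frac{\beta}{2n}(x_1+\cdots+x_n)^2\Bigr)\prod_{i=1}^nd\rho(x_i),\qquad \mathbf{x}=(x_1,\dots,x_n)\in\mathbb{R}^n,$$ where $Z_n=\int\exp\bigl(\frac{\beta}{2n}(x_1+\cdots+x_n)^2\bigr)\prod_{i=1}^nd\rho(x_i)$. *)

(* Defs.v *)
From HB Require Import structures.
From mathcomp Require Import all_boot all_order all_algebra.
From mathcomp Require Import all_classical all_reals all_analysis.

Set Implicit Arguments.
Unset Strict Implicit.
Unset Printing Implicit Defensive.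

Import Order.TTheory GRing.Theory Num.Theory.
Import numFieldNormedType.Exports.

Local Open Scope ring_scope.
Local Open Scope classical_set_scope.

Section power_probability.
Context d (T : measurableType d) (R : realType).

Definition tuple_cons n (p : T * n.-tuple T) : n.+1.-tuple T :=
  [tuple of p.1 :: p.2].

Lemma measurable_tuple_cons n : measurable_fun setT (@tuple_cons n).
Proof. exact: measurable_cons measurable_fst measurable_snd. Qed.

HB.instance Definition _ n :=
  isMeasurableFun.Build _ _ _ _ (@tuple_cons n) (@measurable_tuple_cons n).

(* [power_prob P n] is the n-fold product P \x ... \x P, carried over from
   iterated pairs to tuples; it is characterised by [power_prob_box]. *)
Fixpoint power_prob (P : probability T R) (n : nat) :
    probability (n.-tuple T) R :=
  if n is m.+1 then
    distribution (P \x power_prob P m)%E (@tuple_cons m)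
  else \d_([tuple] : 0.-tuple T).

Lemma power_prob_box (P : probability T R) n (A : 'I_n -> set T) :
  (forall i, measurable (A i)) ->
  power_prob P n [set x | forall i, A i (tnth x i)] = (\prod_(i < n) P (A i))%E.
Proof.
elim: n A => [|n IHn] A mA.
  rewrite big_ord0 /= diracE mem_set//.
  by move=> [[]].
rewrite big_ord_recl -IHn//= /distribution /pushforward /=.
rewrite -product_measure1E//; last first.
  rewrite [X in measurable X](_ : _ =
      \bigcap_(i in [set: 'I_n]) ((@tnth _ T ^~ i) @^-1` A (lift ord0 i))).
    apply: fin_bigcap_measurable => // i _.
    by rewrite -[X in measurable X]setTI; exact: measurable_tnth.
  by apply/seteqP; split => x /= h i; [move=> _; exact: h | exact: h].
congr (_ _); apply/seteqP; split => -[x t] /=.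
  move=> h; split; first by have := h ord0; rewrite /tuple_cons /= tnth0.
  by move=> i; have := h (lift ord0 i); rewrite /tuple_cons /= tnthS.
by move=> [h0 h] i; case: (unliftP ord0 i) => [j|] ->;
  rewrite /tuple_cons /= ?tnthS ?tnth0.
Qed.

End power_probability.

Section curie_weiss.
Context {R : realType}.
Implicit Types (rho : probability (measurableTypeR R) R) (beta : R).

Definition symmetric_about0 rho :=
  forall A : set R, measurable A -> rho (-%R @^-1` A) = rho A.

Definition compactly_supported rho := exists L : R, rho `[- L, L]%classic = 1%E.

(* Equality of laws is required on measurable sets only: both sides are total
   set functions whose values elsewhere are meaningless. *)
Definition has_law d (Omega : measurableType d) d' (T : measurableType d')
    (P : probability Omega R) (X : {RV P >-> T}) (mu : set T -> \bar R) :=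
  forall A, measurable A -> distribution P X A = mu A.

Definition CW_weight beta n (x : n.-tuple R) : R :=
  expR (beta / (2 * n%:R) * (\sum_(i < n) tnth x i) ^+ 2).

(* Rintegral returns 0 when the integral is +oo; in that case CW_law is null and
   no random vector has it as its law. *)
Definition CW_Z rho beta n : R :=
  \int[power_prob rho n]_x CW_weight beta x.

Definition CW_law rho beta n (A : set (n.-tuple (measurableTypeR R))) :
    \bar R :=
  ((CW_Z rho beta n)^-1%:E *
   \int[power_prob rho n]_(x in A) (CW_weight beta x)%:E)%E.

Definition CW_h rho (s : R) : R :=
  s ^+ 2 / 2 - ln (\int[rho]_x expR (s * x)).

Definition magnetization n (x : n.-tuple R) : R :=
  n%:R^-1 * \sum_(i < n) tnth x i.

Definition limit_kernel rho (k : nat) (y : R) : R :=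
  expR (- ((CW_h rho)^`(2 * k)%classic 0 * y ^+ (2 * k) / (2 * k)`!%:R)).

Definition limit_density rho (k : nat) (y : R) : R :=
  (\int[lebesgue_measure]_t limit_kernel rho k t)^-1 * limit_kernel rho k y.

Definition has_density d (Omega : measurableType d) (P : probability Omega R)
    (Y : {RV P >-> measurableTypeR R}) (p : R -> R) :=
  has_law Y (fun A => \int[lebesgue_measure]_(y in A) (p y)%:E)%E.

End curie_weiss.

(* Main.v *)
From HB Require Import structures.
Require Import Defs.
From mathcomp Require Import all_boot all_order all_algebra.
From mathcomp Require Import all_classical all_reals all_analysis.
From mathcomp Require Import measurable_realfun.
From mathcomp Require Import ring lra zify.

Set Implicit Arguments.
Unset Strict Implicit.
Unset Printing Implicit Defensive.

Import Order.TTheory GRing.Theory Num.Theory.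
Import numFieldNormedType.Exports.

Local Open Scope ring_scope.
Local Open Scope classical_set_scope.

(** Write [W] for the normalised magnetization, [b = n^(1/2k)], [q z] for the tail
of the limit law at [z], [h] for the function of the statement (its value is the
gap between the Gaussian exponent [s^2/2] and the log-Laplace transform of a
spin) and [g y = h^(2k)(0) y^(2k-1) / (2k-1)!] for the drift of the limit law,
whose density is proportional to [exp (- int g)]. The proof is Stein's method,
carried out in a scale in which every error is relative to [q z].

Single out one spin [X]. If the others sum to [T], put [s = T / n], [V = b s]; by
the form of the Gibbs weight, the conditional law of [X] is that of a single spin
reweighted by [exp (s X + X^2 / (2 n))], with mean [mu] and variance [v].
Exchangeability and the definition of [mu] give, for every test function [f],
  [E ((T - (n-1) mu) f W) = (n-1) E ((X - mu) (f W - f W'))],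
where [W'] is [W] with [X] replaced by [mu] ([stein_identity]). Because
[h' s = s - mu] up to [O(s/n)], because [h'] agrees with its leading Taylor term
up to a relative error [s^2] (it is odd), and because [v = 1 + O(s^2 + 1/n)], this
is an approximate form of [E (g V f V) = E (f' V)], with errors of order
[b^-2 = n^(-1/k)] times powers of [1 + |V|] ([spin_coeff_bounds]). Note that [W]
moves by at most [delta = b L / n] with [X], and [delta] is at most of order
[b^-2] after the trade made in [shift_size_bounds].

Take for [f] the solution of [f' = g f + q z - 1_(z, oo)]. The identity then
compares [P (V > z)] with [q z]. To obtain a relative error, note that [f], [g f]
and the indicator are all bounded by [q z] times a power of [1 + |w|] times
[exp (a min(|w|, z)^2k)], where [a = h^(2k)(0) / (2k)!] ([stein_sol_bound],
[stein_drift_le], [stein_one_bound]). So it remains to bound the expectation of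
such weights by powers of [1 + z] ([cw_moment]): a Gaussian linearisation of the
square in the Gibbs weight turns it into a one-dimensional integral against
[exp (- n h)] ([gauss_upper]), on which the Taylor expansion of [h] is accurate up
to [z = O(n^(1/(k(2k+2))))] and the growth of [h] takes over beyond. This is
where the range of [z] and the uniqueness of the critical point of [h] enter.

Finally [V] is replaced by [W] at the price of a shift of [z] by [O(delta)], which
changes [q z] by a factor [1 + O(delta (1 + z)^(2k-1))] ([cw_tail_ratio]), and the
almost surely bounded spins of the model are replaced by bounded ones
([CW_integral_clamp]). *)

(** * Integrals of bounded measurable functions *)

Section bounded_measurable.
Context d (T : measurableType d) (R : realType).
Implicit Types f g : T -> R.

(** Compactly supported spins make every integrand over a probability space
bounded, and this class is stable under the operations that occur below, so it
settles all integrability and Fubini side conditions at once. *)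
Definition bmfun f := measurable_fun setT f /\ exists M, forall x, `|f x| <= M.

Lemma bmfun_cst (a : R) : bmfun (fun=> a).
Proof. by split; [exact: measurable_cst|exists `|a|]. Qed.

Lemma bmfunD f g : bmfun f -> bmfun g -> bmfun (fun x => f x + g x).
Proof.
move=> [mf [M fM]] [mg [N gN]]; split; first exact: measurable_funD.
by exists (M + N) => x; rewrite (le_trans (ler_normD _ _))// lerD.
Qed.

Lemma bmfunM f g : bmfun f -> bmfun g -> bmfun (fun x => f x * g x).
Proof.
move=> [mf [M fM]] [mg [N gN]]; split; first exact: measurable_funM.
by exists (M * N) => x; rewrite normrM ler_pM.
Qed.

Lemma bmfunN f : bmfun f -> bmfun (fun x => - f x).
Proof.
move=> [mf [M fM]]; split; first exact: measurableT_comp.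
by exists M => x; rewrite normrN.
Qed.

Lemma bmfunB f g : bmfun f -> bmfun g -> bmfun (fun x => f x - g x).
Proof. by move=> bf bg; apply: bmfunD => //; exact: bmfunN. Qed.

Lemma bmfunX f n : bmfun f -> bmfun (fun x => f x ^+ n).
Proof.
move=> [mf [M fM]]; split; first exact: measurable_funX.
by exists (M ^+ n) => x; rewrite normrX lerXn2r// nnegrE// (le_trans _ (fM x)).
Qed.

Lemma bmfun_continuous_comp (g : R -> R) f :
  continuous g -> bmfun f -> bmfun (fun x => g (f x)).
Proof.
move=> cg [mf [M fM]]; split.
  by apply: measurableT_comp mf; exact: continuous_measurable_fun.
have [M0|M0] := leP 0 M; last first.
  by exists 0 => x; have := le_trans (normr_ge0 (f x)) (fM x); rewrite leNgt M0.
have MM : - M <= M by rewrite (le_trans _ M0)// oppr_le0.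
have cg' : {within `[- M, M], continuous (fun x => `|g x|)}.
  apply: continuous_subspaceT => x; apply: continuous_comp; first exact: cg.
  exact: norm_continuous.
have [c _ cM] := EVT_max MM cg'.
by exists `|g c| => x; apply: cM; rewrite in_itv/= -ler_norml.
Qed.

Lemma bmfun_bool (b : T -> bool) : measurable_fun setT b ->
  bmfun (fun x => (b x)%:R : R).
Proof.
move=> mb; split; last by exists 1 => x; case: (b x); rewrite ?normr1 ?normr0.
apply: (measurableT_comp (f := fun c : bool => c%:R : R)) => //.
Qed.

Lemma bmfun_lt (f : T -> R) (a : R) : bmfun f ->
  bmfun (fun x => (a < f x)%R%:R : R).
Proof.
move=> [mf _]; apply: bmfun_bool.
by apply: measurable_fun_ltr => //; exact: measurable_cst.
Qed.

Lemma bmfun_le f (a : R) : bmfun f -> bmfun (fun x => (a <= f x)%R%:R : R).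
Proof.
move=> bf; rewrite (_ : (fun _ => _) = (fun x => 1 - (- a < - f x)%R%:R)).
  by apply: bmfunB; [exact: bmfun_cst|apply: bmfun_lt; exact: bmfunN].
by apply/funext => x; rewrite ltrN2; case: leP => _; rewrite ?subr0 ?subrr.
Qed.

Lemma bmfun_integrable (P : probability T R) f :
  bmfun f -> P.-integrable setT (EFin \o f).
Proof.
move=> [mf [M fM]]; apply: measurable_bounded_integrable => //.
  by apply: (@le_lt_trans _ _ 1%E); [exact: probability_le1|exact: ltry].
exists M; split; first exact: num_real.
by move=> y My x _; rewrite /= (le_trans (fM x))// ltW.
Qed.

Lemma ler_Rint (P : probability T R) f g : bmfun f -> bmfun g ->
  (forall x, f x <= g x) -> \int[P]_x f x <= \int[P]_x g x.
Proof. by move=> bf bg fg; apply: le_Rintegral => //; exact: bmfun_integrable. Qed.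

Lemma RintD (P : probability T R) f g : bmfun f -> bmfun g ->
  \int[P]_x (f x + g x) = \int[P]_x f x + \int[P]_x g x.
Proof. by move=> bf bg; apply: RintegralD => //; exact: bmfun_integrable. Qed.

Lemma RintB (P : probability T R) f g : bmfun f -> bmfun g ->
  \int[P]_x (f x - g x) = \int[P]_x f x - \int[P]_x g x.
Proof. by move=> bf bg; apply: RintegralB => //; exact: bmfun_integrable. Qed.

Lemma RintZl (P : probability T R) (a : R) f : bmfun f ->
  \int[P]_x (a * f x) = a * \int[P]_x f x.
Proof. by move=> bf; apply: RintegralZl => //; exact: bmfun_integrable. Qed.

Lemma Rint_cst (P : probability T R) (a : R) : \int[P]_x a = a.
Proof.
rewrite Rintegral_cst//; transitivity (a * fine 1%E); last exact: mulr1.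
by congr (_ * fine _); exact: probability_setT.
Qed.

Lemma ler_norm_Rint (P : probability T R) f g : bmfun f -> bmfun g ->
  (forall x, `|f x| <= g x) -> `|\int[P]_x f x| <= \int[P]_x g x.
Proof.
move=> bf bg fg; apply: le_trans (le_normr_Rintegral _ _) _ => //.
  exact: bmfun_integrable.
apply: ler_Rint => //.
by apply: bmfun_continuous_comp bf; exact: norm_continuous.
Qed.

Lemma EFin_Rint (P : probability T R) f : bmfun f ->
  ((\int[P]_x f x)%:E = \int[P]_x (f x)%:E)%E.
Proof.
move=> bf; rewrite fineK//; apply: integrable_fin_num => //.
exact: bmfun_integrable.
Qed.

End bounded_measurable.

Lemma bmfun_comp d1 d2 (T1 : measurableType d1) (T2 : measurableType d2)
    (R : realType) (f : T2 -> R) (phi : T1 -> T2) :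
  bmfun f -> measurable_fun setT phi -> bmfun (fun x => f (phi x)).
Proof.
move=> [mf [M fM]] mphi; split; first exact: measurableT_comp mf mphi.
by exists M => x.
Qed.

Section fubini_bounded.
Context d1 d2 (T1 : measurableType d1) (T2 : measurableType d2) (R : realType).
Variables (P1 : probability T1 R) (P2 : probability T2 R).
Variable G : T1 * T2 -> R.
Hypothesis bG : bmfun G.

Lemma bmfun_pair1 x : bmfun (fun y => G (x, y)).
Proof.
case: bG => mG [M GM]; split; last by exists M => y; exact: GM.
exact: measurableT_comp mG (pair1_measurable x).
Qed.

Lemma bmfun_pair2 y : bmfun (fun x => G (x, y)).
Proof.
case: bG => mG [M GM]; split; last by exists M => x; exact: GM.
exact: measurableT_comp mG (pair2_measurable y).
Qed.

Let iG : (P1 \x P2)%E.-integrable setT (EFin \o G).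
Proof. exact: (@bmfun_integrable _ _ _ (P1 \x P2)%E). Qed.

Lemma bmfun_Rint1 : bmfun (fun x => \int[P2]_y G (x, y)).
Proof.
split.
  have := @measurable_fubini_F _ _ _ _ _ P1 P2 _ iG.
  move=> /(measurableT_comp (@fine_measurable _ _ measurableT)).
  exact.
case: (bG) => mG [M GM]; exists M => x.
rewrite -[leRHS](@Rint_cst _ _ _ P2); apply: ler_norm_Rint => //.
  exact: bmfun_pair1.
exact: bmfun_cst.
Qed.


Lemma Rint_prod1 :
  \int[(P1 \x P2)%E]_z G z = \int[P1]_x \int[P2]_y G (x, y).
Proof.
congr fine; rewrite -integral12_prod_meas1//; apply: eq_integral => x _.
by rewrite EFin_Rint//; exact: bmfun_pair1.
Qed.

Lemma Rint_prod2 :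
  \int[(P1 \x P2)%E]_z G z = \int[P2]_y \int[P1]_x G (x, y).
Proof.
congr fine; rewrite -integral21_prod_meas1//; apply: eq_integral => x _.
by rewrite EFin_Rint//; exact: bmfun_pair2.
Qed.

End fubini_bounded.

(** * One-variable calculus *)

Section calculus.
Context {R : realType}.
Implicit Types (f df : R -> R).

Lemma ler_eq (x y : R) : x = y -> x <= y.
Proof. by move=> ->. Qed.

Lemma is_derive_eqr (f : R -> R) (x a b : R) :
  is_derive x 1 f a -> a = b -> is_derive x 1 f b.
Proof. by move=> H <-. Qed.

Lemma is_derive_cstM (f : R -> R) (x c df : R) :
  is_derive x 1 f df -> is_derive x 1 (fun s => c * f s) (c * df).
Proof. by move=> dfE; exact: (is_deriveZ c dfE). Qed.

Lemma is_derive_Xn (x : R) m :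
  is_derive x 1 (fun s : R => s ^+ m) (m%:R * x ^+ m.-1).
Proof.
have := is_deriveX m (is_derive_id x 1).
by rewrite exprfctE => H; apply: (is_derive_eqr H); exact: mulr1.
Qed.

Lemma is_derive_Mr (f g : R -> R) (x df dg : R) :
  is_derive x 1 f df -> is_derive x 1 g dg ->
  is_derive x 1 (fun s => f s * g s) (f x * dg + g x * df).
Proof. by move=> dfE dgE; exact: (is_deriveM dfE dgE). Qed.

Lemma is_derive_Vr (f : R -> R) (x df : R) : f x != 0 ->
  is_derive x 1 f df -> is_derive x 1 (fun s => (f s)^-1) (- (f x)^-2 * df).
Proof. by move=> f0 dfE; exact: (is_deriveV f0 dfE). Qed.

Lemma is_derive_Br (f g : R -> R) (x df dg : R) :
  is_derive x 1 f df -> is_derive x 1 g dg ->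
  is_derive x 1 (fun s => f s - g s) (df - dg).
Proof. by move=> dfE dgE; exact: (is_deriveB dfE dgE). Qed.

Lemma is_derive_expR_comp (f : R -> R) (x df : R) :
  is_derive x 1 f df -> is_derive x 1 (fun s => expR (f s)) (expR (f x) * df).
Proof. by move=> dfE; exact: (is_derive1_comp (is_derive_expR _) dfE). Qed.

Lemma is_derive_continuous f df :
  (forall x : R, is_derive x 1 f (df x)) -> continuous f.
Proof.
move=> dfE x; apply: differentiable_continuous.
by apply/derivable1_diffP; exact: (@ex_derive _ _ _ _ _ _ _ (dfE x)).
Qed.

Lemma MVT_le f df (a b D : R) : a <= b ->
  (forall x, a < x < b -> is_derive x 1 f (df x)) ->
  {within `[a, b], continuous f} ->
  (forall x, a < x < b -> df x <= D) -> f b - f a <= D * (b - a).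
Proof.
rewrite le_eqVlt => /predU1P[->|ab] dfE cf dfD; first by rewrite !subrr mulr0.
have dfE' x : x \in `]a, b[%R -> is_derive x 1 f (df x).
  by rewrite in_itv => /= /dfE.
have [c] := @MVT _ f df a b ab dfE' cf.
rewrite in_itv/= => cab ->; rewrite ler_wpM2r ?dfD//.
by rewrite subr_ge0 ltW.
Qed.

Lemma MVT_ge f df (a b D : R) : a <= b ->
  (forall x, a < x < b -> is_derive x 1 f (df x)) ->
  {within `[a, b], continuous f} ->
  (forall x, a < x < b -> D <= df x) -> D * (b - a) <= f b - f a.
Proof.
rewrite le_eqVlt => /predU1P[->|ab] dfE cf dfD; first by rewrite !subrr mulr0.
have dfE' x : x \in `]a, b[%R -> is_derive x 1 f (df x).
  by rewrite in_itv => /= /dfE.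
have [c] := @MVT _ f df a b ab dfE' cf.
rewrite in_itv/= => cab ->; rewrite ler_wpM2r ?dfD//.
by rewrite subr_ge0 ltW.
Qed.

Lemma MVT_norm_le f df (a b D : R) :
  (forall x : R, is_derive x 1 f (df x)) ->
  (forall x, `|x - a| <= `|b - a| -> `|df x| <= D) ->
  `|f b - f a| <= D * `|b - a|.
Proof.
move=> dfE dfD.
have cf u v : {within `[u, v], continuous f}.
  apply: continuous_subspaceT; exact: is_derive_continuous dfE.
have [ab|/ltW ba] := leP a b.
  have [c] := @MVT_segment _ f df a b ab (fun x _ => dfE x) (cf _ _).
  rewrite in_itv/= => /andP[ac cb] ->; rewrite normrM ler_wpM2r//; apply: dfD.
  by rewrite !ger0_norm ?subr_ge0// lerD2r.
have [c] := @MVT_segment _ f df b a ba (fun x _ => dfE x) (cf _ _).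
rewrite in_itv/= distrC (distrC b) => /andP[bc ca] ->; rewrite normrM ler_wpM2r//.
apply: dfD; rewrite distrC (distrC b).
by rewrite !ger0_norm ?subr_ge0// lerD2l lerN2.
Qed.

Lemma continuous_bounded_segment f (r : R) : continuous f ->
  exists2 C, 0 <= C & forall x, `|x| <= r -> `|f x| <= C.
Proof.
move=> cf; have [r0|r0] := leP 0 r; last first.
  exists 0 => // x xr; have := le_trans (normr_ge0 x) xr.
  by rewrite leNgt r0.
have cf' : {within `[- r, r], continuous (fun x => `|f x|)}.
  apply: continuous_subspaceT => x; apply: continuous_comp; first exact: cf.
  exact: norm_continuous.
have [|c _ cM] := EVT_max _ cf'; first by rewrite (le_trans _ r0)// oppr_le0.
by exists `|f c| => // x xr; apply: cM; rewrite in_itv/= -ler_norml.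
Qed.

(** Taylor with vanishing lower coefficients, by integrating the top bound [m]
times with the mean value theorem; [F] lists the successive derivatives. *)
Lemma taylor_flat_le (F : nat -> R -> R) m (C r : R) :
  (forall i (x : R), is_derive x 1 (F i) (F i.+1 x)) ->
  (forall i, (i < m)%N -> F i 0 = 0) ->
  (forall x, `|x| <= r -> `|F m x| <= C) ->
  forall x, `|x| <= r -> `|F 0%N x| <= C * `|x| ^+ m.
Proof.
elim: m F => [|m IH] F dF F0 FC x xr; first by rewrite mulr1 FC.
have := @MVT_norm_le (F 0%N) (F 1%N) 0 x (C * `|x| ^+ m) (dF 0%N).
rewrite F0// !subr0 exprSr mulrA; apply => c; rewrite subr0 => cx'.
apply: le_trans (IH (fun i => F i.+1) _ _ _ c _) _ => //.
- by move=> i im; apply: F0.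
- exact: le_trans xr.
- apply: ler_wpM2l; last by rewrite lerXn2r// nnegrE.
  by apply: le_trans (FC 0 _) => //; rewrite normr0 (le_trans _ xr).
Qed.

(** A quadratic remainder identifies a derivative: the form in which a Taylor
bound uniform in the sample point passes under an integral sign. *)
Lemma is_derive_quadratic f (s d C : R) :
  (forall r, `|r| <= 1 -> `|f (s + r) - f s - r * d| <= C * r ^+ 2) ->
  is_derive s 1 f d.
Proof.
move=> H; apply/is_derive1_caratheodory.
exists (fun z => if z == s then d else (f z - f s) / (z - s)); split.
- move=> z; case: eqVneq => [->|zs]; first by rewrite !subrr mulr0.
  by rewrite divfK// subr_eq0.
- rewrite /prop_for/continuous_at eqxx; apply/cvgrPdist_le => /= e e0.
  have C0 : 0 <= C.
    by have := H 1; rewrite normr1 expr1n mulr1 => /(_ (lexx _)); apply: le_trans.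
  near=> z; case: eqVneq => [_|zs]; first by rewrite subrr normr0 ltW.
  have zs0 : z - s != 0 by rewrite subr_eq0.
  have zs1 : `|z - s| <= 1.
    by rewrite distrC; near: z; apply: cvgr_dist_le => //; exact: cvg_id.
  have := H (z - s) zs1; rewrite (addrC s) subrK => Hz.
  rewrite distrC -[X in `|X|](mulfK zs0) mulrBl mulfVK// normrM normfV.
  rewrite ler_pdivrMr ?normr_gt0// (mulrC d).
  rewrite (le_trans Hz)// -real_normK ?num_real// expr2 mulrA ler_wpM2r//.
  have : `|s - z| <= e / (C + 1).
    near: z; apply: cvgr_dist_le; first exact: cvg_id.
    by rewrite divr_gt0// ltr_wpDl.
  rewrite distrC ler_pdivlMr ?ltr_wpDl// => /(le_trans _); apply.
  by rewrite mulrC ler_wpM2l// lerDl.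
- by rewrite eqxx.
Unshelve. all: by end_near. Qed.

Lemma expR_sub1_ub (x : R) : expR x - 1 <= x * expR x.
Proof.
have : (1 - x) * expR x <= 1.
  rewrite -[leRHS](expRxMexpNx_1 x) mulrC ler_wpM2l ?expR_ge0//.
  by have := expR_ge1Dx (- x); lra.
by lra.
Qed.

Lemma expR_sub1_le (y : R) : `|expR y - 1 - y| <= y ^+ 2 * expR `|y|.
Proof.
rewrite ger0_norm; last by have := expR_ge1Dx y; lra.
have h1 : expR y - 1 - y <= y * (expR y - 1) by have := expR_sub1_ub y; lra.
apply: le_trans h1 _; have [y0|y0] := leP 0 y.
  rewrite (ger0_norm y0) expr2 -mulrA ler_wpM2l//; exact: expR_sub1_ub.
rewrite (ltr0_norm y0).
have : (- y) * (1 - expR y) <= (- y) * (- y).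
  by rewrite ler_wpM2l; have := expR_ge1Dx y; lra.
have : y ^+ 2 * 1 <= y ^+ 2 * expR (- y).
  by rewrite ler_wpM2l ?sqr_ge0// -[leLHS]expR0 ler_expR; lra.
by lra.
Qed.

End calculus.

(** * Tilted moments *)

Section tilted_moments.
Context d (T : measurableType d) (R : realType) (P : probability T R).
Variables (X u : T -> R).
Hypotheses (bX : bmfun X) (bu : bmfun u).

(** Unnormalised moments of the law of [X] tilted by [expR (s * X)] and
reweighted by [u]. The choice [u = 1] gives the derivatives of the moment
generating function; [spin_weight] below gives the law of one spin given the
others. *)
Definition tilt_mom (j : nat) (s : R) : R :=
  \int[P]_x (X x ^+ j * expR (s * X x) * u x).

Lemma bmfun_expR (s : R) : bmfun (fun x => expR (s * X x)).
Proof.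
apply: bmfun_continuous_comp; first exact: continuous_expR.
by apply: bmfunM => //; exact: bmfun_cst.
Qed.

Lemma bmfun_tilt_mom j s : bmfun (fun x => X x ^+ j * expR (s * X x) * u x).
Proof.
by apply: bmfunM => //; apply: bmfunM (bmfun_expR s); exact: bmfunX.
Qed.

Lemma is_derive_tilt_mom j (s : R) :
  is_derive s 1 (tilt_mom j) (tilt_mom j.+1 s).
Proof.
have [_ [M XM]] := bX; have [_ [N uN]] := bu.
have bexp := bmfun_expR; have bmom := bmfun_tilt_mom.
apply: (@is_derive_quadratic _ _ _ _
  (M ^+ j * expR (`|s| * M) * (M ^+ 2 * expR M) * N)) => r r1.
rewrite /tilt_mom -RintZl; last exact: bmom.
have bdiff : bmfun (fun x => X x ^+ j * expR ((s + r) * X x) * u x -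
    X x ^+ j * expR (s * X x) * u x) by apply: bmfunB; exact: bmom.
have brm : bmfun (fun x => r * (X x ^+ j.+1 * expR (s * X x) * u x)).
  by apply: bmfunM; [exact: bmfun_cst|exact: bmom].
rewrite -RintB; [|exact: bmom..].
rewrite -RintB//.
rewrite -[leRHS](@Rint_cst _ _ _ P).
apply: ler_norm_Rint; [|exact: bmfun_cst|].
  exact: bmfunB.
move=> x.
have -> : X x ^+ j * expR ((s + r) * X x) * u x - X x ^+ j * expR (s * X x) * u x
   - r * (X x ^+ j.+1 * expR (s * X x) * u x) =
  X x ^+ j * expR (s * X x) * (expR (r * X x) - 1 - r * X x) * u x.
  by rewrite mulrDl expRD exprSr; ring.
rewrite !normrM normrX (ger0_norm (expR_ge0 _)) mulrAC.
have M0 : 0 <= M by apply: le_trans (XM x).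
have rXM : `|r * X x| <= M by rewrite normrM -[leRHS]mul1r ler_pM.
have h1 : `|X x| ^+ j <= M ^+ j by rewrite lerXn2r// nnegrE.
have h2 : expR (s * X x) <= expR (`|s| * M).
  by rewrite ler_expR (le_trans (ler_norm _))// normrM ler_wpM2l.
have h3 : `|expR (r * X x) - 1 - r * X x| <= M ^+ 2 * expR M * r ^+ 2.
  apply: (le_trans (expR_sub1_le _)); 
  have -> : (r * X x) ^+ 2 * expR `|r * X x| = X x ^+ 2 * expR `|r * X x| * r ^+ 2.
    by ring.
  rewrite ler_wpM2r ?sqr_ge0//; apply: ler_pM; rewrite ?sqr_ge0 ?expR_ge0//.
    by rewrite -[leLHS]real_normK ?num_real// lerXn2r ?nnegrE.
  by rewrite ler_expR.
have -> : M ^+ j * expR (`|s| * M) * (M ^+ 2 * expR M) * N * r ^+ 2 =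
  M ^+ j * expR (`|s| * M) * N * (M ^+ 2 * expR M * r ^+ 2) by ring.
by apply: ler_pM => //; rewrite ?mulr_ge0 ?exprn_ge0 ?expR_ge0//;
  apply: ler_pM => //; rewrite ?mulr_ge0 ?exprn_ge0 ?expR_ge0//;
  apply: ler_pM => //; rewrite ?mulr_ge0 ?exprn_ge0 ?expR_ge0.
Qed.

Lemma continuous_tilt_mom j : continuous (tilt_mom j).
Proof. exact: is_derive_continuous (is_derive_tilt_mom j). Qed.

End tilted_moments.
(** * Elementary estimates and continuity *)

Lemma expR_sub1_norm {R : realType} (y : R) : `|expR y - 1| <= `|y| * expR `|y|.
Proof.
have [y0|y0] := leP 0 y.
  by rewrite !ger0_norm ?expR_sub1_ub//; have := expR_ge1Dx y; lra.
rewrite !ltr0_norm ?subr_lt0 ?expR_lt1//.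
have := expR_ge1Dx y.
have : (- y) * 1 <= (- y) * expR (- y).
  by rewrite ler_wpM2l; [|lra|rewrite -[leLHS]expR0 ler_expR; lra].
by lra.
Qed.

Lemma sqr_norm_le {R : realType} (x b : R) : `|x| <= b -> x ^+ 2 <= b ^+ 2.
Proof.
move=> xb; rewrite -[leLHS]real_normK ?num_real// lerXn2r// nnegrE.
by rewrite (le_trans _ xb).
Qed.

Lemma expR_sqr_sub1_le {R : realType} (eps b y : R) : 0 <= eps <= 1 -> `|y| <= b ->
  `|expR (eps / 2 * y ^+ 2) - 1| <= eps * (b ^+ 2 * expR (b ^+ 2)).
Proof.
move=> /andP[e0 e1] /sqr_norm_le yb; have y20 := sqr_ge0 y.
apply: le_trans (expR_sub1_norm _) _.
have ey0 : 0 <= eps / 2 * y ^+ 2 by rewrite mulr_ge0 ?divr_ge0.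
have eyb : eps / 2 * y ^+ 2 <= eps * b ^+ 2 by nra.
have -> : eps * (b ^+ 2 * expR (b ^+ 2)) = (eps * b ^+ 2) * expR (b ^+ 2) by ring.
by rewrite (ger0_norm ey0); apply: ler_pM; rewrite ?expR_ge0// ler_expR; nra.
Qed.

(** Perturbation of a quotient, arranged so that the size of [a / b] multiplies
the error of the denominator. *)
Lemma ratio_diff_le {R : realType} (a b a' b' c Q D E : R) :
  0 < c -> 0 < b -> c <= b' -> `|a / b| <= Q -> `|a - a'| <= D ->
  `|b - b'| <= E -> `|a / b - a' / b'| <= D / c + Q * E / c.
Proof.
move=> c0 b0 cb' Qab Daa Ebb; have b'0 : 0 < b' by apply: lt_le_trans cb'.
have -> : a / b - a' / b' = (a - a') / b' - (a / b) * (b - b') / b'.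
  by field; rewrite !gt_eqF.
have ib : `|b'^-1| <= c^-1.
  by rewrite normfV gtr0_norm// lef_pV2 ?posrE.
rewrite (le_trans (ler_normB _ _))// lerD// !normrM; apply: ler_pM => //.
by rewrite -normrM; apply: (le_trans (y := `|a / b| * `|b - b'|)); rewrite ?normrM// -normrM ler_pM.
Qed.

Lemma continuous_scaled_expR {R : realType} (c : R) :
  continuous (fun y : R => expR (c * y)).
Proof. exact: (is_derive_continuous (fun x => is_derive_expR_comp
  (is_derive_cstM c (is_derive_id x 1)))). Qed.

Lemma continuous_sqr_expR {R : realType} (c : R) :
  continuous (fun y : R => expR (c * y ^+ 2)).
Proof. exact: (is_derive_continuous (fun x => is_derive_expR_comp
  (is_derive_cstM c (is_derive_Xn x 2)))). Qed.

Lemma continuous_Xn {R : realType} n : continuous (fun y : R => y ^+ n).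
Proof. exact: (is_derive_continuous (fun x => is_derive_Xn x n)). Qed.

Lemma continuousMr {R : realType} (f g : R -> R) : continuous f -> continuous g ->
  continuous (fun y : R => f y * g y).
Proof. by move=> cf cg y; apply: continuousM; [exact: cf|exact: cg]. Qed.

Lemma continuousDr {R : realType} (f g : R -> R) : continuous f -> continuous g ->
  continuous (fun y : R => f y + g y).
Proof. by move=> cf cg y; apply: continuousD; [exact: cf|exact: cg]. Qed.

Lemma continuousBr {R : realType} (f g : R -> R) : continuous f -> continuous g ->
  continuous (fun y : R => f y - g y).
Proof. by move=> cf cg y; apply: continuousB; [exact: cf|exact: cg]. Qed.

Lemma continuous_idr {R : realType} : continuous (fun y : R => y).
Proof. by move=> y; exact: cvg_id. Qed.

Lemma continuous_cstr {R : realType} (c : R) : continuous (fun _ : R => c).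
Proof. by move=> y; exact: cst_continuous. Qed.

Lemma continuous_compr {R : realType} (f g : R -> R) : continuous f -> continuous g ->
  continuous (fun y : R => g (f y)).
Proof. by move=> cf cg y; apply: (@continuous_comp _ _ _ f g); [exact: cf|exact: cg]. Qed.

Lemma continuous_norm_pow {R : realType} (b : R) j :
  continuous (fun y : R => (1 + b * `|y|) ^+ j).
Proof.
have c := continuousMr (@continuous_cstr R b) (@norm_continuous R R).
exact: (continuous_compr (continuousDr (@continuous_cstr R 1) c) (@continuous_Xn R j)).
Qed.

Lemma continuous_norm1_pow {R : realType} j : continuous (fun y : R => (1 + `|y|) ^+ j).
Proof. by have := @continuous_norm_pow R 1 j; under eq_fun do rewrite mul1r. Qed.

Lemma continuous_inv_sqr {R : realType} (b : R) : 0 <= b ->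
  continuous (fun y : R => (1 + b * `|y|) ^- 2).
Proof.
move=> b0 y; apply: cvgV; last exact: continuous_norm_pow.
by rewrite gt_eqF// exprn_gt0// ltr_wpDr// mulr_ge0.
Qed.

(** The majorant is that of [gap_integrand_le]. *)
Lemma integral_inv_sqr {R : realType} (b : R) : 0 < b ->
  (\int[@lebesgue_measure R]_s ((1 + b * `|s|) ^- 2)%:E = (2 / b)%:E)%E.
Proof.
move=> b0.
have cf := continuous_inv_sqr (ltW b0).
rewrite ge0_symfun_integralT//; first last.
- by move=> s /=; rewrite normrN.
- by move=> s; rewrite invr_ge0 exprn_ge0// addr_ge0// mulr_ge0// ltW.
rewrite -set_itvcy.
have pos (s : R) : 0 <= s -> 0 < 1 + b * s by move=> s0; rewrite ltr_wpDr// mulr_ge0// ltW.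
pose F (s : R) := - (b^-1) * (1 + b * s)^-1.
have dF (s : R) : 0 <= s -> is_derive s 1 F ((1 + b * s) ^- 2).
  move=> s0; have H1 : is_derive s 1 (fun s : R => 1 + b * s) b.
    have H := is_deriveD (is_derive_cst (1 : R) s 1) (is_derive_cstM b (is_derive_id s 1)).
    by apply: (is_derive_eqr H); rewrite add0r mulr1.
  have H2 := is_derive_cstM (- b^-1) (is_derive_Vr (f := fun s => 1 + b * s) (lt0r_neq0 (pos s s0)) H1).
  by apply: (is_derive_eqr H2); field; rewrite (lt0r_neq0 (pos s s0)) lt0r_neq0.
have -> : (\int[@lebesgue_measure R]_(s in `[0%R, +oo[) ((1 + b * `|s|) ^- 2)%:E =
    \int[@lebesgue_measure R]_(s in `[0%R, +oo[) ((1 + b * s) ^- 2)%:E)%E.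
  by apply: eq_integral => s; rewrite inE/= in_itv/= andbT => s0; rewrite ger0_norm.
have cF x : 0 <= x -> {for x, continuous F}.
  move=> x0; apply: differentiable_continuous; apply/derivable1_diffP.
  exact: (@ex_derive _ _ _ _ _ _ _ (dF x x0)).
rewrite (@ge0_continuous_FTC2y R (fun s => (1 + b * s) ^- 2) F 0 0).
- by rewrite -EFinB -EFinM /F mulr0 addr0 invr1 mulr1 sub0r opprK.
- by move=> x x0; rewrite invr_ge0 exprn_ge0// ltW// pos.
- apply: (subspace_eq_continuous (f := fun s : R => (1 + b * `|s|) ^- 2)).
    by move=> s; rewrite inE/= in_itv/= andbT => s0; rewrite ger0_norm.
  exact: continuous_subspaceT.
- apply/cvgrPdist_le => /= e e0; near=> x.
  have x0 : 0 <= x by near: x; apply: nbhs_pinfty_ge; rewrite num_real.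
  rewrite sub0r /F mulNr opprK ger0_norm; last first.
    by rewrite mulr_ge0 ?invr_ge0 ?(ltW b0)// ltW// pos.
  rewrite -invfM -[leRHS]invrK lef_pV2 ?posrE ?invr_gt0 ?mulr_gt0 ?pos//.
  have xe : e^-1 / b / b <= x by near: x; apply: nbhs_pinfty_ge; rewrite num_real.
  move: xe; rewrite !ler_pdivrMr// => /le_trans; apply.
  have -> : b * (1 + b * x) = b + x * b * b by ring.
  by rewrite lerDr ltW.
- by move=> x x0; exact: (@ex_derive _ _ _ _ _ _ _ (dF x (ltW x0))).
- by apply: cvg_at_right_filter; exact: cF.
- move=> x; rewrite in_itv/= andbT => x0; rewrite derive1E.
  exact: (@derive_val _ _ _ _ _ _ _ (dF x (ltW x0))).
Unshelve. all: by end_near. Qed.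

(** [1 + u] is at most a constant times [expR (c * u / j.+1)], by
[1 + x <= expR x]; raise this to the power [j]. *)
Lemma pow_expR_le {R : realType} (c u : R) j : 0 < c -> 0 <= u ->
  (1 + u) ^+ j * expR (- (c * u)) <= (1 + j.+1%:R / c) ^+ j.
Proof.
move=> c0 u0; have J0 : 0 < j.+1%:R :> R by rewrite ltr0n.
have h : 1 + u <= (1 + j.+1%:R / c) * expR (c * u / j.+1%:R).
  apply: (@le_trans _ _ ((1 + j.+1%:R / c) * (1 + c * u / j.+1%:R))); last first.
    by rewrite ler_wpM2l ?addr_ge0 ?divr_ge0 ?(ltW c0)// expR_ge1Dx.
  have -> : (1 + j.+1%:R / c) * (1 + c * u / j.+1%:R) =
     1 + u + (j.+1%:R / c + c * u / j.+1%:R) by field; rewrite !gt_eqF.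
  by rewrite lerDl addr_ge0// divr_ge0// ?mulr_ge0 ?(ltW c0).
rewrite expRN ler_pdivrMr ?expR_gt0//.
apply: (@le_trans _ _ (((1 + j.+1%:R / c) * expR (c * u / j.+1%:R)) ^+ j)).
  by rewrite lerXn2r ?nnegrE ?mulr_ge0 ?addr_ge0 ?divr_ge0 ?expR_ge0 ?(ltW c0).
rewrite exprMn ler_wpM2l ?exprn_ge0 ?addr_ge0 ?divr_ge0 ?(ltW c0)//.
rewrite -expRM_natl ler_expR mulrCA -[leRHS]mulr1 ler_wpM2l ?mulr_ge0 ?(ltW c0)//.
by rewrite ler_pdivrMr// mul1r ler_nat.
Qed.

Lemma pow1_le {R : realType} (x : R) i j : 0 <= x -> (i <= j)%N -> (1 + x) ^+ i <= (1 + x) ^+ j.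
Proof. by move=> x0 ij; rewrite ler_weXn2l// lerDl. Qed.

Lemma pow1D_le {R : realType} (z : R) j : 0 <= z -> (1 + z) ^+ j <= 2 ^+ j * (1 + z ^+ j).
Proof.
move=> z0; have [z1|/ltW z1] := leP z 1.
  apply: (@le_trans _ _ (2 ^+ j)).
    by rewrite lerXn2r ?nnegrE ?addr_ge0//; lra.
  by rewrite ler_peMr ?exprn_ge0// lerDl exprn_ge0.
apply: (@le_trans _ _ ((2 * z) ^+ j)).
  by rewrite lerXn2r ?nnegrE ?addr_ge0 ?mulr_ge0//; lra.
by rewrite exprMn ler_wpM2l ?exprn_ge0// lerDr.
Qed.

Lemma range_le {R : realType} k (K b y : R) : 1 <= K -> 1 <= b -> 1 <= y ->
  y ^+ (2 * k + 2) <= K * b ^+ 2 -> y <= K * b.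
Proof.
move=> K1 b1 y1 yK; have K0 : 0 <= K by exact: le_trans K1.
have y2 : y ^+ 2 <= (K * b) ^+ 2.
  apply: (@le_trans _ _ (y ^+ (2 * k + 2))); first by rewrite ler_weXn2l// leq_addl.
  by apply: (le_trans yK); rewrite exprMn ler_wpM2r ?sqr_ge0// ler_eXnr.
have y0 : 0 <= y by exact: le_trans y1.
have b0 : 0 <= b by exact: le_trans b1.
by move: y2; rewrite ler_pXn2r// nnegrE mulr_ge0.
Qed.

(** [delta] bounds the effect of one spin on the normalised magnetization when
[b ^+ (2 * k)] is the number of spins. In the range [y <= K * b] one may trade
[2 * k - 3] factors [y] for factors [b], which turns an error
[delta * y ^+ (2 * k - 1)] into one of order [b ^- 2 * y ^+ 2]; this is where
[k >= 2] matters. *)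
Lemma shift_size_bounds {R : realType} k (L K b y : R) : (2 <= k)%N -> 0 <= L -> 0 < K ->
  0 < b -> 0 < y -> y <= K * b ->
  let delta := b * L / b ^+ (2 * k) in
  [/\ delta = L / b ^+ (2 * k - 1), delta * y ^+ (2 * k - 1) <= L * K ^+ (2 * k - 1) &
    delta * y ^+ (2 * k - 1) <= L * K ^+ (2 * k - 3) * (b ^- 2 * y ^+ 2)].
Proof.
move=> k2 L0 K0 b0 y0 yK delta.
have ek3 : (2 * k - 1 = (2 * k - 3) + 2)%N by lia.
have em : (2 * k = (2 * k - 1).+1)%N by lia.
have yb j : y ^+ j <= (K * b) ^+ j.
  by apply: lerXn2r => //; rewrite nnegrE ltW// mulr_gt0.
have dE : delta = L / b ^+ (2 * k - 1).
  by rewrite /delta {1}em exprSr; field; rewrite !gt_eqF// exprn_gt0.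
split=> //; rewrite {}dE mulrAC ler_pdivrMr ?exprn_gt0//.
  by rewrite -mulrA -exprMn ler_wpM2l.
rewrite ek3 !exprD.
have -> : L * K ^+ (2 * k - 3) * (b ^- 2 * y ^+ 2) * (b ^+ (2 * k - 3) * b ^+ 2) =
    L * ((K * b) ^+ (2 * k - 3) * y ^+ 2).
  by rewrite exprMn; field; rewrite gt_eqF.
by apply: ler_wpM2l => //; apply: ler_wpM2r (yb _); exact: sqr_ge0.
Qed.

(** * The cumulant gap and its derivatives *)

Section even_smooth.
Context {R : realType}.
Variable f : R -> R.
Hypothesis f_smooth : forall i (x : R), is_derive x 1 (f^`(i)%classic) (f^`(i.+1)%classic x).
Hypothesis f_even : forall x, f (- x) = f x.

Lemma derive1n_even i x : f^`(i)%classic (- x) = (-1) ^+ i * f^`(i)%classic x.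
Proof.
elim: i x => [|i IH] x; first by rewrite derive1n0 mul1r.
have D1 : is_derive x 1 (fun y : R => f^`(i)%classic (- y)) (f^`(i.+1)%classic (- x) * -1).
  by apply: (is_derive1_comp (f := f^`(i)%classic) (g := -%R)).
have D2 : is_derive x 1 (fun y : R => f^`(i)%classic (- y)) ((-1) ^+ i * f^`(i.+1)%classic x).
  have -> : (fun y => f^`(i)%classic (- y)) = (fun y => (-1) ^+ i * f^`(i)%classic y).
    by apply/funext => y; exact: IH.
  exact: (is_derive_cstM _ (f_smooth i x)).
rewrite exprS -mulrA -(@derive_val _ _ _ _ _ _ _ D2) (@derive_val _ _ _ _ _ _ _ D1).
by rewrite mulrN1 mulN1r opprK.
Qed.

(** Evenness kills the derivative of order [2 * k + 1] at 0, so the first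
correction to the leading term has relative size [s ^+ 2] and not [s]. With
[s] of order [n^(-1/2k)] this is what makes the final rate [n^(-1/k)]. *)
Lemma derive1_taylor_even k : (0 < k)%N ->
  (forall i, (i <= 2 * k - 1)%N -> f^`(i)%classic 0 = 0) ->
  let a := f^`(2 * k)%classic 0 / (2 * k)`!%:R in
  forall r, exists2 C, 0 <= C & forall s, `|s| <= r ->
    `|f^`()%classic s - (2 * k)%:R * a * s ^+ (2 * k - 1)| <= C * `|s| ^+ (2 * k + 1).
Proof.
move=> k0 flat a r.
(* [F i] is the [i]-th derivative of the Taylor remainder of [f^`()]. *)
pose F (i : nat) (s : R) := f^`(i.+1)%classic s -
  a * ((2 * k) ^_ i.+1)%:R * s ^+ (2 * k - i.+1).
have dF i (x : R) : is_derive x 1 (F i) (F i.+1 x).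
  have H := is_derive_Br (f_smooth i.+1 x) (is_derive_cstM
    (a * ((2 * k) ^_ i.+1)%:R) (is_derive_Xn x (2 * k - i.+1))).
  apply: (is_derive_eqr H); rewrite /F; congr (_ - _).
  by rewrite (ffactnSr _ i.+1) natrM (subnS _ i.+1) !mulrA.
have F0 i : (i < 2 * k + 1)%N -> F i 0 = 0.
  rewrite /F => ik; have [|i2k|i2k] := ltngtP i.+1 (2 * k).
  - by move=> ik'; rewrite flat ?expr0n; [|lia]; rewrite subn_eq0 leqNgt ik' mulr0 subrr.
  - have -> : i.+1 = (2 * k).+1 by lia.
    rewrite ffact_small// mulr0 mul0r subr0.
    have := derive1n_even (2 * k).+1 0; rewrite oppr0 exprS exprM sqrrN !expr1n.
    by lra.
  - rewrite i2k subnn mulr1 ffactnn divfK ?subrr// pnatr_eq0 -lt0n fact_gt0//.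
have [C C0 FC] := @continuous_bounded_segment _ (F (2 * k + 1)%N) r
  (is_derive_continuous (dF _)).
exists C => // s sr.
have := @taylor_flat_le _ F (2 * k + 1)%N C r dF F0 FC s sr.
by rewrite /F derive1n1 ffactn1 (mulrC a).
Qed.

End even_smooth.

Section cumulant_gap.
Context d (T : measurableType d) (R : realType) (P : probability T R).
Variable X : T -> R.
Hypothesis bX : bmfun X.

Let M := tilt_mom P X (fun=> 1).
Let b1 : bmfun (fun _ : T => 1 : R) := bmfun_cst T 1.

Lemma tilt_mom0_gt0 s : 0 < tilt_mom P X (fun=> 1) 0 s.
Proof.
have [_ [N XN]] := bX.
apply: (@lt_le_trans _ _ (expR (- (`|s| * N)))); first exact: expR_gt0.
rewrite -[leLHS](@Rint_cst _ _ _ P); apply: ler_Rint.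
- exact: bmfun_cst.
- exact: bmfun_tilt_mom.
- move=> x; rewrite mul1r mulr1 ler_expR lerNl (le_trans (ler_norm _))//.
  by rewrite normrN normrM ler_wpM2l.
Qed.

(** The rate function of the magnetization: [expR (- n * cumulant_gap s)] is the
unnormalised density of the magnetization smoothed by an independent Gaussian of
variance [1 / n]. *)
Definition cumulant_gap (s : R) := s ^+ 2 / 2 - ln (M 0 s).

(** A class of functions closed under differentiation that contains the
derivative of the cumulant gap; it makes the gap infinitely differentiable
without computing any derivative of higher order. *)
Inductive moment_algebra : (R -> R) -> Prop :=
| MAmom j : moment_algebra (M j)
| MAinv : moment_algebra (fun s => (M 0 s)^-1)
| MAid : moment_algebra id
| MAcst a : moment_algebra (fun=> a)
| MAadd f g : moment_algebra f -> moment_algebra g ->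
    moment_algebra (fun s => f s + g s)
| MAmul f g : moment_algebra f -> moment_algebra g ->
    moment_algebra (fun s => f s * g s).

Lemma moment_algebra_derive f : moment_algebra f ->
  exists2 df, moment_algebra df & forall s : R, is_derive s 1 f (df s).
Proof.
elim => {f} [j|||a|f g _ [df Adf dfE] _ [dg Adg dgE]|
  f g Af [df Adf dfE] Ag [dg Adg dgE]].
- exists (M j.+1); [exact: MAmom|move=> s; exact: is_derive_tilt_mom].
- exists (fun s => -1 * ((M 0 s)^-1 * (M 0 s)^-1) * M 1 s).
    apply: MAmul (MAmom _); apply: MAmul (MAcst _) _; apply: MAmul; exact: MAinv.
  move=> s; have dM := @is_derive_tilt_mom _ _ _ P _ _ bX b1 0 s.
  have M0 : M 0 s != 0 by rewrite gt_eqF// tilt_mom0_gt0.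
  apply: (is_derive_eqr (is_derive_Vr M0 dM)).
  by rewrite expr2 invfM mulN1r.
- by exists (fun=> 1); [exact: MAcst|move=> s; exact: is_derive_id].
- by exists (fun=> 0); [exact: MAcst|move=> s; exact: is_derive_cst].
- exists (fun s => df s + dg s); first exact: MAadd.
  by move=> s; apply: is_deriveD.
- exists (fun s => f s * dg s + g s * df s).
    by apply: MAadd; apply: MAmul.
  by move=> s; apply: is_deriveM.
Qed.

Lemma is_derive_cumulant_gap (s : R) :
  is_derive s 1 cumulant_gap (s - M 1 s / M 0 s).
Proof.
have dM := @is_derive_tilt_mom _ _ _ P _ _ bX b1 0 s.
have dl := is_derive1_ln (tilt_mom0_gt0 s).
have dlM := is_derive1_comp dl dM.
have -> : cumulant_gap = (fun s => 2^-1 * s ^+ 2 - (@ln R \o M 0) s).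
  by apply/funext => y; rewrite /cumulant_gap mulrC.
have H := is_derive_Br (is_derive_cstM 2^-1 (is_derive_Xn s 2)) dlM.
by apply: (is_derive_eqr H); rewrite expr1 mulrA mulVf ?pnatr_eq0// mul1r mulrC.
Qed.

Lemma derive1_cumulant_gap : cumulant_gap^`()%classic = (fun s => s - M 1 s / M 0 s).
Proof.
apply/funext => s; rewrite derive1E.
exact: (@derive_val _ _ _ _ _ _ _ (is_derive_cumulant_gap s)).
Qed.

Lemma cumulant_gap_smooth i (s : R) :
  is_derive s 1 (cumulant_gap^`(i)%classic) (cumulant_gap^`(i.+1)%classic s).
Proof.
have step f : (exists2 df, moment_algebra df & forall s : R, is_derive s 1 f (df s)) ->
    moment_algebra f^`()%classic /\ forall s : R, is_derive s 1 f (f^`()%classic s).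
  move=> [df Adf dfE]; have -> : f^`()%classic = df.
    by apply/funext => y; rewrite derive1E (@derive_val _ _ _ _ _ _ _ (dfE y)).
  by [].
have [H0 H0'] : moment_algebra cumulant_gap^`()%classic /\
    forall s : R, is_derive s 1 cumulant_gap (cumulant_gap^`()%classic s).
  apply: step; exists (fun s => s + -1 * (M 1 s * (M 0 s)^-1)).
    apply: MAadd MAid _; apply: MAmul (MAcst _) _; apply: MAmul (MAmom _) MAinv.
  by move=> y; rewrite mulN1r; exact: is_derive_cumulant_gap.
case: i => [|i]; first by rewrite derive1n1 derive1n0.
have A j : moment_algebra cumulant_gap^`(j.+1)%classic.
  elim: j => [|j /moment_algebra_derive/step[]]; first by rewrite derive1n1.
  by rewrite derive1nS.
by have [_] := step _ (moment_algebra_derive (A i)); rewrite -derive1nS.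
Qed.

Hypothesis X_sym : forall g : R -> R, continuous g ->
  \int[P]_x g (- X x) = \int[P]_x g (X x).

Lemma cumulant_gap_even s : cumulant_gap (- s) = cumulant_gap s.
Proof.
rewrite /cumulant_gap sqrrN; congr (_ - ln _).
rewrite /M /tilt_mom; under eq_Rintegral do rewrite mul1r mulr1 mulNr -mulrN.
under [RHS]eq_Rintegral do rewrite mul1r mulr1.
apply: (X_sym (g := fun y => expR (s * y))) => y.
apply: continuous_comp; last exact: continuous_expR.
by apply: continuousM; [exact: cst_continuous|exact: cvg_id].
Qed.

End cumulant_gap.

(** * The limit law *)

Section target_tail.
Context {R : realType}.
Variables (a : R) (k : nat).
Hypotheses (a0 : 0 < a) (k0 : (0 < k)%N).

Local Notation mu := (@lebesgue_measure R).

Definition target_fun (y : R) : R := expR (- (a * y ^+ (2 * k))).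
Definition target_drift (y : R) : R := (2 * k)%:R * a * y ^+ (2 * k - 1).
Definition target_upper (w : R) : R := \int[mu]_(t in `]w, +oo[) target_fun t.
Definition target_lower (w : R) : R := \int[mu]_(t in `]-oo, w]) target_fun t.
Definition target_mass : R := \int[mu]_t target_fun t.

Let p := target_fun.
Let g := target_drift.
Let A := target_upper.
Let B := target_lower.
Let I := target_mass.

Lemma target_fun_gt0 y : 0 < p y. Proof. exact: expR_gt0. Qed.

Lemma is_derive_target_exponent (y : R) :
  is_derive y 1 (fun y => a * y ^+ (2 * k)) (g y).
Proof.
have H := is_derive_cstM a (is_derive_Xn y (2 * k)).
by apply: (is_derive_eqr H); rewrite /g /target_drift -subn1; ring.
Qed.

Lemma is_derive_target_fun (y : R) : is_derive y 1 p (- g y * p y).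
Proof.
have H := is_derive_cstM (-1) (is_derive_target_exponent y).
have H2 := is_derive_expR_comp H.
have -> : p = (fun s : R => expR (-1 * (a * s ^+ (2 * k)))).
  by apply/funext => s; rewrite mulN1r.
by apply: (is_derive_eqr H2); rewrite mulN1r mulrC mulN1r.
Qed.

Lemma continuous_target_fun : continuous p.
Proof. exact: is_derive_continuous is_derive_target_fun. Qed.

Lemma measurable_target_fun : measurable_fun setT p.
Proof. by apply: continuous_measurable_fun; exact: continuous_target_fun. Qed.

Lemma target_fun_even y : p (- y) = p y.
Proof. by rewrite /p /target_fun exprNn exprM sqrrN !expr1n mul1r. Qed.

Lemma target_exponent_ge y : a * y ^+ 2 - a <= a * y ^+ (2 * k).
Proof.
suff : a * (y ^+ 2 - 1) <= a * y ^+ (2 * k) by rewrite mulrBr mulr1.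
rewrite ler_wpM2l ?(ltW a0)//.
have [y1|y1] := leP 1 (y ^+ 2).
  have : y ^+ 2 <= (y ^+ 2) ^+ k by rewrite -[leLHS]expr1 ler_weXn2l.
  by rewrite -exprM; lra.
have : 0 <= (y ^+ 2) ^+ k by rewrite exprn_ge0// sqr_ge0.
by rewrite -exprM; lra.
Qed.

Lemma integrable_target_fun : mu.-integrable setT (EFin \o p).
Proof.
pose s : R := Num.sqrt (2 * a)^-1.
have a2 : 0 < (2 * a)^-1 by rewrite invr_gt0 mulr_gt0.
have s0 : s != 0 by rewrite gt_eqF// sqrtr_gt0.
have pk := normal_peak_gt0 s0.
have iN := @integrable_normal_pdf R 0 s.
have := integrableZl measurableT (expR a * (normal_peak s)^-1) iN.
apply: le_integrable => //.
  by apply/measurable_EFinP; exact: measurable_target_fun.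
move=> y _ /=; rewrite lee_fin normal_pdfE// /normal_fun subr0.
rewrite ger0_norm ?(ltW (target_fun_gt0 _))// normrM ger0_norm; last first.
  by rewrite mulr_ge0 ?expR_ge0// invr_ge0 ltW.
rewrite ger0_norm; last by rewrite mulr_ge0 ?expR_ge0// ltW.
rewrite -mulrA mulKf ?gt_eqF// -expRD ler_expR.
rewrite /s sqr_sqrtr ?(ltW a2)//.
have -> : - y ^+ 2 / ((2 * a)^-1 *+ 2) = - (a * y ^+ 2).
  by field; rewrite gt_eqF.
by have := target_exponent_ge y; rewrite -lerN2 opprB.
Qed.

Let integrableS (D : set R) : measurable D -> mu.-integrable D (EFin \o p).
Proof. by move=> mD; apply: integrableS integrable_target_fun. Qed.

Lemma is_derive_target_lower (w : R) : is_derive w 1 B (p w).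
Proof.
have wu : w < w + 1 by rewrite ltrDl.
have ip : mu.-integrable `]-oo, (w + 1)] (EFin \o p) by exact: integrableS.
have [||dB dBE] := @continuous_FTC1 R p -oo%O w (w + 1) wu ip.
- by rewrite ltNyr.
- exact: continuous_target_fun.
by rewrite -dBE derive1E; apply/derivableP.
Qed.

Lemma target_massE w : I = B w + A w.
Proof.
rewrite /I /target_mass -(@setUv _ `]-oo, w]) setCitvl/=.
rewrite Rintegral_setU//; last 2 first.
  by rewrite -setCitvl setUv; exact: integrable_target_fun.
  by apply/disj_setPS => x /= []; rewrite !in_itv/= andbT leNgt => /negP.
Qed.

Lemma is_derive_target_upper (w : R) : is_derive w 1 A (- p w).
Proof.
have -> : A = (fun y => I - B y) by apply/funext => y; rewrite (target_massE y) addrC addKr.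
have := is_derive_Br (is_derive_cst I w 1) (is_derive_target_lower w).
by move=> H; apply: (is_derive_eqr H); rewrite sub0r.
Qed.

Lemma target_upper_ge0 w : 0 <= A w.
Proof. by apply: Rintegral_ge0 => x _; exact: ltW (target_fun_gt0 _). Qed.

Lemma target_lower_ge0 w : 0 <= B w.
Proof. by apply: Rintegral_ge0 => x _; exact: ltW (target_fun_gt0 _). Qed.

Lemma target_upper_le w : A w <= I.
Proof. by rewrite (target_massE w) lerDr target_lower_ge0. Qed.

Lemma target_lower_le w : B w <= I.
Proof. by rewrite (target_massE w) lerDl target_upper_ge0. Qed.

Lemma target_upper_nonincr u v : u <= v -> A v <= A u.
Proof.
move=> uv; have := @MVT_le _ A (fun y => - p y) u v 0 uv.
rewrite mul0r subr_le0; apply.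
- by move=> x _; exact: is_derive_target_upper.
- exact/continuous_subspaceT/(is_derive_continuous is_derive_target_upper).
- by move=> x _; rewrite oppr_le0 ltW// target_fun_gt0.
Qed.

Lemma target_lower_nondecr u v : u <= v -> B u <= B v.
Proof.
move=> uv; have := target_upper_nonincr uv.
by have := target_massE u; rewrite (target_massE v); lra.
Qed.

Lemma target_lowerN w : B (- w) = A w.
Proof.
rewrite /B /target_lower /Rintegral ge0_integration_by_substitutionNy.
- rewrite -integral_itv_obnd_cbnd; last first.
    apply/measurable_EFinP; apply: measurable_funTS.
    by apply: measurableT_comp => //; exact: measurable_target_fun.
  by congr fine; apply: eq_integral => x _ /=; rewrite -/(p _) target_fun_even.
- exact/continuous_subspaceT/continuous_target_fun.
- by move=> x _; exact: ltW (target_fun_gt0 _).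
Qed.

Lemma target_fun_cvg0 : p x @[x --> +oo] --> (0 : R).
Proof.
apply/cvgrPdist_le => /= e e0; near=> x.
have x1 : 1 <= x by near: x; apply: nbhs_pinfty_ge; rewrite num_real.
rewrite sub0r normrN ger0_norm ?(ltW (target_fun_gt0 _))//.
rewrite /p /target_fun expRN -[leRHS]invrK lef_pV2 ?posrE ?expR_gt0 ?invr_gt0//.
have xe : e^-1 / a <= x by near: x; apply: nbhs_pinfty_ge; rewrite num_real.
rewrite ler_pdivrMr// in xe.
apply: (le_trans xe); rewrite mulrC; apply: le_trans (expR_ge1Dx _).
have : a * x <= a * x ^+ (2 * k).
  by rewrite ler_wpM2l ?(ltW a0)// -[leLHS]expr1 ler_weXn2l// muln_gt0.
by lra.
Unshelve. all: by end_near. Qed.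

(** Mills: [target_drift * target_fun] is an exact derivative, and the drift
increases on the tail. *)
Lemma target_upper_mills w : 0 < w -> A w <= p w / g w.
Proof.
move=> w0; have gw : 0 < g w by rewrite /g /target_drift !mulr_gt0 ?exprn_gt0// ltr0n muln_gt0.
rewrite ler_pdivlMr// mulrC.
have cg : continuous g.
  exact: (continuousMr (@continuous_cstr R ((2 * k)%:R * a)) (@continuous_Xn R (2 * k - 1))).
have cgp : continuous (fun x => g x * p x) := continuousMr cg continuous_target_fun.
have dF (x : R) : is_derive x 1 (fun x => -1 * p x) (g x * p x).
  have H := is_derive_cstM (-1) (is_derive_target_fun x).
  by apply: (is_derive_eqr H); rewrite mulrA mulrNN mul1r.
have gp0 x : w <= x -> 0 <= g x * p x.
  move=> wx; rewrite mulr_ge0 ?(ltW (target_fun_gt0 _))//.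
  by rewrite !mulr_ge0 ?exprn_ge0 ?(ltW a0)// (le_trans _ wx)// ltW.
have H : (\int[mu]_(x in `[w, +oo[) (g x * p x)%:E = 0%:E - (-1 * p w)%:E)%E.
  apply: (@ge0_continuous_FTC2y R (fun x => g x * p x) (fun x => -1 * p x) w 0).
  - exact: gp0.
  - exact: continuous_subspaceT.
  - by rewrite -(mulr0 (-1)); apply: cvgM; [exact: cvg_cst|exact: target_fun_cvg0].
  - by move=> x wx; exact: (@ex_derive _ _ _ _ _ _ _ (dF x)).
  - apply: cvg_at_right_filter; exact: (is_derive_continuous dF).
  - by move=> x _; rewrite derive1E; exact: (@derive_val _ _ _ _ _ _ _ (dF x)).
have AE : ((A w)%:E = \int[mu]_(x in `[w, +oo[) (p x)%:E)%E.
  rewrite -integral_itv_obnd_cbnd; last first.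
    by apply/measurable_EFinP; apply: measurable_funTS; exact: measurable_target_fun.
  by rewrite fineK//; apply: integrable_fin_num => //; exact: integrableS.
rewrite -lee_fin EFinM AE -ge0_integralZl//; first last.
- by rewrite lee_fin ltW.
- by move=> x _; rewrite lee_fin ltW// target_fun_gt0.
- by apply/measurable_EFinP; apply: measurable_funTS; exact: measurable_target_fun.
apply: (@le_trans _ _ (\int[mu]_(x in `[w, +oo[) (g x * p x)%:E)%E); last first.
  by rewrite H mulN1r sub0e lee_fin opprK.
apply: ge0_le_integral => //.
- by move=> x _; rewrite mule_ge0 ?lee_fin// ltW// target_fun_gt0.
- apply: emeasurable_funM; first exact: measurable_cst.
  by apply/measurable_EFinP; apply: measurable_funTS; exact: measurable_target_fun.
- by apply/measurable_EFinP; apply: measurable_funTS; exact: continuous_measurable_fun.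
- move=> x; rewrite /= in_itv/= andbT => wx; rewrite -EFinM lee_fin ler_wpM2r//.
    exact: ltW (target_fun_gt0 _).
  apply: ler_wpM2l; first by rewrite mulr_ge0// ltW.
  by rewrite lerXn2r ?nnegrE ?(ltW w0) ?(le_trans (ltW w0) wx).
Qed.

(** The tail contains a rectangle; a width [r] of order
[(1 + z) ^- (2 * k - 1)] gives the matching lower Mills bound. *)
Lemma target_upper_step z r : 0 <= z -> 0 <= r -> r * p (z + r) <= A z.
Proof.
move=> z0 r0; have zr : z <= z + r by rewrite lerDl.
have := @MVT_le _ A (fun y => - p y) z (z + r) (- p (z + r)) zr.
move=> /(_ _ _ _)/wrap[].
- by move=> x _; exact: is_derive_target_upper.
- exact/continuous_subspaceT/(is_derive_continuous is_derive_target_upper).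
- move=> x /andP[zx xr]; rewrite lerN2 ler_expR lerN2 ler_wpM2l ?(ltW a0)//.
  have x0 : 0 <= x by rewrite (le_trans z0)// ltW.
  by rewrite lerXn2r ?nnegrE// ?(ltW xr)// (le_trans x0)// ltW.
by have := target_upper_ge0 (z + r); rewrite addrAC subrr add0r; lra.
Qed.

Lemma target_upper_gt0 z : 0 <= z -> 0 < A z.
Proof.
move=> z0; apply: lt_le_trans (target_upper_step z0 ler01).
by rewrite mul1r target_fun_gt0.
Qed.

Lemma target_mass_gt0 : 0 < I.
Proof. exact: lt_le_trans (target_upper_gt0 (lexx 0)) (target_upper_le 0). Qed.

Lemma pow_add_le (x r : R) m : 0 <= x -> 0 <= r ->
  (x + r) ^+ m <= x ^+ m + m%:R * r * (x + r) ^+ m.-1.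
Proof.
move=> x0 r0; have xr : x <= x + r by rewrite lerDl.
have := @MVT_le _ (fun y => y ^+ m) (fun y => m%:R * y ^+ m.-1) x (x + r)
  (m%:R * (x + r) ^+ m.-1) xr.
move=> /(_ _ _ _)/wrap[].
- by move=> y _; exact: is_derive_Xn.
- exact/continuous_subspaceT/continuous_Xn.
- move=> y /andP[xy yr]; rewrite ler_wpM2l// lerXn2r ?nnegrE ?(ltW yr)//.
    by rewrite (le_trans x0)// ltW.
  by rewrite addr_ge0.
rewrite addrAC subrr add0r; lra.
Qed.

Lemma target_mills_lower : exists2 c, 0 < c &
  forall z, 0 <= z -> c * p z <= A z * (1 + z) ^+ (2 * k - 1).
Proof.
exists (expR (- (a * ((2 * k)%:R * 2 ^+ (2 * k - 1))))); first exact: expR_gt0.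
move=> z z0; set m := (2 * k - 1)%N.
have z1 : 0 < 1 + z by rewrite ltr_wpDr.
have z1m : 0 < (1 + z) ^+ m by rewrite exprn_gt0.
set r := ((1 + z) ^+ m)^-1; have r0 : 0 < r by rewrite invr_gt0.
have r1 : r <= 1 by rewrite invf_le1// exprn_ege1// lerDl.
have := target_upper_step z0 (ltW r0); rewrite mulrC -ler_pdivlMr//.
rewrite invrK; apply: le_trans.
rewrite -expRD ler_expR -opprD lerN2 -mulrDr ler_wpM2l ?(ltW a0)//.
rewrite [leRHS]addrC; apply: (le_trans (pow_add_le (2 * k) z0 (ltW r0))); rewrite lerD2l.
rewrite -mulrA ler_wpM2l// -subn1 -/m.
have h1 : (z + r) ^+ m <= (2 * (1 + z)) ^+ m.
  by rewrite lerXn2r ?nnegrE; lra.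
apply: (le_trans (ler_wpM2l (ltW r0) h1)).
by rewrite exprMn mulrCA mulVf ?mulr1// gt_eqF.
Qed.

Lemma target_mills_upper : exists2 C, 0 < C &
  forall w, 0 <= w -> A w * (1 + w) ^+ (2 * k - 1) <= C * p w.
Proof.
set m := (2 * k - 1)%N; have I0 := target_mass_gt0.
have ka : 0 < (2 * k)%:R * a by rewrite mulr_gt0// ltr0n muln_gt0.
pose C1 := I * 2 ^+ m * expR a; pose C2 := 2 ^+ m / ((2 * k)%:R * a).
have C10 : 0 < C1 by rewrite !mulr_gt0 ?exprn_gt0 ?expR_gt0.
have C20 : 0 < C2 by rewrite divr_gt0// exprn_gt0.
exists (C1 + C2) => [|w w0]; first by rewrite addr_gt0.
have pw := target_fun_gt0 w; have w1 : 0 <= 1 + w by rewrite addr_ge0.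
rewrite mulrDl; have [lew1|ltw1] := leP w 1.
  have h : A w * (1 + w) ^+ m <= C1 * p w.
    have p1 : 1 <= expR a * p w.
      rewrite -expRD -[leLHS]expR0 ler_expR subr_ge0 ler_piMr ?(ltW a0)//.
      exact: exprn_ile1.
    have w2 : (1 + w) ^+ m <= 2 ^+ m by rewrite lerXn2r ?nnegrE; lra.
    have h2 : A w * (1 + w) ^+ m <= I * 2 ^+ m.
      by apply: ler_pM; rewrite ?exprn_ge0 ?target_upper_ge0 ?target_upper_le.
    apply: (le_trans h2); rewrite /C1 -[leRHS]mulrA -[leLHS]mulr1 ler_wpM2l//.
    by rewrite mulr_ge0 ?exprn_ge0// ltW.
  by rewrite (le_trans h)// lerDl mulr_ge0// ltW.
have h : A w * (1 + w) ^+ m <= C2 * p w.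
  have gw : 0 < g w by rewrite mulr_gt0// exprn_gt0// (lt_trans ltr01).
  have := target_upper_mills (lt_trans ltr01 ltw1).
  have h1 : (1 + w) ^+ m <= (2 * w) ^+ m by rewrite lerXn2r ?nnegrE; lra.
  move=> h2; apply: (le_trans (ler_pM (target_upper_ge0 w) _ h2 h1)).
    by rewrite exprn_ge0.
  rewrite /C2 /g /target_drift -/m exprMn le_eqVlt; apply/orP; left; apply/eqP.
  have wm : 0 < w ^+ m by rewrite exprn_gt0// (lt_trans ltr01).
  move: (w ^+ m) wm ((2 * k)%:R * a) ka => W W0 K K0.
  by field; rewrite !gt_eqF.
by rewrite (le_trans h)// lerDr mulr_ge0// ltW.
Qed.

End target_tail.

(** * The Stein equation of the limit law *)

Section stein_solution.
Context {R : realType}.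
Variables (a : R) (k : nat).
Hypotheses (a0 : 0 < a) (k0 : (0 < k)%N).

Local Notation p := (target_fun a k).
Local Notation g := (target_drift a k).
Local Notation A := (target_upper a k).
Local Notation B := (target_lower a k).
Local Notation I := (target_mass a k).

Definition target_tail (z : R) := A z / I.

(** The bounded solution of the Stein equation
[f' w = target_drift w * f w + target_tail z - (z < w)], written with [max] and
[min] to cover both sides of the kink at [z]. *)
Definition stein_sol (z w : R) :=
  A (Num.max z w) * B (Num.min z w) / I * expR (a * w ^+ (2 * k)).

(** The reciprocal of [target_fun], frozen beyond [z]. The product
[target_tail z * trunc_exp z w] dominates the Stein solution, and under the
limit law the second factor has an expectation polynomial in [z]; so errors
measured in this scale are errors relative to [target_tail z]. *)
Definition trunc_exp (z w : R) :=
  expR (a * Num.min `|w| (Num.max z 0) ^+ (2 * k)).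

Local Notation q := target_tail.
Local Notation f := stein_sol.
Local Notation E := trunc_exp.

Let I0 : 0 < I. Proof. exact: target_mass_gt0. Qed.

Lemma target_fun_inv w : p w * expR (a * w ^+ (2 * k)) = 1.
Proof. by rewrite /target_fun mulrC expRxMexpNx_1. Qed.

Lemma target_tail_ge0 z : 0 <= q z.
Proof. by rewrite divr_ge0 ?target_upper_ge0// ltW. Qed.


Lemma target_tailC z : B z / I = 1 - q z.
Proof.
have := target_massE a0 k0 z => IE.
have -> : B z = I - A z by rewrite IE addrK.
by rewrite mulrBl divff// gt_eqF.
Qed.

Lemma trunc_exp_ge1 z w : 1 <= E z w.
Proof.
rewrite -expR0 ler_expR mulr_ge0 ?(ltW a0)// exprn_ge0//.
by rewrite le_min normr_ge0 le_max lexx orbT.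
Qed.

Let left_sol (z w : R) := A z / I * (B w * expR (a * w ^+ (2 * k))).
Let right_sol (z w : R) := B z / I * (A w * expR (a * w ^+ (2 * k))).

Lemma stein_sol_left z w : w <= z -> f z w = left_sol z w.
Proof. by move=> wz; rewrite /f max_l// min_r// /left_sol; ring. Qed.

Lemma stein_sol_right z w : z <= w -> f z w = right_sol z w.
Proof. by move=> wz; rewrite /f max_r// min_l// /right_sol; ring. Qed.

Let is_derive_exp (w : R) : is_derive w 1 (fun w => expR (a * w ^+ (2 * k)))
  (expR (a * w ^+ (2 * k)) * g w).
Proof. exact: (is_derive_expR_comp (is_derive_target_exponent a k w)). Qed.

Lemma is_derive_left_sol (z w : R) :
  is_derive w 1 (left_sol z) (g w * left_sol z w + q z).
Proof.
have H := is_derive_cstM (A z / I)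
  (is_derive_Mr (is_derive_target_lower a0 k0 w) (is_derive_exp w)).
apply: (is_derive_eqr H).
by rewrite [X in _ + X]mulrC target_fun_inv /left_sol /target_tail; ring.
Qed.

Lemma is_derive_right_sol (z w : R) :
  is_derive w 1 (right_sol z) (g w * right_sol z w + q z - 1).
Proof.
have H := is_derive_cstM (B z / I)
  (is_derive_Mr (is_derive_target_upper a0 k0 w) (is_derive_exp w)).
apply: (is_derive_eqr H).
rewrite mulrN [X in _ - X]mulrC target_fun_inv /right_sol -addrA.
have -> : q z - 1 = - (B z / I) by rewrite target_tailC opprB.
by ring.
Qed.

Lemma continuous_stein_sol z : continuous (f z).
Proof.
have cA := is_derive_continuous (is_derive_target_upper a0 k0).
have cB := is_derive_continuous (is_derive_target_lower a0 k0).
have cM : continuous (fun w : R => A (Num.max z w)).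
  apply: (continuous_compr _ cA) => w.
  by apply: continuous_max; [exact: cst_continuous|exact: cvg_id].
have cm : continuous (fun w : R => B (Num.min z w)).
  apply: (continuous_compr _ cB) => w.
  by apply: continuous_min; [exact: cst_continuous|exact: cvg_id].
have cI := @continuous_cstr R I^-1.
exact: (continuousMr (continuousMr (continuousMr cM cm) cI) (is_derive_continuous is_derive_exp)).
Qed.

Lemma continuous_trunc_exp z : continuous (E z).
Proof.
have cm : continuous (fun w : R => Num.min `|w| (Num.max z 0)).
  by move=> w; apply: continuous_min; [exact: norm_continuous|exact: cst_continuous].
exact: (continuous_compr (continuous_compr cm (@continuous_Xn R _)) (@continuous_scaled_expR R a)).
Qed.

Lemma stein_sol_ge0 z w : 0 <= f z w.
Proof.
by rewrite /f mulr_ge0 ?expR_ge0// divr_ge0 ?(ltW I0)// mulr_ge0 ?target_upper_ge0 ?target_lower_ge0.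
Qed.

Let q00 : 0 < q 0. Proof. by rewrite divr_gt0// target_upper_gt0. Qed.

Lemma target_tail_neg z : z <= 0 -> q 0 <= q z.
Proof. by move=> z0; rewrite ler_pM2r ?invr_gt0// target_upper_nonincr. Qed.

Local Notation m := (2 * k - 1)%N.

Lemma stein_mills_lower : exists2 C, 0 < C & forall z, 0 <= z ->
  1 <= C * (q z * (1 + z) ^+ m * expR (a * z ^+ (2 * k))).
Proof.
have [c c0 Hc] := target_mills_lower a0 k0; exists (I / c); first exact: divr_gt0.
move=> z z0; have /(ler_wpM2r (expR_ge0 (a * z ^+ (2 * k)))) := Hc z z0.
rewrite -[leLHS]mulrA target_fun_inv mulr1 => h.
have -> : I / c * (q z * (1 + z) ^+ m * expR (a * z ^+ (2 * k))) =
   (A z * (1 + z) ^+ m * expR (a * z ^+ (2 * k))) / c.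
  move: (expR _) (_ ^+ m) => e S; rewrite /target_tail; field.
  by rewrite !gt_eqF.
by rewrite ler_pdivlMr// mul1r.
Qed.

Lemma stein_mills_upper : exists2 C, 0 < C & forall w, 0 <= w ->
  A w * expR (a * w ^+ (2 * k)) * (1 + w) ^+ m <= C.
Proof.
have [C C0 HC] := target_mills_upper a0 k0; exists C => // w w0.
have /(ler_wpM2r (expR_ge0 (a * w ^+ (2 * k)))) := HC w w0.
by rewrite -[leRHS]mulrA target_fun_inv mulr1 mulrAC.
Qed.

Lemma stein_mills_upper1 : exists2 C, 0 < C & forall w, 0 <= w ->
  A w * expR (a * w ^+ (2 * k)) <= C.
Proof.
have [C C0 HC] := stein_mills_upper; exists C => // w w0.
apply: le_trans (HC w w0); rewrite ler_peMr ?mulr_ge0 ?target_upper_ge0 ?expR_ge0//.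
by rewrite exprn_ege1// lerDl.
Qed.

Lemma trunc_expE z w : 0 <= z -> z <= w -> E z w = expR (a * z ^+ (2 * k)).
Proof.
move=> z0 zw; rewrite /trunc_exp max_l// min_r//.
by rewrite (le_trans zw)// ler_norm.
Qed.

Lemma stein_weight_ge0 z w j : 0 <= q z * (1 + `|w|) ^+ j * E z w.
Proof.
apply: mulr_ge0; last exact: expR_ge0.
by apply: mulr_ge0; [exact: target_tail_ge0|rewrite exprn_ge0// addr_ge0].
Qed.

(** By the lower Mills bound the weight beyond [z] makes up for the smallness of
[target_tail z]. So errors that carry the indicator of the tail are relative
errors too. *)
Lemma stein_one_bound : exists2 C, 0 < C & forall z w, z <= w ->
  1 <= C * (q z * (1 + `|w|) ^+ m * E z w).
Proof.
have [C C0 HC] := stein_mills_lower; exists (C + (q 0)^-1).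
  by rewrite addr_gt0// invr_gt0.
move=> z w zw; have t0 := stein_weight_ge0 z w m.
rewrite mulrDl; have [z0|z0] := leP 0 z.
  apply: (@le_trans _ _ (C * (q z * (1 + `|w|) ^+ m * E z w))); last first.
    by rewrite lerDl mulr_ge0// invr_ge0 ltW.
  apply: le_trans (HC z z0) _; rewrite ler_wpM2l ?(ltW C0)// trunc_expE//.
  rewrite ler_wpM2r ?expR_ge0// ler_wpM2l ?target_tail_ge0//.
  by rewrite lerXn2r ?nnegrE ?addr_ge0 ?lerD2l ?(le_trans zw (ler_norm w)).
apply: (@le_trans _ _ ((q 0)^-1 * (q z * (1 + `|w|) ^+ m * E z w))); last first.
  by rewrite lerDr mulr_ge0// ltW.
rewrite ler_pdivlMl// mulr1; apply: le_trans (target_tail_neg (ltW z0)) _.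
rewrite -mulrA ler_peMr ?target_tail_ge0// -[leLHS]mulr1 ler_pM ?exprn_ege1 ?trunc_exp_ge1//.
by rewrite lerDl.
Qed.

Lemma stein_sol_bound : exists2 C, 0 < C & forall z w, f z w <= C * (q z * E z w).
Proof.
have [C1 C10 HC1] := stein_mills_upper1.
have [C2 C20 HC2] := stein_mills_upper.
have [C3 C30 HC3] := stein_mills_lower.
pose C := C1 + I + C1 / q 0 + C2 * C3.
have Cge : [/\ C1 <= C, I <= C, C1 / q 0 <= C & C2 * C3 <= C].
  have [x1 x2] : 0 < C1 / q 0 /\ 0 < C2 * C3 by rewrite divr_gt0// mulr_gt0.
  rewrite /C; move: (C1 / q 0) (C2 * C3) (target_mass a k) I0 x1 x2 => y1 y2 i ? ? ?.
  by split; lra.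
have C0 : 0 < C by apply: lt_le_trans C10 _; case: Cge.
case: Cge => CC1 CI CC1q CC23; exists C => // z w; clearbody C.
have q0 := target_tail_ge0 z; have E1 := trunc_exp_ge1 z w.
have qE : q z <= q z * E z w by rewrite ler_peMr.
have qE0 : 0 <= q z * E z w by exact: le_trans qE.
have e0 : 0 <= expR (a * w ^+ (2 * k)) by exact: expR_ge0.
have Bneg : w <= 0 -> B w * expR (a * w ^+ (2 * k)) <= C1.
  move=> w0; have := HC1 (- w); rewrite oppr_ge0 => /(_ w0).
  by rewrite -target_lowerN// opprK exprNn exprM sqrrN !expr1n mul1r.
have [wz|zw] := leP w z.
  rewrite stein_sol_left// /left_sol -/(q z); have [w0|w0] := leP w 0.
    rewrite mulrC; apply: ler_pM => //.
      by rewrite mulr_ge0 ?target_lower_ge0.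
    exact: le_trans (Bneg w0) CC1.
  have -> : E z w = expR (a * w ^+ (2 * k)).
    rewrite /trunc_exp max_l ?(le_trans (ltW w0))// gtr0_norm// min_l//.
  rewrite [leRHS]mulrCA ler_wpM2l// ler_wpM2r//.
  exact: le_trans (target_lower_le a0 k0 w) CI.
rewrite stein_sol_right ?(ltW zw)// /right_sol.
have BI : B z / I <= 1 by rewrite ler_pdivrMr// mul1r target_lower_le.
have BI0 : 0 <= B z / I by rewrite divr_ge0 ?target_lower_ge0// ltW.
have Ae0 : 0 <= A w * expR (a * w ^+ (2 * k)) by rewrite mulr_ge0 ?target_upper_ge0.
have [z0|z0] := leP 0 z.
  have w0 : 0 <= w by rewrite (le_trans z0)// ltW.
  have z1m : 0 < (1 + z) ^+ m by rewrite exprn_gt0// ltr_wpDr.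
  have hA : A w * expR (a * w ^+ (2 * k)) <= C2 / (1 + z) ^+ m.
    rewrite ler_pdivlMr//; apply: le_trans (HC2 w w0); rewrite ler_wpM2l//.
    by rewrite lerXn2r ?nnegrE ?addr_ge0// lerD2l ltW.
  apply: (@le_trans _ _ (C2 / (1 + z) ^+ m)).
    by rewrite -[leRHS]mul1r; apply: ler_pM.
  rewrite ler_pdivrMr// trunc_expE ?(ltW zw)//.
  apply: (@le_trans _ _ (C2 * C3 * (q z * (1 + z) ^+ m * expR (a * z ^+ (2 * k))))).
    by rewrite -[leLHS]mulr1 -[leRHS]mulrA ler_wpM2l ?(ltW C20)// HC3.
  have -> : C * (q z * expR (a * z ^+ (2 * k))) * (1 + z) ^+ m =
    C * (q z * (1 + z) ^+ m * expR (a * z ^+ (2 * k))) by ring.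
  rewrite ler_wpM2r//; apply: mulr_ge0 (expR_ge0 _).
  by apply: mulr_ge0 => //; exact: ltW.
have key : B z / I * (A w * expR (a * w ^+ (2 * k))) <= C1.
  have [w0|w0] := leP 0 w.
    by rewrite -[leRHS]mul1r; apply: ler_pM => //; exact: HC1.
  apply: le_trans (Bneg (ltW w0)).
  have -> : B z / I * (A w * expR (a * w ^+ (2 * k))) =
    (B z * (A w / I)) * expR (a * w ^+ (2 * k)) by ring.
  rewrite ler_wpM2r// -[leRHS]mulr1; apply: ler_pM.
  - exact: target_lower_ge0.
  - by rewrite divr_ge0 ?target_upper_ge0// ltW.
  - by rewrite target_lower_nondecr// ltW.
  - by rewrite ler_pdivrMr// mul1r target_upper_le.
apply: (le_trans key); apply: (@le_trans _ _ (C1 / q 0 * q z)).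
  rewrite mulrAC ler_pdivlMr// ler_wpM2l ?(ltW C10)//.
  exact: target_tail_neg (ltW z0).
by apply: ler_pM => //; rewrite divr_ge0 ?(ltW C10) ?(ltW q00).
Qed.

(** The solution is differentiable on either side of [z] only; slope bounds on
both sides combine across the kink. *)
Lemma stein_sol_slope z u v D1 D2 : u <= v ->
  (forall x, u <= x <= v -> x <= z -> D1 <= g x * f z x + q z <= D2) ->
  (forall x, u <= x <= v -> z <= x -> D1 <= g x * f z x + q z - 1 <= D2) ->
  D1 * (v - u) <= f z v - f z u <= D2 * (v - u).
Proof.
move=> uv HL HR.
have L u' v' : u <= u' -> u' <= v' -> v' <= v -> v' <= z ->
    D1 * (v' - u') <= f z v' - f z u' <= D2 * (v' - u').
  move=> uu uv' vv vz; have D x : u' < x < v' -> D1 <= g x * left_sol z x + q z <= D2.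
    move=> /andP[ux xv]; have xz : x <= z by rewrite (le_trans (ltW xv)).
    by rewrite -stein_sol_left//; apply: HL => //;
      rewrite (le_trans uu (ltW ux)) (le_trans (ltW xv) vv).
  have c : {within `[u', v'], continuous (left_sol z)}.
    exact/continuous_subspaceT/(is_derive_continuous (is_derive_left_sol z)).
  rewrite !stein_sol_left ?(le_trans uv')//; apply/andP; split.
    by apply: (MVT_ge uv' (fun x _ => is_derive_left_sol z x) c) => x /D/andP[].
  by apply: (MVT_le uv' (fun x _ => is_derive_left_sol z x) c) => x /D/andP[].
have Rr u' v' : u <= u' -> u' <= v' -> v' <= v -> z <= u' ->
    D1 * (v' - u') <= f z v' - f z u' <= D2 * (v' - u').
  move=> uu uv' vv zu; have D x : u' < x < v' -> D1 <= g x * right_sol z x + q z - 1 <= D2.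
    move=> /andP[ux xv]; have zx : z <= x by rewrite (le_trans zu)// ltW.
    by rewrite -stein_sol_right//; apply: HR => //;
      rewrite (le_trans uu (ltW ux)) (le_trans (ltW xv) vv).
  have c : {within `[u', v'], continuous (right_sol z)}.
    exact/continuous_subspaceT/(is_derive_continuous (is_derive_right_sol z)).
  rewrite !stein_sol_right ?(le_trans zu)//; apply/andP; split.
    by apply: (MVT_ge uv' (fun x _ => is_derive_right_sol z x) c) => x /D/andP[].
  by apply: (MVT_le uv' (fun x _ => is_derive_right_sol z x) c) => x /D/andP[].
have [vz|zv] := leP v z; first exact: L.
have [zu|uz] := leP z u; first exact: Rr.
have /andP[l1 l2] := L u z (lexx _) (ltW uz) (ltW zv) (lexx _).
have /andP[r1 r2] := Rr z v (ltW uz) (ltW zv) (lexx _) (lexx _).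
by rewrite !mulrBr in l1 l2 r1 r2 *; apply/andP; split; lra.
Qed.

End stein_solution.

(** * Stability of the Stein solution under small shifts *)

Section stein_perturbation.
Context {R : realType}.
Variables (a : R) (k : nat).
Hypotheses (a0 : 0 < a) (k0 : (0 < k)%N).

Local Notation g := (target_drift a k).
Local Notation q := (target_tail a k).
Local Notation f := (stein_sol a k).
Local Notation E := (trunc_exp a k).
Local Notation m := (2 * k - 1)%N.

Lemma pow_shift (K delta V w : R) j : 0 <= delta -> delta <= K -> `|w - V| <= delta ->
  (1 + `|w|) ^+ j <= (1 + K) ^+ j * (1 + `|V|) ^+ j.
Proof.
move=> d0 dK wV; have K0 : 0 <= K by exact: le_trans dK.
rewrite -exprMn lerXn2r ?nnegrE ?mulr_ge0 ?addr_ge0//.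
have : `|w| <= `|V| + delta.
  by rewrite -[w](subrK V) addrC (le_trans (ler_normD _ _))// lerD2l.
have : 0 <= K * `|V| by rewrite mulr_ge0.
by lra.
Qed.

Lemma le_shift_bound (K delta z : R) : 0 <= delta ->
  delta * (1 + Num.max z 0) ^+ m <= K -> delta <= K.
Proof.
move=> d0; apply: le_trans; rewrite ler_peMr// exprn_ege1// lerDl.
by rewrite le_max lexx orbT.
Qed.

(** Only the truncated variable [min |w| z] enters, so the change of the exponent
is at most a multiple of [delta * (1 + z) ^+ (2 * k - 1)], which is bounded. *)
Lemma trunc_exp_shift (K : R) : 0 <= K -> exists2 C, 0 < C &
  forall z V delta w, 0 <= delta -> delta * (1 + Num.max z 0) ^+ m <= K ->
    `|w - V| <= delta -> E z w <= C * E z V.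
Proof.
move=> K0; exists (expR (a * ((2 * k)%:R * ((1 + K) ^+ m * K)))); first exact: expR_gt0.
move=> z V delta w d0 dz wV; have dK := le_shift_bound d0 dz.
set zp := Num.max z 0 in dz *; have zp0 : 0 <= zp by rewrite le_max lexx orbT.
rewrite /trunc_exp -expRD ler_expR -mulrDr ler_wpM2l ?(ltW a0)// -/zp.
set x := Num.min `|V| zp; have x0 : 0 <= x by rewrite le_min normr_ge0.
have xz : x <= zp by rewrite ge_min lexx orbT.
have wx : Num.min `|w| zp <= x + delta.
  rewrite /x -[leRHS]/(_ + _) ge_min; apply/orP.
  have wVd : `|w| <= `|V| + delta.
    by rewrite -[w](subrK V) addrC (le_trans (ler_normD _ _))// lerD2l.
  by have [Vz|zV] := leP `|V| zp; [left|right; rewrite lerDl].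
apply: (@le_trans _ _ ((x + delta) ^+ (2 * k))).
  by rewrite lerXn2r ?nnegrE ?addr_ge0// le_min normr_ge0.
apply: (le_trans (pow_add_le (2 * k) x0 d0)); rewrite [leRHS]addrC lerD2l.
rewrite -mulrA ler_wpM2l// -subn1.
have h : (x + delta) ^+ m <= ((1 + K) * (1 + zp)) ^+ m.
  rewrite lerXn2r ?nnegrE ?mulr_ge0 ?addr_ge0//.
  have : 0 <= K * zp by rewrite mulr_ge0.
  by lra.
apply: (le_trans (ler_wpM2l d0 h)); rewrite exprMn mulrCA ler_wpM2l//.
by rewrite exprn_ge0// addr_ge0.
Qed.

Let weight j z w := q z * (1 + `|w|) ^+ j * E z w.

Let weight_ge0 j z w : 0 <= weight j z w. Proof. exact: stein_weight_ge0. Qed.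

Lemma stein_weight_shift (K : R) j : 0 <= K -> exists2 C, 0 < C &
  forall z V delta w, 0 <= delta -> delta * (1 + Num.max z 0) ^+ m <= K ->
    `|w - V| <= delta ->
    q z * (1 + `|w|) ^+ j * E z w <= C * (q z * (1 + `|V|) ^+ j * E z V).
Proof.
move=> K0; have [C C0 HC] := trunc_exp_shift K0.
exists ((1 + K) ^+ j * C); first by rewrite mulr_gt0// exprn_gt0// ltr_wpDr.
move=> z V delta w d0 dz wV; have h1 := HC _ _ _ _ d0 dz wV.
have h2 := pow_shift j d0 (le_shift_bound d0 dz) wV.
have -> : (1 + K) ^+ j * C * (q z * (1 + `|V|) ^+ j * E z V) =
  q z * ((1 + K) ^+ j * (1 + `|V|) ^+ j) * (C * E z V) by ring.
have q0 := target_tail_ge0 a0 k0 z.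
apply: ler_pM => //; last by rewrite ler_wpM2l.
  by apply: mulr_ge0 => //; rewrite exprn_ge0// addr_ge0.
exact: expR_ge0.
Qed.

Lemma target_drift_le w : `|g w| <= (2 * k)%:R * a * (1 + `|w|) ^+ m.
Proof.
rewrite /target_drift !normrM normrX normr_nat (gtr0_norm a0) ler_wpM2l ?mulr_ge0 ?(ltW a0)//.
by rewrite lerXn2r ?nnegrE ?addr_ge0// lerDr.
Qed.

Lemma stein_drift_le : exists2 C, 0 < C & forall z w,
  `|g w * f z w| <= C * (q z * (1 + `|w|) ^+ m * E z w).
Proof.
have [C C0 HC] := stein_sol_bound a0 k0.
exists ((2 * k)%:R * a * C); first by rewrite !mulr_gt0// ltr0n muln_gt0.
move=> z w; rewrite normrM (ger0_norm (stein_sol_ge0 a0 k0 z w)).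
have -> : (2 * k)%:R * a * C * (q z * (1 + `|w|) ^+ m * E z w) =
  (2 * k)%:R * a * (1 + `|w|) ^+ m * (C * (q z * E z w)) by ring.
by apply: ler_pM => //; [exact: stein_sol_ge0|exact: target_drift_le].
Qed.

Lemma stein_tail_le z w j : q z <= q z * (1 + `|w|) ^+ j * E z w.
Proof.
have q0 := target_tail_ge0 a0 k0 z.
rewrite -mulrA ler_peMr// -[leLHS]mulr1; apply: ler_pM => //.
  by rewrite exprn_ege1// lerDl.
exact: trunc_exp_ge1.
Qed.

Lemma stein_sol_lipschitz (K : R) : 0 <= K -> exists2 C, 0 < C &
  forall z V delta w, 0 <= delta -> delta * (1 + Num.max z 0) ^+ m <= K ->
    `|w - V| <= delta ->
    `|f z w - f z V| <= C * (delta * (q z * (1 + `|V|) ^+ m * E z V)).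
Proof.
move=> K0; have [C1 C10 H1] := stein_drift_le.
have [C2 C20 H2] := stein_one_bound a0 k0.
have [C3 C30 H3] := stein_weight_shift m K0.
exists ((C1 + 1 + C2) * C3); first by rewrite mulr_gt0// addr_gt0// addr_gt0.
move=> z V delta w d0 dz wV.
pose D := (C1 + 1 + C2) * C3 * (q z * (1 + `|V|) ^+ m * E z V).
have D0 : 0 <= D.
  by rewrite mulr_ge0 ?weight_ge0// mulr_ge0 ?(ltW C30)// !addr_ge0// ltW.
have upw x : `|x - V| <= delta -> (C1 + 1 + C2) * (q z * (1 + `|x|) ^+ m * E z x) <= D.
  move=> xV; rewrite /D -[leRHS]mulrA ler_wpM2l ?addr_ge0 ?(ltW C10) ?(ltW C20)//.
  exact: (H3 _ _ _ _ d0 dz xV).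
have facts x : `|x - V| <= delta -> exists W,
    [/\ 0 <= C1 * W, 0 <= C2 * W & q z <= W] /\
    [/\ `|g x * f z x| <= C1 * W, z <= x -> 1 <= C2 * W & C1 * W + W + C2 * W <= D].
  move=> xV; exists (q z * (1 + `|x|) ^+ m * E z x).
  have W0 : 0 <= q z * (1 + `|x|) ^+ m * E z x by exact: weight_ge0.
  split; split.
  - exact: (mulr_ge0 (ltW C10)).
  - exact: (mulr_ge0 (ltW C20)).
  - exact: stein_tail_le.
  - exact: H1.
  - exact: H2.
  - by apply: le_trans (upw x xV); rewrite !mulrDl mul1r.
have incr u v : u <= v -> (forall x, u <= x <= v -> `|x - V| <= delta) ->
    `|f z v - f z u| <= D * (v - u).
  clearbody D; have q0 := target_tail_ge0 a0 k0 z.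
  move=> uv xV; rewrite ler_norml -mulNr.
  apply: (stein_sol_slope a0 k0 uv) => x xuv xz;
    have [W [[W1 W2 qW] [GW oW WD]]] := facts x (xV x xuv);
    move: GW; rewrite ler_norml => /andP[GW1 GW2]; [|have := oW xz];
    move: (C1 * W) (C2 * W) (g x * _) (q z) W1 W2 qW GW1 GW2 WD q0 => *;
    apply/andP; split; lra.
have fin u v : u <= v -> v - u <= delta -> D * (v - u) <=
    (C1 + 1 + C2) * C3 * (delta * (q z * (1 + `|V|) ^+ m * E z V)).
  move=> uv vud; have -> : (C1 + 1 + C2) * C3 * (delta * (q z * (1 + `|V|) ^+ m * E z V)) = D * delta.
    by rewrite /D; ring.
  by rewrite ler_wpM2l.
have [Vw|wV'] := leP V w.
  rewrite (ger0_norm (_ : 0 <= w - V)) ?subr_ge0// in wV.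
  apply: le_trans (incr _ _ Vw _) (fin _ _ Vw wV) => x /andP[Vx xw].
  by rewrite ger0_norm ?subr_ge0// (le_trans _ wV)// lerD2r.
rewrite (ltr0_norm (_ : w - V < 0)) ?subr_lt0// opprB in wV.
rewrite distrC; apply: le_trans (incr _ _ (ltW wV') _) (fin _ _ (ltW wV') wV) => x /andP[wx xV].
by rewrite ler0_norm ?subr_le0// opprB (le_trans _ wV)// lerD2l lerN2.
Qed.

Lemma target_drift_shift (K : R) : 0 <= K -> exists2 C, 0 < C &
  forall V delta w, 0 <= delta -> delta <= K -> `|w - V| <= delta ->
  `|g w - g V| <= C * (delta * (1 + `|V|) ^+ m).
Proof.
move=> K0; pose c := (2 * k)%:R * a * m%:R * (1 + K) ^+ m.
have c0 : 0 <= c by rewrite !mulr_ge0 ?(ltW a0)// exprn_ge0// addr_ge0.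
exists (c + 1) => [|V delta w d0 dK wV]; first by rewrite ltr_wpDl.
have dg (x : R) : is_derive x 1 g ((2 * k)%:R * a * (m%:R * x ^+ m.-1)).
  exact: (is_derive_cstM _ (is_derive_Xn x m)).
have := @MVT_norm_le _ g _ V w (c * (1 + `|V|) ^+ m) dg.
move=> /(_ _)/wrap[].
  move=> x xV.
  have h := pow_shift m d0 dK (le_trans xV wV).
  rewrite !normrM !normr_nat (gtr0_norm a0) normrX /c -!mulrA.
  do 3 (apply: ler_wpM2l; first by rewrite ?(ltW a0)).
  apply: le_trans h; apply: (@le_trans _ _ ((1 + `|x|) ^+ m.-1)).
    by rewrite lerXn2r ?nnegrE ?addr_ge0// lerDr.
  by rewrite ler_weXn2l ?leq_pred// lerDl.
move/le_trans; apply.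
rewrite mulrDl mul1r; apply: (@le_trans _ _ (c * (delta * (1 + `|V|) ^+ m))); last first.
  by rewrite lerDl mulr_ge0// exprn_ge0// addr_ge0.
by rewrite -mulrA ler_wpM2l// mulrC ler_wpM2r// exprn_ge0// addr_ge0.
Qed.

Lemma stein_drift_shift (K : R) : 0 <= K -> exists2 C, 0 < C &
  forall z V delta w, 0 <= delta -> delta * (1 + Num.max z 0) ^+ m <= K ->
    `|w - V| <= delta ->
    `|g w * f z w - g V * f z V| <=
      C * (delta * (q z * (1 + `|V|) ^+ (2 * m) * E z V)).
Proof.
move=> K0; have [C1 C10 H1] := target_drift_shift K0.
have [C2 C20 H2] := stein_sol_bound a0 k0.
have [C3 C30 H3] := trunc_exp_shift K0.
have [C4 C40 H4] := stein_sol_lipschitz K0.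
pose ka := (2 * k)%:R * a; have ka0 : 0 < ka by rewrite mulr_gt0// ltr0n muln_gt0.
exists (C1 * (C2 * C3) + ka * C4) => [|z V delta w d0 dz wV].
  exact: (addr_gt0 (mulr_gt0 C10 (mulr_gt0 C20 C30)) (mulr_gt0 ka0 C40)).
have dK := le_shift_bound d0 dz; have q0 := target_tail_ge0 a0 k0 z.
have V1 : 1 <= 1 + `|V| by rewrite lerDl.
have -> : g w * f z w - g V * f z V = (g w - g V) * f z w + g V * (f z w - f z V) by ring.
rewrite [leRHS]mulrDl; apply: (le_trans (ler_normD _ _)); apply: lerD.
  rewrite normrM (ger0_norm (stein_sol_ge0 a0 k0 z w)).
  have h1 := H1 _ _ _ d0 dK wV; have h3 := H3 _ _ _ _ d0 dz wV.
  have h2 : f z w <= C2 * (q z * (C3 * E z V)).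
    by apply: le_trans (H2 z w) _; rewrite ler_wpM2l ?(ltW C20)// ler_wpM2l.
  apply: le_trans (ler_pM _ _ h1 h2) _ => //; first exact: stein_sol_ge0.
  have -> : C1 * (delta * (1 + `|V|) ^+ m) * (C2 * (q z * (C3 * E z V))) =
    C1 * (C2 * C3) * (delta * (q z * (1 + `|V|) ^+ m * E z V)) by ring.
  rewrite ler_wpM2l ?mulr_ge0 ?(ltW C10) ?(ltW C20) ?(ltW C30)// ler_wpM2l//.
  rewrite ler_wpM2r ?expR_ge0// ler_wpM2l// ler_weXn2l//.
  by rewrite leq_pmull.
rewrite normrM.
apply: le_trans (ler_pM _ _ (target_drift_le V) (H4 _ _ _ _ d0 dz wV)) _ => //.
have -> : (1 + `|V|) ^+ (2 * m) = (1 + `|V|) ^+ m * (1 + `|V|) ^+ m.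
  by rewrite (mulnC 2%N m) exprM expr2.
rewrite -/ka.
by apply: ler_eq; ring.
Qed.

(** The Stein equation replaces an increment of the solution near [V] by its
value at [V]. The derivative jumps at [z], hence the indicators with threshold
moved by [delta] to the safe side. *)
Lemma stein_increment (K : R) : 0 <= K -> exists2 C, 0 < C &
  forall z V delta u v, 0 <= delta -> delta * (1 + Num.max z 0) ^+ m <= K ->
    `|u - V| <= delta -> `|v - V| <= delta -> u <= v ->
    let err := C * (delta * (q z * (1 + `|V|) ^+ (2 * m) * E z V)) in
    f z v - f z u <= (g V * f z V + q z - (z + delta < V)%R%:R + err) * (v - u) /\
    (g V * f z V + q z - (z - delta <= V)%R%:R - err) * (v - u) <= f z v - f z u.
Proof.
move=> K0; have [C C0 H] := stein_drift_shift K0.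
exists C => // z V delta u v d0 dz uV vV uv err.
have err0 : 0 <= err by rewrite mulr_ge0 ?(ltW C0)// mulr_ge0// weight_ge0.
have near x : u <= x <= v -> `|x - V| <= delta.
  move=> /andP[ux xv]; move: uV vV; rewrite !ler_norml => /andP[u1 u2] /andP[v1 v2].
  by apply/andP; split; lra.
have dr x : u <= x <= v -> `|g x * f z x - g V * f z V| <= err.
  by move=> xuv; apply: H => //; exact: near.
clearbody err; apply/andP; rewrite andbC.
apply: (stein_sol_slope a0 k0 uv) => x xuv xz; have := dr x xuv;
  rewrite ler_norml => /andP[h1 h2]; apply/andP; split.
- by case: (z - delta <= V); rewrite /= ?mulr0n ?mulr1n; lra.
- suff -> : (z + delta < V) = false by rewrite /= mulr0n; lra.
  apply/negbTE; rewrite -leNgt; have := near x xuv.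
  by rewrite ler_norml => /andP[]; lra.
- suff -> : (z - delta <= V) = true by rewrite /= mulr1n; lra.
  by have := near x xuv; rewrite ler_norml => /andP[]; lra.
- by case: (z + delta < V); rewrite /= ?mulr0n ?mulr1n; lra.
Qed.

End stein_perturbation.
Section stein_remainder.
Context {R : realType}.
Variables (a : R) (k : nat).
Hypotheses (a0 : 0 < a) (k0 : (0 < k)%N).
Local Notation g := (target_drift a k).
Local Notation q := (target_tail a k).
Local Notation f := (stein_sol a k).
Local Notation E := (trunc_exp a k).
Local Notation m := (2 * k - 1)%N.
Local Notation wt j z V := (q z * (1 + `|V|) ^+ j * E z V).

(** If [r] and [c] are close to the drift and to 1, the difference of [r * f W]
and [c * f' V] is the Stein equation up to terms that are small in the
weighted scale. Writing the remainder at [W] prepares for moments of [W]. *)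
Lemma stein_remainder (K C0 C1 : R) : 0 <= K -> 0 < C0 -> 0 <= C1 ->
  exists2 C, 0 < C & forall z V delta W eta r c err (B : bool),
  0 <= delta -> delta * (1 + Num.max z 0) ^+ m <= K -> `|W - V| <= delta ->
  0 <= eta ->
  `|r - g V| <= C0 * (eta * (1 + `|V|) ^+ (2 * k + 1)) ->
  `|r| <= C0 * (1 + `|V|) ^+ m ->
  `|1 - c| <= C0 * (eta * (1 + `|V|) ^+ 2) -> `|c| <= C0 ->
  `|err| <= C1 * (delta * wt (2 * m)%N z V) ->
  (B -> z - delta <= V) ->
  `|r * f z W - c * (g V * f z V + q z - B%:R + err) - (B%:R - q z)| <=
  C * (eta * wt (2 * k + 1)%N z W + delta * wt (2 * m)%N z W).
Proof.
move=> K0 C00 C10.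
have e2m : (2 * m = m + m)%N by lia.
have ek : (2 * k + 1 = 2 + m)%N by lia.
have [Ca Ca0 Ha] := stein_sol_lipschitz a0 k0 K0.
have [Cb Cb0 Hb] := stein_sol_bound a0 k0.
have [Cc Cc0 Hc] := stein_drift_le a0 k0.
have [Cd Cd0 Hd] := stein_one_bound a0 k0.
have [Ce Ce0 He] := stein_weight_shift a0 k0 m K0.
have [Cf Cf0 Hf] := stein_weight_shift a0 k0 (2 * k + 1) K0.
have [Cg Cg0 Hg] := stein_weight_shift a0 k0 (2 * m) K0.
pose D1 := C0 * Cb + C0 * (Cc + 1 + Cd * Ce); pose D2 := C0 * Ca + C0 * C1.
have D10 : 0 < D1 by rewrite addr_gt0 ?mulr_gt0// ?addr_gt0 ?mulr_gt0.
have D20 : 0 < D2 by rewrite ltr_pwDl ?mulr_gt0// mulr_ge0// ltW.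
exists (D1 * Cf + D2 * Cg) => [|z V delta W eta r c err B d0 dK WV eta0 br brr b1c bc berr BV].
  by rewrite addr_gt0 ?mulr_gt0.
have wt0 j v : 0 <= wt j z v by exact: stein_weight_ge0.
have V1 : 0 <= 1 + `|V| by rewrite addr_ge0.
have f0 : 0 <= f z V by exact: stein_sol_ge0.
have q0 : 0 <= q z by exact: target_tail_ge0.
have E0 : 0 <= E z V by exact: expR_ge0.
have t1 : `|r * (f z W - f z V)| <= C0 * Ca * (delta * wt (2 * m)%N z V).
  rewrite normrM; apply: le_trans (ler_pM _ _ brr (Ha _ _ _ _ d0 dK WV)) _ => //.
  by rewrite e2m exprD le_eqVlt; apply/orP; left; apply/eqP; ring.
have t2 : `|(r - g V) * f z V| <= C0 * Cb * (eta * wt (2 * k + 1)%N z V).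
  rewrite normrM (ger0_norm f0); apply: le_trans (ler_pM _ _ br (Hb z V)) _ => //.
  by apply: ler_eq; ring.
have bB : B%:R <= Cd * Ce * wt m z V.
  case: B BV => [/(_ isT) zV|_]; last first.
    by apply: mulr_ge0; [apply: mulr_ge0; exact: ltW|exact: wt0].
  (* [V] may lie below [z]; its shift [V + delta] does not. *)
  have zw : z <= V + delta by rewrite -lerBlDr.
  apply: le_trans (Hd _ _ zw) _; rewrite -(mulrA Cd); apply: ler_wpM2l; first exact: ltW.
  have dd : `|V + delta - V| <= delta by rewrite addrAC subrr add0r ger0_norm.
  exact: (He z V delta (V + delta) d0 dK dd).
have qm : q z <= wt m z V by exact: stein_tail_le.
have t3 : `|(1 - c) * (g V * f z V + q z - B%:R)| <=
    C0 * (Cc + 1 + Cd * Ce) * (eta * wt (2 * k + 1)%N z V).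
  have h3 : `|g V * f z V + q z - B%:R| <= (Cc + 1 + Cd * Ce) * wt m z V.
    rewrite (le_trans (ler_normB _ _))// normr_nat [leRHS]mulrDl; apply: lerD bB.
    rewrite (le_trans (ler_normD _ _))// (ger0_norm q0) [leRHS]mulrDl mul1r.
    by apply: lerD qm; exact: Hc.
  rewrite normrM; apply: le_trans (ler_pM _ _ b1c h3) _ => //.
  by rewrite ek exprD le_eqVlt; apply/orP; left; apply/eqP; ring.
have t4 : `|c * err| <= C0 * C1 * (delta * wt (2 * m)%N z V).
  by rewrite normrM -mulrA ler_pM.
have -> : r * f z W - c * (g V * f z V + q z - B%:R + err) - (B%:R - q z) =
  (r * (f z W - f z V) - c * err) +
  ((r - g V) * f z V + (1 - c) * (g V * f z V + q z - B%:R)) by ring.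
have t12 := le_trans (ler_normB _ _) (lerD t1 t4).
have t34 := le_trans (ler_normD _ _) (lerD t2 t3).
apply: le_trans (ler_normD _ _) _; apply: le_trans (lerD t12 t34) _.
apply: (@le_trans _ _ (D1 * (eta * wt (2 * k + 1)%N z V) + D2 * (delta * wt (2 * m)%N z V))).
  by rewrite le_eqVlt /D1 /D2; apply/orP; left; apply/eqP; ring.
rewrite [leRHS]mulrDr; apply: lerD.
  apply: (@le_trans _ _ (D1 * Cf * (eta * wt (2 * k + 1)%N z W))); last first.
    apply: ler_wpM2r; first by apply: mulr_ge0.
    by rewrite lerDl ltW// mulr_gt0.
  rewrite -(mulrA D1); apply: ler_wpM2l; first exact: ltW.
  rewrite (mulrCA Cf); apply: ler_wpM2l => //.
  by apply: Hf d0 dK _; rewrite distrC.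
apply: (@le_trans _ _ (D2 * Cg * (delta * wt (2 * m)%N z W))); last first.
  apply: ler_wpM2r; first by apply: mulr_ge0.
  by rewrite lerDr ltW// mulr_gt0.
rewrite -(mulrA D2); apply: ler_wpM2l; first exact: ltW.
rewrite (mulrCA Cg); apply: ler_wpM2l => //.
by apply: Hg d0 dK _; rewrite distrC.
Qed.

End stein_remainder.

Lemma continuous_target_drift {R : realType} (a : R) k : continuous (target_drift a k).
Proof. exact: (continuousMr (@continuous_cstr R _) (@continuous_Xn R _)). Qed.

Section target_tail_shift.
Context {R : realType}.
Variables (a : R) (k : nat).
Hypotheses (a0 : 0 < a) (k0 : (0 < k)%N).
Local Notation q := (target_tail a k).
Local Notation m := (2 * k - 1)%N.

Lemma target_fun_shift (K : R) : 0 <= K -> exists2 C, 0 < C &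
  forall z y r, 0 <= z -> 0 <= r -> r * (1 + z) ^+ m <= K -> `|y - z| <= r ->
    target_fun a k y <= C * target_fun a k z.
Proof.
move=> K0; have em : (2 * k).-1 = m by lia.
pose D := a * ((2 * k)%:R * (1 + 2 * K) ^+ m * K).
exists (expR D); first exact: expR_gt0.
move=> z y r z0 r0 rK yz; rewrite /target_fun -expRD ler_expR.
have z1 : 1 <= (1 + z) ^+ m by rewrite exprn_ege1// lerDl.
have rK' : r <= K by apply: le_trans rK; rewrite ler_peMr.
have zy : z <= `|y| + r.
  move: yz; rewrite ler_norml => /andP[lo up]; have := ler_norm y; lra.
have yz' : `|y| <= z + r.
  have -> : y = z + (y - z) by ring.
  by rewrite (le_trans (ler_normD _ _))// (ger0_norm z0) lerD2l.
have h1 : z ^+ (2 * k) <= `|y| ^+ (2 * k) + (2 * k)%:R * r * (`|y| + r) ^+ m.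
  rewrite -em; apply: le_trans (pow_add_le (2 * k) (normr_ge0 y) r0).
  by rewrite lerXn2r ?nnegrE ?addr_ge0.
have h2 : r * (`|y| + r) ^+ m <= (1 + 2 * K) ^+ m * K.
  have base : `|y| + r <= (1 + 2 * K) * (1 + z).
    have : 0 <= K * z by exact: mulr_ge0.
    by lra.
  apply: (@le_trans _ _ (r * ((1 + 2 * K) * (1 + z)) ^+ m)).
    rewrite ler_wpM2l// lerXn2r ?nnegrE ?addr_ge0//.
    by rewrite mulr_ge0 ?addr_ge0 ?mulr_ge0.
  rewrite exprMn mulrCA ler_wpM2l// exprn_ge0// addr_ge0// mulr_ge0//.
have h3 : a * z ^+ (2 * k) <= a * `|y| ^+ (2 * k) + D.
  rewrite /D -mulrDr; apply: ler_wpM2l; first exact: ltW.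
  apply: (le_trans h1); rewrite lerD2l -!mulrA ler_wpM2l ?ler0n//.
have ey : `|y| ^+ (2 * k) = y ^+ (2 * k).
  by rewrite !(mulnC 2) !exprM -normrX real_normK ?num_real.
by move: h3; rewrite ey; lra.
Qed.

(** The logarithmic derivative of the tail is at most of order
[(1 + z) ^+ (2 * k - 1)], by the lower Mills bound. *)
Lemma target_tail_shift (K : R) : 0 <= K -> exists2 C, 0 < C &
  forall z y r, 0 <= z -> 0 <= r -> r * (1 + z) ^+ m <= K -> `|y - z| <= r ->
    `|q y - q z| <= C * (r * (1 + z) ^+ m) * q z.
Proof.
move=> K0; have [C C0 HC] := target_fun_shift K0.
have [c c0 Hc] := target_mills_lower a0 k0.
exists (C / c); first exact: divr_gt0.
move=> z y r z0 r0 rK yz.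
have I0 : 0 < target_mass a k by exact: target_mass_gt0.
have key : `|target_upper a k y - target_upper a k z| <= C * target_fun a k z * `|y - z|.
  apply: MVT_norm_le => [x|x]; first exact: is_derive_target_upper.
  move=> xz; rewrite normrN gtr0_norm ?target_fun_gt0//.
  by apply: (HC _ _ r) => //; exact: le_trans yz.
rewrite /target_tail -mulrBl normrM normfV (gtr0_norm I0) [leRHS]mulrA ler_pM2r ?invr_gt0//.
apply: (le_trans key).
apply: (@le_trans _ _ (C * target_fun a k z * r)).
  by rewrite ler_wpM2l// mulr_ge0 ?expR_ge0// ltW.
have -> : C * target_fun a k z * r = (C / c * r) * (c * target_fun a k z).
  by field; rewrite gt_eqF.
have -> : C / c * (r * (1 + z) ^+ m) * target_upper a k z =
   (C / c * r) * (target_upper a k z * (1 + z) ^+ m) by ring.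
by apply: ler_wpM2l (Hc _ z0); rewrite mulr_ge0// ltW// divr_gt0.
Qed.

End target_tail_shift.

(** * One bounded symmetric spin *)

Section bounded_spin.
Context d (T : measurableType d) (R : realType) (P : probability T R).
Variables (X : T -> R) (L : R).
Hypotheses (L0 : 0 <= L) (mX : measurable_fun setT X).
Hypothesis XL : forall x, `|X x| <= L.
Hypothesis X_sym : forall g : R -> R, continuous g ->
  \int[P]_x g (- X x) = \int[P]_x g (X x).
Hypothesis X_var : \int[P]_x (X x ^+ 2) = 1.
Local Notation h := (cumulant_gap P X).
Variable k : nat.
Hypotheses (k0 : (0 < k)%N) (h_root : forall s, h^`()%classic s = 0 <-> s = 0).
Hypothesis h_flat : forall i, (i <= 2 * k - 1)%N -> h^`(i)%classic 0 = 0.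
Local Notation a := (h^`(2 * k)%classic 0 / (2 * k)`!%:R).
Hypothesis a_gt0 : 0 < a.
Local Notation m := (2 * k - 1)%N.
Local Notation leb := (@lebesgue_measure R).
Local Notation pair_law n := (P \x power_prob P n)%E.

Lemma bmfun_spin : bmfun X. Proof. by split => //; exists L. Qed.

Let bX := bmfun_spin.

Section symmetric_spin.

Lemma continuous_spin (g : R -> R) : continuous g -> bmfun (fun x => g (X x)).
Proof. by move=> cg; exact: bmfun_continuous_comp. Qed.

Lemma Rint_odd (g : R -> R) : continuous g -> (forall y, g (- y) = - g y) ->
  \int[P]_x g (X x) = 0.
Proof.
move=> cg godd; have := X_sym cg; under eq_Rintegral do rewrite godd -mulN1r.
by rewrite RintZl ?mulN1r; [lra|exact: continuous_spin].
Qed.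

Lemma Rint_spin_le (g : R -> R) (K : R) : continuous g ->
  (forall y, `|y| <= L -> `|g y| <= K) -> `|\int[P]_x g (X x)| <= K.
Proof.
move=> cg gK; rewrite -[leRHS](@Rint_cst _ _ _ P); apply: ler_norm_Rint.
- exact: continuous_spin.
- exact: bmfun_cst.
- by move=> x; exact: gK.
Qed.

(** Given that the other spins sum to [t], a spin of the model with [n] spins has
weight [expR (s * X) * spin_weight eps] with [s = t / n] and [eps = 1 / n];
[spin_mean] and [spin_var] are its conditional mean and variance. *)
Definition spin_weight (eps : R) x := expR (eps / 2 * X x ^+ 2).

Lemma bmfun_spin_weight eps : bmfun (spin_weight eps).
Proof. exact: (continuous_spin (@continuous_sqr_expR _ (eps / 2))). Qed.

Let N eps := tilt_mom P X (spin_weight eps).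

Definition spin_mean (eps s : R) := N eps 1 s / N eps 0 s.
Definition spin_var (eps s : R) := N eps 2 s / N eps 0 s - spin_mean eps s ^+ 2.

Lemma spin_weight0 : spin_weight 0 = fun=> 1.
Proof. by apply/funext => x; rewrite /spin_weight !mul0r expR0. Qed.

Lemma spin_weight_ge1 (eps : R) x : 0 <= eps -> 1 <= spin_weight eps x.
Proof.
by move=> e0; rewrite -expR0 ler_expR mulr_ge0 ?sqr_ge0// divr_ge0.
Qed.

Lemma tilt_mom_lower (eps : R) (s : R) (r : R) : 0 <= eps -> `|s| <= r ->
  expR (- (r * L)) <= N eps 0 s.
Proof.
move=> e0 sr; rewrite -[leLHS](@Rint_cst _ _ _ P); apply: ler_Rint.
- exact: bmfun_cst.
- exact: (bmfun_tilt_mom bX (bmfun_spin_weight eps)).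
- move=> x; rewrite mul1r -[leLHS]mulr1; apply: ler_pM.
  + exact: expR_ge0.
  + exact: ler01.
  + rewrite ler_expR lerNl (le_trans (ler_norm _))//.
    by rewrite normrN normrM ler_pM.
  + exact: spin_weight_ge1.
Qed.

Lemma spin_mom0_gt0 eps s : 0 <= eps -> 0 < tilt_mom P X (spin_weight eps) 0 s.
Proof.
move=> e0; apply: lt_le_trans (expR_gt0 (- (`|s| * L))) _.
exact: tilt_mom_lower (lexx _).
Qed.

Lemma spin_mean_le eps s : 0 <= eps -> `|spin_mean eps s| <= L.
Proof.
move=> e0; have N0 := spin_mom0_gt0 s e0.
rewrite normrM normfV (gtr0_norm N0) ler_pdivrMr//.
have bw := bmfun_spin_weight eps.
rewrite /tilt_mom -RintZl; last exact: (bmfun_tilt_mom bX bw).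
apply: ler_norm_Rint.
- exact: (bmfun_tilt_mom bX bw).
- by apply: bmfunM; [exact: bmfun_cst|exact: (bmfun_tilt_mom bX bw)].
move=> x; rewrite expr1 expr0 mul1r !normrM !(ger0_norm (expR_ge0 _)) -mulrA.
by rewrite ler_wpM2r// mulr_ge0 ?expR_ge0.
Qed.

Lemma spin_weight_sub1 (eps : R) x : 0 <= eps <= 1 ->
  `|spin_weight eps x - 1| <= eps * (L ^+ 2 * expR (L ^+ 2)).
Proof. by move=> e01; exact: expR_sqr_sub1_le. Qed.

(** By symmetry only the odd part of [expR (s * X)] contributes, and it is
[O(s)]. *)
Lemma odd_moment_le (w : R -> R) (K r : R) : continuous w ->
  (forall y, w (- y) = w y) -> (forall y, `|y| <= L -> `|w y| <= K) ->
  forall s, `|s| <= r ->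
  `|\int[P]_x (X x * expR (s * X x) * w (X x))|
    <= L ^+ 2 * expR (r * L) * K * `|s|.
Proof.
move=> cw w_even wK s sr.
have c1 : continuous (fun y : R => y * w y).
  exact: continuousMr (@continuous_idr _) cw.
have c2 : continuous (fun y : R => y * (expR (s * y) - 1) * w y).
  apply: continuousMr cw; apply: continuousMr (@continuous_idr _) _.
  exact: (continuousBr (@continuous_scaled_expR R s) (@continuous_cstr R 1)).
have -> : \int[P]_x (X x * expR (s * X x) * w (X x)) =
    \int[P]_x (X x * (expR (s * X x) - 1) * w (X x)).
  rewrite -[RHS]addr0 -(@Rint_odd (fun y => y * w y)) //; last first.
    by move=> y; rewrite w_even mulNr.
  rewrite -RintD; last 2 first.
    exact: continuous_spin c2.
    exact: continuous_spin c1.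
  by apply: eq_Rintegral => x _; ring.
apply: (Rint_spin_le c2) => y yL; rewrite !normrM.
have h := expR_sub1_norm (s * y).
have syrL : `|s * y| <= r * L by rewrite normrM ler_pM.
have h' : `|expR (s * y) - 1| <= `|s| * L * expR (r * L).
  apply: (le_trans h); apply: ler_pM; rewrite ?expR_ge0 ?ler_expR//.
  by rewrite normrM ler_wpM2l.
have -> : L ^+ 2 * expR (r * L) * K * `|s| = L * (`|s| * L * expR (r * L)) * K by ring.
by apply: ler_pM; rewrite ?mulr_ge0//; [apply: ler_pM|exact: wK].
Qed.

(** Both bounds are linear in [s]: the factor [s] that symmetry provides is what
keeps the self-interaction [eps] from contributing at the leading order. *)
Lemma spin_mean_bounds (r : R) : 0 <= r -> exists2 C, 0 <= C &
  forall eps s : R, 0 <= eps <= 1 -> `|s| <= r ->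
    `|spin_mean eps s| <= C * `|s| /\
    `|spin_mean eps s - spin_mean 0 s| <= C * (eps * `|s|).
Proof.
move=> r0; pose K0 := expR (L ^+ 2); pose K1 := L ^+ 2 * expR (L ^+ 2).
pose B := L ^+ 2 * expR (r * L); pose c := expR (- (r * L)).
have c0 : 0 < c by exact: expR_gt0.
have K00 : 0 <= K0 by exact: expR_ge0.
have K10 : 0 <= K1 by rewrite mulr_ge0 ?expR_ge0// sqr_ge0.
have B0 : 0 <= B by rewrite mulr_ge0 ?expR_ge0// sqr_ge0.
exists (B * K0 / c + (B * K1 / c + B * K0 / c * (expR (r * L) * K1) / c)).
  by rewrite !addr_ge0// !mulr_ge0// ?invr_ge0 ?expR_ge0// ltW.
move=> eps s /andP[e0 e1] sr.
have N0 e : 0 <= e -> c <= N e 0 s by move=> ?; exact: tilt_mom_lower.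
have Npos e : 0 <= e -> 0 < N e 0 s by move=> /N0; exact: lt_le_trans.
have N1 e : 0 <= e <= 1 -> `|N e 1 s| <= B * K0 * `|s|.
  move=> /andP[e0' e1'].
  apply: (odd_moment_le (w := fun y => expR (e / 2 * y ^+ 2)) (K := K0) _ _ _ sr).
  - exact: continuous_sqr_expR.
  - by move=> y; rewrite sqrrN.
  - move=> y yL; rewrite ger0_norm ?expR_ge0// ler_expR.
    have : y ^+ 2 <= L ^+ 2 by exact: sqr_norm_le.
    by have := sqr_ge0 y; nra.
have dN1 : `|N eps 1 s - N 0 1 s| <= B * K1 * (eps * `|s|).
  have -> : N eps 1 s - N 0 1 s =
     \int[P]_x (X x * expR (s * X x) * (expR (eps / 2 * X x ^+ 2) - 1)).
    rewrite /N spin_weight0 /tilt_mom -RintB; last 2 first.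
      exact: (bmfun_tilt_mom bX (bmfun_spin_weight eps)).
      exact: (bmfun_tilt_mom bX (bmfun_cst _ 1)).
    by apply: eq_Rintegral => x _; rewrite /spin_weight expr1; ring.
  have -> : B * K1 * (eps * `|s|) = B * (eps * K1) * `|s| by ring.
  apply: (odd_moment_le (w := fun y => expR (eps / 2 * y ^+ 2) - 1)
    (K := eps * K1) _ _ _ sr).
  - exact: (continuousBr (@continuous_sqr_expR R (eps / 2)) (@continuous_cstr R 1)).
  - by move=> y; rewrite sqrrN.
  - by move=> y yL; apply: expR_sqr_sub1_le => //; rewrite e0.
have dN0 : `|N eps 0 s - N 0 0 s| <= expR (r * L) * K1 * eps.
  rewrite /N spin_weight0 /tilt_mom -RintB; last 2 first.
    exact: (bmfun_tilt_mom bX (bmfun_spin_weight eps)).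
    exact: (bmfun_tilt_mom bX (bmfun_cst _ 1)).
  rewrite -[leRHS](@Rint_cst _ _ _ P); apply: ler_norm_Rint.
  - apply: bmfunB; last exact: (bmfun_tilt_mom bX (bmfun_cst _ 1)).
    exact: (bmfun_tilt_mom bX (bmfun_spin_weight eps)).
  - exact: bmfun_cst.
  move=> x; rewrite !mul1r -mulrBr normrM -mulrA; apply: ler_pM => //.
    rewrite ger0_norm ?expR_ge0// ler_expR (le_trans (ler_norm _))// normrM.
    exact: ler_pM.
  by rewrite mulrC; apply: spin_weight_sub1; rewrite e0.
have Ne := Npos _ e0; have NO := Npos 0 (lexx _).
have e01 : 0 <= eps <= 1 by rewrite e0.
have Q0 : 0 <= B * K0 / c * `|s| by rewrite !mulr_ge0 ?invr_ge0// ltW.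
have step e : 0 <= e <= 1 -> `|spin_mean e s| <= B * K0 / c * `|s|.
  move=> e01'; have e0' : 0 <= e by case/andP: e01'.
  rewrite normrM normfV (gtr0_norm (Npos _ e0')) ler_pdivrMr ?Npos//.
  apply: le_trans (N1 _ e01') _.
  have -> : B * K0 * `|s| = B * K0 / c * `|s| * c by field; rewrite gt_eqF.
  by apply: ler_wpM2l => //; exact: N0.
split; first by rewrite (le_trans (step _ e01))// ler_wpM2r// lerDl !addr_ge0//
  !mulr_ge0// ?invr_ge0 ?expR_ge0// ltW.
apply: le_trans (ratio_diff_le c0 Ne (N0 0 (lexx _)) (step _ e01) dN1 dN0) _.
have -> : B * K1 * (eps * `|s|) / c + B * K0 / c * `|s| * (expR (r * L) * K1 * eps) / c =
  (B * K1 / c + B * K0 / c * (expR (r * L) * K1) / c) * (eps * `|s|) by ring.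
rewrite ler_wpM2r ?mulr_ge0// lerDr !mulr_ge0// invr_ge0 ltW//.
Qed.

(** The terms of first order in [s] integrate to 0, leaving an error quadratic in
[s]. *)
Lemma even_moment_le (r : R) : 0 <= r -> exists2 C, 0 <= C & forall eps s : R,
  0 <= eps <= 1 -> `|s| <= r ->
  `|N eps 0 s - 1| <= C * (s ^+ 2 + eps) /\ `|N eps 2 s - 1| <= C * (s ^+ 2 + eps).
Proof.
move=> r0; pose K1 := L ^+ 2 * expR (L ^+ 2).
pose K := expR (r * L) * (K1 + L ^+ 2).
have K10 : 0 <= K1 by rewrite mulr_ge0 ?expR_ge0// sqr_ge0.
have K0 : 0 <= K by rewrite mulr_ge0 ?expR_ge0// addr_ge0 ?sqr_ge0.
exists (K + L ^+ 2 * K) => [|eps s e01 sr].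
  by apply: addr_ge0 => //; apply: mulr_ge0 => //; exact: sqr_ge0.
have e0 : 0 <= eps by case/andP: e01.
have s2e : 0 <= s ^+ 2 + eps by rewrite addr_ge0 ?sqr_ge0.
pose g (y : R) := expR (s * y) * expR (eps / 2 * y ^+ 2) - 1 - s * y.
have cg : continuous g.
  have c1 := continuousMr (@continuous_scaled_expR R s) (@continuous_sqr_expR R (eps / 2)).
  have c2 := continuousMr (@continuous_cstr R s) (@continuous_idr R).
  exact: (continuousBr (continuousBr c1 (@continuous_cstr R 1)) c2).
have gK y : `|y| <= L -> `|g y| <= K * (s ^+ 2 + eps).
  move=> yL; have -> : g y = expR (s * y) * (expR (eps / 2 * y ^+ 2) - 1) +
     (expR (s * y) - 1 - s * y) by rewrite /g; ring.
  have syrL : `|s * y| <= r * L by rewrite normrM ler_pM.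
  have yL2 := sqr_norm_le yL; have y20 := sqr_ge0 y.
  have h1 : `|expR (eps / 2 * y ^+ 2) - 1| <= eps * K1 by exact: expR_sqr_sub1_le.
  have h2 : `|expR (s * y) - 1 - s * y| <= s ^+ 2 * L ^+ 2 * expR (r * L).
    apply: le_trans (expR_sub1_le _) _; rewrite exprMn.
    apply: ler_pM; rewrite ?expR_ge0 ?ler_expR//.
      by apply: mulr_ge0; rewrite ?sqr_ge0.
    by rewrite ler_wpM2l ?sqr_ge0.
  rewrite (le_trans (ler_normD _ _))// normrM (ger0_norm (expR_ge0 _)).
  have h3 : expR (s * y) <= expR (r * L) by rewrite ler_expR (le_trans (ler_norm _)).
  have h4 : expR (s * y) * `|expR (eps / 2 * y ^+ 2) - 1| <= expR (r * L) * (eps * K1).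
    by apply: ler_pM; rewrite ?expR_ge0.
  apply: le_trans (lerD h4 h2) _.
  have -> : K * (s ^+ 2 + eps) = expR (r * L) * (eps * K1) + s ^+ 2 * L ^+ 2 * expR (r * L)
    + expR (r * L) * (s ^+ 2 * K1 + eps * L ^+ 2) by rewrite /K; ring.
  by rewrite lerDl mulr_ge0 ?expR_ge0// addr_ge0// mulr_ge0 ?sqr_ge0.
have key j : ~~ odd j -> \int[P]_x (X x ^+ j) = 1 -> N eps j s - 1 = \int[P]_x (X x ^+ j * g (X x)).
  move=> oj Xj.
  have cj : continuous (fun y : R => y ^+ j * g y).
    exact: (continuousMr (@continuous_Xn R j) cg).
  have cj1 : continuous (fun y : R => s * y ^+ j.+1).
    exact: (continuousMr (@continuous_cstr R s) (@continuous_Xn R j.+1)).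
  have Oj : \int[P]_x (s * X x ^+ j.+1) = 0.
    apply: (Rint_odd cj1) => y.
    by rewrite exprNn exprS -signr_odd (negbTE oj) mulr1 mulN1r mulrN.
  have -> : \int[P]_x (X x ^+ j * g (X x)) =
      \int[P]_x (X x ^+ j * g (X x)) + \int[P]_x (s * X x ^+ j.+1) + \int[P]_x (X x ^+ j) - 1.
    by rewrite Oj Xj; ring.
  congr (_ - 1).
  rewrite -RintD; [|exact: continuous_spin cj|exact: continuous_spin cj1].
  rewrite -RintD; last 2 first.
    by apply: bmfunD; [exact: continuous_spin cj|exact: continuous_spin cj1].
    exact: continuous_spin (@continuous_Xn _ j).
  by apply: eq_Rintegral => x _; rewrite /g /spin_weight (exprS _ j); ring.
split.
  rewrite key ?Rint_cst//.
  apply: le_trans (Rint_spin_le (g := fun y => y ^+ 0 * g y) (K := K * (s ^+ 2 + eps)) _ _) _.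
  - exact: (continuousMr (@continuous_Xn R 0) cg).
  - by move=> y yL; rewrite mul1r gK.
  - by rewrite ler_wpM2r// lerDl mulr_ge0 ?sqr_ge0.
rewrite key//.
apply: le_trans (Rint_spin_le (g := fun y => y ^+ 2 * g y) (K := L ^+ 2 * K * (s ^+ 2 + eps)) _ _) _.
- exact: (continuousMr (@continuous_Xn R 2) cg).
- move=> y yL; rewrite normrM -mulrA ler_pM ?gK// ger0_norm ?sqr_ge0//.
  exact: sqr_norm_le.
- by rewrite ler_wpM2r// lerDr.
Qed.

Lemma spin_var_bound (r : R) : 0 <= r -> exists2 C, 0 <= C &
  forall eps s : R, 0 <= eps <= 1 -> `|s| <= r ->
    `|spin_var eps s - 1| <= C * (s ^+ 2 + eps).
Proof.
move=> r0; have [C1 C10 H1] := spin_mean_bounds r0.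
have [C2 C20 H2] := even_moment_le r0.
have c0 : 0 < expR (- (r * L)) by exact: expR_gt0.
exists (2 * C2 / expR (- (r * L)) + C1 ^+ 2) => [|eps s e01 sr].
  by rewrite addr_ge0 ?sqr_ge0// !mulr_ge0// invr_ge0 ltW.
have e0 : 0 <= eps by case/andP: e01.
have [m1 _] := H1 _ _ e01 sr; have [n0 n2] := H2 _ _ e01 sr.
have N0 := tilt_mom_lower e0 sr; have Npos := lt_le_trans c0 N0.
have -> : spin_var eps s - 1 = (N eps 2 s - N eps 0 s) / N eps 0 s - spin_mean eps s ^+ 2.
  by rewrite /spin_var; field; rewrite gt_eqF.
apply: (le_trans (ler_normB _ _)); rewrite [leRHS]mulrDl; apply: lerD.
  rewrite normrM normfV (gtr0_norm Npos) ler_pdivrMr//.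
  have -> : N eps 2 s - N eps 0 s = (N eps 2 s - 1) - (N eps 0 s - 1) by ring.
  have s2e : 0 <= s ^+ 2 + eps by rewrite addr_ge0 ?sqr_ge0.
  have t0 : 0 <= 2 * C2 * (s ^+ 2 + eps) by rewrite !mulr_ge0.
  apply: (le_trans (ler_normB _ _)); apply: (le_trans (lerD n2 n0)).
  have -> : C2 * (s ^+ 2 + eps) + C2 * (s ^+ 2 + eps) =
    2 * C2 / expR (- (r * L)) * (s ^+ 2 + eps) * expR (- (r * L)).
    by field; rewrite gt_eqF.
  by rewrite ler_wpM2l// !mulr_ge0// invr_ge0 ltW.
rewrite normrX; have : `|spin_mean eps s| ^+ 2 <= (C1 * `|s|) ^+ 2.
  by rewrite lerXn2r ?nnegrE// mulr_ge0.
move/le_trans; apply; rewrite exprMn real_normK ?num_real//.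
by rewrite ler_wpM2l ?sqr_ge0// lerDl.
Qed.

End symmetric_spin.

(** * Growth of the cumulant gap *)

Section gap_growth.


Lemma gap_derive1E s : h^`()%classic s = s - spin_mean 0 s.
Proof. by rewrite derive1_cumulant_gap// /spin_mean spin_weight0. Qed.

Let dh (s : R) : is_derive s 1 h (h^`()%classic s).
Proof. by have := cumulant_gap_smooth P bX 0 s; rewrite derive1n0 derive1n1. Qed.

Let cdh : continuous h^`()%classic.
Proof.
have H (s : R) := cumulant_gap_smooth P bX 1 s.
by have := is_derive_continuous H; rewrite derive1n1.
Qed.

Lemma gap_derive1_taylor (r : R) : exists2 C, 0 <= C & forall s, `|s| <= r ->
  `|h^`()%classic s - (2 * k)%:R * a * s ^+ (2 * k - 1)| <= C * `|s| ^+ (2 * k + 1).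
Proof.
have H1 := cumulant_gap_smooth P bX.
have H2 := cumulant_gap_even X_sym.
have H := derive1_taylor_even H1 H2 k0 h_flat.
exact: (H r).
Qed.

Lemma gap_taylor (r : R) : exists2 C, 0 <= C & forall s, `|s| <= r ->
  `|h s - a * s ^+ (2 * k)| <= C * `|s| ^+ (2 * k + 2).
Proof.
have [C C0 HC] := gap_derive1_taylor r; exists C => // s sr.
pose F (x : R) := h x - a * x ^+ (2 * k).
have dF (x : R) : is_derive x 1 F (h^`()%classic x - (2 * k)%:R * a * x ^+ (2 * k - 1)).
  have H := is_derive_Br (dh x) (is_derive_cstM a (is_derive_Xn x (2 * k))).
  by apply: (is_derive_eqr H); rewrite -subn1; ring.
have F0 : F 0 = 0.
  rewrite /F expr0n muln_eq0/= gtn_eqF// mulr0 subr0.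
  by have := @h_flat 0%N isT; rewrite derive1n0.
have := @MVT_norm_le _ F _ 0 s (C * `|s| ^+ (2 * k + 1)) dF.
rewrite F0 !subr0 => /(_ _)/le_trans; apply; last first.
  by rewrite -mulrA -exprSr -addnS.
move=> x; rewrite subr0 => xs'.
apply: le_trans (HC _ (le_trans xs' sr)) _.
by rewrite ler_wpM2l// lerXn2r// nnegrE.
Qed.

(** Near 0 the Taylor expansion makes [h'] positive; having no other zero it stays
positive, hence is bounded below on compact sets, and for large [s] it is at
least [s - L]. *)
Lemma gap_derive1_growth : exists2 c, 0 < c &
  forall s, 0 <= s -> c * Num.min s 1 ^+ (2 * k - 1) <= h^`()%classic s.
Proof.
have [C C0 HC] := gap_derive1_taylor 1.
have ka0 : 0 < k%:R * a by rewrite mulr_gt0// ltr0n.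
(* up to [s0] the Taylor remainder is at most half of the leading term *)
pose s0 := Num.min 1 (k%:R * a / (C + 1)).
have C1 : 0 < C + 1 by rewrite ltr_wpDl.
have s0_gt0 : 0 < s0 by rewrite lt_min ltr01 divr_gt0.
have s01 : s0 <= 1 by rewrite ge_min lexx.
have near0 s : 0 <= s <= s0 -> k%:R * a * s ^+ (2 * k - 1) <= h^`()%classic s.
  move=> /andP[sge0 ss0]; have s1 : s <= 1 by exact: le_trans s01.
  have := HC s; rewrite ger0_norm// => /(_ s1).
  rewrite ler_norml => /andP[+ _].
  have -> : (2 * k + 1 = (2 * k - 1) + 2)%N by lia.
  rewrite exprD => H.
  have Cs : C * s ^+ 2 <= k%:R * a.
    have h1 : s <= k%:R * a / (C + 1).
      by rewrite (le_trans ss0)// ge_min lexx orbT.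
    have h2 : s * (C + 1) <= k%:R * a by rewrite -ler_pdivlMr.
    have h3 : s ^+ 2 <= s by rewrite expr2 -[leRHS]mulr1 ler_wpM2l.
    have : C * s ^+ 2 <= C * s by rewrite ler_wpM2l.
    by lra.
  have p0 : 0 <= s ^+ (2 * k - 1) by rewrite exprn_ge0.
  have : C * s ^+ 2 * s ^+ (2 * k - 1) <= k%:R * a * s ^+ (2 * k - 1).
    by rewrite ler_wpM2r.
  by rewrite natrM in H; lra.
have h_pos s : 0 < s -> 0 < h^`()%classic s.
  move=> sgt0; have [ss0|ss0] := leP s s0.
    apply: lt_le_trans (near0 s _); last by rewrite ltW.
    by rewrite mulr_gt0// exprn_gt0.
  rewrite ltNge; apply/negP => hs.
  have hs0 : 0 < h^`()%classic s0.
    apply: lt_le_trans (near0 s0 _); last by rewrite ltW/=.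
    by rewrite mulr_gt0// exprn_gt0.
  have hs_s0 : h^`()%classic s <= h^`()%classic s0 by rewrite (le_trans hs)// ltW.
  have [x] : exists2 x, x \in `[s0, s]%R & h^`()%classic x = 0.
    apply: (IVT (ltW ss0) (continuous_subspaceT cdh)).
    by rewrite (min_r hs_s0) (max_l hs_s0) hs/= ltW.
  rewrite in_itv/= => /andP[s0x _] /h_root x0.
  by move: s0x; rewrite x0 leNgt s0_gt0.
pose S := L + 1.
have s0S : s0 <= S by rewrite (le_trans s01)// lerDr.
have [m mS mmin] := @EVT_min _ h^`()%classic s0 S s0S (continuous_subspaceT cdh).
have hm : 0 < h^`()%classic m.
  by apply: h_pos; move: mS; rewrite in_itv/= => /andP[+ _]; exact: lt_le_trans.
pose c := Num.min (k%:R * a) (Num.min (h^`()%classic m) 1).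
have c0 : 0 < c by rewrite !lt_min ka0 hm ltr01.
have [cka cm c1] : [/\ c <= k%:R * a, c <= h^`()%classic m & c <= 1].
  by rewrite !ge_min !lexx !orbT.
clearbody c; exists c; first exact: c0.
move=> s sge0; have ms0 : 0 <= Num.min s 1 by rewrite le_min sge0 ler01.
have p1 : Num.min s 1 ^+ (2 * k - 1) <= 1.
  by apply: exprn_ile1 => //; rewrite ge_min lexx orbT.
have pge0 : 0 <= Num.min s 1 ^+ (2 * k - 1) by rewrite exprn_ge0.
have cp : c * Num.min s 1 ^+ (2 * k - 1) <= c.
  by rewrite -[leRHS]mulr1 ler_wpM2l// ltW.
have [ss0|ss0] := leP s s0.
  have -> : Num.min s 1 = s by rewrite min_l// (le_trans ss0).
  apply: le_trans (near0 s _); last by rewrite sge0.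
  by rewrite ler_wpM2r ?exprn_ge0.
have [sS|sS] := leP s S.
  apply: (le_trans cp); apply: (le_trans cm).
  by apply: mmin; rewrite in_itv/= ltW.
rewrite gap_derive1E; apply: (le_trans cp); apply: (le_trans c1).
by have := le_trans (ler_norm _) (spin_mean_le s (lexx 0)); rewrite /S in sS; lra.
Qed.

Lemma gap_growth : exists2 c, 0 < c & forall u s, 0 <= u <= s ->
  h u + c * Num.min u 1 ^+ (2 * k - 1) * (s - u) <= h s.
Proof.
have [c c0 hc] := gap_derive1_growth; exists c => // u s /andP[u0 us].
have := @MVT_le _ (fun x => -1 * h x) (fun x => -1 * h^`()%classic x) u s
  (- (c * Num.min u 1 ^+ (2 * k - 1))) us.
move=> /(_ _ _ _)/wrap[].
- by move=> x _; exact: (is_derive_cstM (-1) (dh x)).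
- apply: continuous_subspaceT.
  exact: (is_derive_continuous (fun x => is_derive_cstM (-1) (dh x))).
- move=> x /andP[ux xs]; rewrite mulN1r lerN2.
  apply: le_trans (hc x _); last by rewrite (le_trans u0)// ltW.
  rewrite ler_wpM2l ?(ltW c0)// lerXn2r ?nnegrE ?le_min ?u0 ?ler01//=.
    by rewrite (le_trans u0 (ltW ux)).
  by rewrite !ge_min (ltW ux) lexx !orbT.
move: (h s) (h u) (c * _) => hs hu cu; lra.
Qed.

End gap_growth.

(** * Sums of independent spins *)

Section spin_sums.

Definition spin_sum n (t : n.-tuple T) : R := \sum_(i < n) X (tnth t i).

Lemma spin_sum_cons n (x : T) (t : n.-tuple T) :
  spin_sum (tuple_cons (x, t)) = X x + spin_sum t.
Proof.
rewrite /spin_sum big_ord_recl; congr (X _ + _).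
by apply: eq_bigr => i _; rewrite /tuple_cons /= tnthS.
Qed.

Lemma spin_sum_le n (t : n.-tuple T) : `|spin_sum t| <= n%:R * L.
Proof.
rewrite (le_trans (ler_norm_sum _ _ _))// (le_trans (ler_sum _ (G := fun=> L) _))//.
by rewrite sumr_const card_ord mulr_natl.
Qed.

Lemma bmfun_spin_sum n : bmfun (@spin_sum n).
Proof.
split; last by exists (n%:R * L) => t; exact: spin_sum_le.
rewrite /spin_sum; apply: measurable_sum => i.
by apply: measurableT_comp mX _; exact: measurable_tnth.
Qed.

Lemma Rint_power_cons n (G : n.+1.-tuple T -> R) : bmfun G ->
  \int[power_prob P n.+1]_t G t =
  \int[pair_law n]_u G (tuple_cons u).
Proof.
move=> [mG [M GM]]; rewrite /Rintegral; congr fine.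
rewrite /= integral_distribution//.
  exact/measurable_EFinP.
apply: (@bmfun_integrable _ _ _ (pair_law n) (G \o @tuple_cons _ _ n)); split.
  by apply: measurableT_comp => //; exact: measurable_tuple_cons.
by exists M => u; exact: GM.
Qed.

(** One spin is singled out: the sample space is a pair (one spin, all others). *)
Definition spin_total n (u : T * n.-tuple T) : R := X u.1 + spin_sum u.2.

Lemma bmfun_fst n : bmfun (fun u : T * n.-tuple T => X u.1).
Proof. by split; [exact: measurableT_comp|exists L => u; exact: XL]. Qed.

Lemma bmfun_snd n (G : n.-tuple T -> R) : bmfun G ->
  bmfun (fun u : T * n.-tuple T => G u.2).
Proof.
by move=> [mG [M GM]]; split; [exact: measurableT_comp|exists M => u; exact: GM].
Qed.

Lemma bmfun_spin_total n : bmfun (@spin_total n).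
Proof.
apply: bmfunD; first exact: bmfun_fst.
exact: bmfun_snd (bmfun_spin_sum n).
Qed.


Lemma mgf_total n (s : R) :
  \int[pair_law n]_u expR (s * spin_total u) =
  tilt_mom P X (fun=> 1) 0 s ^+ n.+1.
Proof.
have prodE m : \int[pair_law m]_u expR (s * spin_total u) =
    tilt_mom P X (fun=> 1) 0 s * \int[power_prob P m]_t expR (s * spin_sum t).
  have bs : bmfun (fun t : m.-tuple T => expR (s * spin_sum t)).
    exact: (bmfun_continuous_comp (@continuous_scaled_expR R s) (bmfun_spin_sum m)).
  have btot := bmfun_continuous_comp (@continuous_scaled_expR R s) (bmfun_spin_total m).
  rewrite Rint_prod2// -RintZl//; apply: eq_Rintegral => t _.
  rewrite /tilt_mom mulrC -RintZl; last exact: (bmfun_tilt_mom bX (bmfun_cst _ 1)).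
  apply: eq_Rintegral => x _.
  by rewrite /spin_total/= expr0 mul1r mulr1 mulrDr expRD mulrC.
suff power m : \int[power_prob P m]_t expR (s * spin_sum t) =
    tilt_mom P X (fun=> 1) 0 s ^+ m by rewrite prodE power exprS.
elim: m => [|m IH].
  rewrite expr0 -[RHS](@Rint_cst _ _ _ (power_prob P 0)).
  by apply: eq_Rintegral => t _; rewrite /spin_sum big_ord0 mulr0 expR0.
rewrite (Rint_power_cons (G := fun t => expR (s * spin_sum t))); last first.
  exact: (bmfun_continuous_comp (@continuous_scaled_expR R s) (bmfun_spin_sum m.+1)).
rewrite exprS -IH -prodE; apply: eq_Rintegral => -[x t] _.
by rewrite spin_sum_cons.
Qed.

End spin_sums.

(** * Moments of the magnetization *)

Section laplace.

Lemma expR_gap n s : expR (- (n%:R * h s)) =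
  expR (- (n%:R * s ^+ 2 / 2)) * tilt_mom P X (fun=> 1) 0 s ^+ n.
Proof.
have M0 := tilt_mom0_gt0 P bX s.
rewrite -[X in _ * X ^+ n](lnK M0) -expRM_natl -expRD /cumulant_gap; congr expR.
by ring.
Qed.

(** Up to [b * t = z1] the Taylor remainder [n * t ^+ (2 * k + 2)] is bounded;
[z1] is the limit of the moderate deviation range. *)
Lemma gap_scaled_lower (K : R) : exists2 C, 0 <= C & forall n (b t z1 : R),
  0 < b -> b ^+ (2 * k) = n%:R -> 0 <= t <= K -> b * t <= z1 ->
  z1 ^+ (2 * k + 2) <= K * b ^+ 2 ->
  a * (b * t) ^+ (2 * k) - C <= n%:R * h t.
Proof.
have [C C0 HC] := gap_taylor K.
exists (C * `|K|) => [|n b t z1 b0 bn /andP[t0 tK] bt z1K]; first exact: mulr_ge0.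
have := HC t; rewrite ger0_norm// => /(_ tK); rewrite ler_norml => /andP[hlow _].
have b20 : 0 < b ^+ 2 by rewrite exprn_gt0.
have nt : n%:R * t ^+ (2 * k + 2) <= `|K|.
  rewrite -(ler_pM2r b20) -bn exprD mulrA -exprMn -mulrA -exprMn [t * b]mulrC -exprD.
  apply: (@le_trans _ _ (z1 ^+ (2 * k + 2))).
    by rewrite lerXn2r ?nnegrE ?mulr_ge0 ?(ltW b0)// (le_trans _ bt)// mulr_ge0// ltW.
  by apply: (le_trans z1K); rewrite ler_wpM2r ?(ltW b20)// ler_norm.
have hn : n%:R * (a * t ^+ (2 * k) - C * t ^+ (2 * k + 2)) <= n%:R * h t.
  by rewrite ler_wpM2l//; move: hlow; rewrite lerBrDr addrC; lra.
apply: le_trans hn; rewrite exprMn bn.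
have : C * (n%:R * t ^+ (2 * k + 2)) <= C * `|K| by rewrite ler_wpM2l.
by rewrite mulrBr; lra.
Qed.

Lemma gap_scaled_growth : exists2 c, 0 < c & forall n (b t z1 : R),
  1 <= b -> b ^+ (2 * k) = n%:R -> 1 <= z1 -> z1 <= b * t ->
  n%:R * h (z1 / b) + c * (b * t - z1) <= n%:R * h t.
Proof.
have [c c0 Hc] := gap_growth.
exists c => // n b t z1 b1 bn z11 zbt; have b0 : 0 < b by rewrite (lt_le_trans ltr01).
have u0 : 0 <= z1 / b by rewrite divr_ge0 ?(ltW b0)// (le_trans ler01).
have ut : z1 / b <= t by rewrite ler_pdivrMr// mulrC.
have := Hc (z1 / b) t; rewrite u0 ut => /(_ isT) H.
apply: (@le_trans _ _ (n%:R * (h (z1 / b) + c * Num.min (z1 / b) 1 ^+ (2 * k - 1) * (t - z1 / b))));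
  last by rewrite ler_wpM2l.
rewrite [leRHS]mulrDr lerD2l.
have -> : b * t - z1 = b * (t - z1 / b) by field; rewrite gt_eqF.
set Mm := Num.min _ _ ^+ _.
have -> : n%:R * (c * Mm * (t - z1 / b)) = c * ((n%:R * Mm) * (t - z1 / b)) by ring.
rewrite ler_wpM2l ?(ltW c0)// ler_wpM2r ?subr_ge0// {}/Mm.
have bE : n%:R = b ^+ (2 * k - 1) * b by rewrite -bn -exprSr; congr (_ ^+ _); lia.
rewrite bE mulrAC -[leLHS]mul1r ler_wpM2r ?(ltW b0)// -exprMn.
apply: exprn_ege1; have [z1b|bz1] := leP (z1 / b) 1.
  by rewrite mulrC divfK ?gt_eqF.
by rewrite mulr1.
Qed.

(** Below [1 + z] the factor [trunc_exp] is at most a constant times the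
reciprocal of the Gibbs factor [expR (- n * h s)]; beyond, [trunc_exp] is frozen
and the Gibbs factor decays exponentially by [gap_scaled_growth]. A single
integrable majorant of width [(1 + z) / b] covers both. *)
Lemma gap_integrand_le j (K : R) : 1 <= K -> exists2 C, 0 < C & forall n (b z s : R),
  1 <= b -> b ^+ (2 * k) = n%:R ->
  (1 + Num.max z 0) ^+ (2 * k + 2) <= K * b ^+ 2 ->
  (1 + `|b * s|) ^+ j * trunc_exp a k z (b * s) * expR (- (n%:R * h s)) <=
    C * (1 + Num.max z 0) ^+ j * (1 + b / (1 + Num.max z 0) * `|s|) ^- 2.
Proof.
move=> K1; have K0 : 0 <= K by exact: le_trans K1.
have [C1 C10 H1] := gap_scaled_lower K; have [c c0 H2] := gap_scaled_growth.
pose D := (1 + (j + 2).+1%:R / c) ^+ (j + 2).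
have D0 : 0 <= D by rewrite exprn_ge0// addr_ge0// divr_ge0// ltW.
exists (4 * expR C1 * 2 ^+ j * (1 + D)).
  by rewrite !mulr_gt0 ?exprn_gt0 ?expR_gt0// ltr_wpDr.
move=> n b z s b1 bn zK; have b0 : 0 < b by rewrite (lt_le_trans ltr01).
set zp := Num.max z 0 in zK *; have zp0 : 0 <= zp by rewrite le_max lexx orbT.
set z1 := 1 + zp in zK *; have z11 : 1 <= z1 by rewrite lerDl.
have z10 : 0 < z1 by rewrite (lt_le_trans ltr01).
have z1Kb : z1 <= K * b.
  have : z1 ^+ (2 * k + 2) <= (K * b) ^+ (2 * k + 2).
    apply: (le_trans zK); rewrite exprMn; apply: ler_pM => //.
      by rewrite exprn_ge0// ltW.
      by rewrite -[leLHS]expr1 ler_weXn2l// addn2.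
    by rewrite ler_weXn2l// leq_addl.
  by rewrite ler_pXn2r ?addn2// nnegrE ?mulr_ge0// ltW.
set t := `|s|; have t0 : 0 <= t by exact: normr_ge0.
have -> : h s = h t.
  rewrite /t; have [s0|s0] := leP 0 s; first by rewrite ger0_norm.
  by rewrite (ltr0_norm s0); exact/esym/(cumulant_gap_even X_sym).
have bsE : `|b * s| = b * t by rewrite normrM gtr0_norm.
rewrite /trunc_exp bsE -/zp; set y := b * t.
have y0 : 0 <= y by rewrite mulr_ge0// ltW.
have yE : b / z1 * t = y / z1 by rewrite /y mulrAC.
rewrite yE ler_pdivlMr; last by rewrite exprn_gt0// ltr_wpDr// divr_ge0// ltW.
rewrite -[X in X * _ <= _]mulrA -expRD.
have lowz1 : a * z1 ^+ (2 * k) - C1 <= n%:R * h (z1 / b).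
  have bz : b * (z1 / b) = z1 by rewrite mulrC divfK ?gt_eqF.
  have := H1 n b (z1 / b) z1 b0 bn; rewrite bz; apply => //.
  by rewrite divr_ge0 ?(ltW b0) ?(ltW z10)//= ler_pdivrMr.
have [yz|zy] := leP y z1.
  have e1 : expR (a * Num.min y zp ^+ (2 * k) + - (n%:R * h t)) <= expR C1.
    rewrite ler_expR; have tK : 0 <= t <= K.
      by rewrite t0/= -(ler_pM2l b0) (le_trans yz)// mulrC.
    have := H1 n b t z1 b0 bn tK yz zK; rewrite -/y.
    have : a * Num.min y zp ^+ (2 * k) <= a * y ^+ (2 * k).
      rewrite ler_wpM2l ?(ltW a_gt0)// lerXn2r ?nnegrE ?le_min ?y0//.
      by rewrite ge_min lexx.
    by move: (a * _) (a * _) (n%:R * _) => *; lra.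
  have e2 : (1 + y) ^+ j <= (2 * z1) ^+ j by rewrite lerXn2r ?nnegrE; lra.
  have e3 : (1 + y / z1) ^+ 2 <= 2 ^+ 2.
    rewrite lerXn2r ?nnegrE ?addr_ge0 ?divr_ge0 ?(ltW z10)//.
    by rewrite -[2]/(1 + 1) lerD2l ler_pdivrMr// mul1r.
  apply: (@le_trans _ _ ((2 * z1) ^+ j * expR C1 * 2 ^+ 2)).
    by apply: ler_pM => //; [apply: mulr_ge0; rewrite ?exprn_ge0 ?addr_ge0 ?expR_ge0|
      rewrite sqr_ge0|apply: ler_pM; rewrite ?exprn_ge0 ?addr_ge0 ?expR_ge0].
  have -> : (2 * z1) ^+ j * expR C1 * 2 ^+ 2 = 4 * expR C1 * 2 ^+ j * z1 ^+ j.
    by rewrite exprMn; ring.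
  rewrite ler_wpM2r ?exprn_ge0 ?(ltW z10)// ler_peMr ?mulr_ge0 ?exprn_ge0 ?expR_ge0//.
  by rewrite lerDl.
pose u := y - z1; have u0 : 0 <= u by rewrite subr_ge0 ltW.
have yu : y = z1 + u by rewrite /u addrC subrK.
have e1 : expR (a * Num.min y zp ^+ (2 * k) + - (n%:R * h t)) <= expR C1 * expR (- (c * u)).
  rewrite -expRD ler_expR.
  have := H2 n b t z1 b1 bn z11 (ltW zy); rewrite -/y -/u.
  have : a * Num.min y zp ^+ (2 * k) <= a * z1 ^+ (2 * k).
    rewrite ler_wpM2l ?(ltW a_gt0)// lerXn2r ?nnegrE ?le_min ?y0 ?(ltW z10)//.
    by rewrite ge_min /z1 lerDr ler01 orbT.
  have aux (A B h1 h2 C c' : R) : B - C <= h1 -> A <= B -> h1 + c' <= h2 ->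
      A - h2 <= C - c' by lra.
  exact: aux lowz1.
have zu0 : 0 <= zp * u by rewrite mulr_ge0.
have e2 : (1 + y) ^+ j <= (2 * z1 * (1 + u)) ^+ j.
  have h1y : 1 + y <= 2 * z1 * (1 + u).
    have aux (v w : R) : 0 <= v -> 0 <= w -> 0 <= v * w ->
      1 + (1 + v + w) <= 2 * (1 + v) * (1 + w) by lra.
    by rewrite yu; exact: aux.
  by rewrite lerXn2r ?nnegrE ?addr_ge0// (le_trans _ h1y)// addr_ge0.
have e3 : (1 + y / z1) ^+ 2 <= (2 * (1 + u)) ^+ 2.
  have h1y : 1 + y / z1 <= 2 * (1 + u).
    rewrite yu mulrDl divff ?gt_eqF//.
    have : u / z1 <= u by rewrite ler_pdivrMr// ler_peMr.
    by lra.
  have p1 : 0 <= 1 + y / z1 by rewrite addr_ge0// divr_ge0// ltW.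
  by rewrite lerXn2r ?nnegrE// (le_trans p1).
apply: (@le_trans _ _ ((2 * z1 * (1 + u)) ^+ j * (expR C1 * expR (- (c * u))) * (2 * (1 + u)) ^+ 2)).
  by apply: ler_pM => //; [apply: mulr_ge0; rewrite ?exprn_ge0 ?addr_ge0 ?expR_ge0|
    rewrite sqr_ge0|apply: ler_pM; rewrite ?exprn_ge0 ?addr_ge0 ?expR_ge0].
have -> : (2 * z1 * (1 + u)) ^+ j * (expR C1 * expR (- (c * u))) * (2 * (1 + u)) ^+ 2 =
  4 * expR C1 * 2 ^+ j * ((1 + u) ^+ (j + 2) * expR (- (c * u))) * z1 ^+ j.
  by rewrite !exprMn exprD; ring.
rewrite ler_wpM2r ?exprn_ge0 ?(ltW z10)// ler_wpM2l ?mulr_ge0 ?exprn_ge0 ?expR_ge0//.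
by apply: le_trans (pow_expR_le (j + 2) c0 u0) _; rewrite lerDr.
Qed.

End laplace.

Section hubbard_stratonovich.
Variable n : nat.

Local Notation N := (n.+1%:R : R).
Local Notation Pn := (pair_law n).
Local Notation S := (@spin_total n).

Definition cw_exp (M : R) (s : R) : R := expR ((2 * M)^-1 * s ^+ 2).

Let N0 : 0 < N. Proof. by rewrite ltr0n. Qed.
Let r : R := (Num.sqrt N)^-1.
Let r0 : 0 < r. Proof. by rewrite invr_gt0 sqrtr_gt0. Qed.
Let r2 : N * r ^+ 2 = 1.
Proof. by rewrite /r exprVn sqr_sqrtr ?(ltW N0)// divff// gt_eqF. Qed.

Let r2i : r ^+ 2 = N^-1. Proof. by rewrite /r exprVn sqr_sqrtr ?(ltW N0). Qed.

Let bS : bmfun S := bmfun_spin_total n.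

Lemma bmfun_cw_exp : bmfun (fun u : T * n.-tuple T => cw_exp N (spin_total u)).
Proof. exact: (bmfun_continuous_comp (@continuous_sqr_expR R (2 * N)^-1) bS). Qed.

Let completed_square (s S0 : R) :
  - (N * s ^+ 2 / 2) + s * S0 = (2 * N)^-1 * S0 ^+ 2 - N * (s - S0 / N) ^+ 2 / 2.
Proof. by field; rewrite gt_eqF. Qed.

Let F (Phi : R -> R) (us : (T * n.-tuple T) * measurableTypeR R) : \bar R :=
  (Phi us.2 * expR (- (N * us.2 ^+ 2 / 2) + us.2 * S us.1))%:E.

Let mF (Phi : R -> R) : measurable_fun setT Phi -> measurable_fun setT (F Phi).
Proof.
move=> mPhi; apply/measurable_EFinP; apply: measurable_funM.
  exact: measurableT_comp.
have [mS _] := bS.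
apply: measurableT_comp => //; apply: measurable_funD.
  apply: measurableT_comp => //; apply: measurable_funM => //.
  by apply: measurable_funM => //; exact: measurable_funX.
by apply: measurable_funM => //; exact: measurableT_comp mS _.
Qed.

Let F_ge0 (Phi : R -> R) : (forall s, 0 <= Phi s) -> forall us, (0 <= F Phi us)%E.
Proof. by move=> Phi0 us; rewrite lee_fin mulr_ge0 ?expR_ge0. Qed.

Let tonelli (Phi : R -> R) : measurable_fun setT Phi -> (forall s, 0 <= Phi s) ->
  (\int[Pn]_u \int[leb]_s F Phi (u, s) =
   \int[leb]_s (Phi s * expR (- (N * h s)))%:E)%E.
Proof.
move=> mPhi Phi0.
pose Q : probability (T * n.-tuple T)%type R := Pn.
have FT := @fubini_tonelli _ _ _ _ R Q leb (F Phi) (mF mPhi) (F_ge0 Phi0).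
transitivity (\int[leb]_s \int[Pn]_u F Phi (u, s))%E; first exact: FT.
apply: eq_integral => s _; rewrite /F/=.
have bE : bmfun (fun u => expR (s * S u)).
  exact: (bmfun_continuous_comp (@continuous_scaled_expR R s) bS).
rewrite (expR_gap) -(mgf_total n s) mulrA -RintZl// EFin_Rint; last first.
  by apply: bmfunM => //; exact: bmfun_cst.
by apply: eq_integral => u _; rewrite expRD mulrA.
Qed.

(** Hubbard--Stratonovich: [expR (N * m ^+ 2 / 2)] is a Gaussian average of
[expR (N * s * m)], whose expectation is a power of the moment generating
function, so an expectation over [N] spins becomes a one-dimensional integral.
For the inequality it suffices to keep the [s] within [1 / sqrt N] of [m] on the
side away from 0, where [Phi s >= Phi m]. *)
Lemma gauss_upper (Phi : R -> R) : measurable_fun setT Phi -> (forall s, 0 <= Phi s) ->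
  (forall x y, `|x| <= `|y| -> Phi x <= Phi y) ->
  (\int[Pn]_u (Phi (S u / N) * cw_exp N (S u))%:E <=
   (expR 2^-1 * Num.sqrt N)%:E * \int[leb]_s (Phi s * expR (- (N * h s)))%:E)%E.
Proof.
move=> mPhi Phi0 Phi_mono; have [mS _] := bS.
rewrite -tonelli// -ge0_integralZl//; first last.
- by move=> u _; apply: integral_ge0 => s _; exact: F_ge0.
- exact: (measurable_fun_fubini_tonelli_F (F Phi) (mF mPhi) (F_ge0 Phi0)).
apply: ge0_le_integral => //.
- by move=> u _; rewrite lee_fin mulr_ge0 ?expR_ge0.
- apply/measurable_EFinP; apply: measurable_funM.
    by apply: measurableT_comp mPhi _; exact: measurable_funM.
  by case: (bmfun_continuous_comp (@continuous_sqr_expR R (2 * N)^-1) bS).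
- apply: emeasurable_funM; first exact: measurable_cst.
  exact: (measurable_fun_fubini_tonelli_F (F Phi) (mF mPhi) (F_ge0 Phi0)).
move=> u _; set m := S u / N; set c := Phi m * cw_exp N (S u) * expR (- 2^-1).
have c0 : 0 <= c by rewrite !mulr_ge0 ?expR_ge0.
(* the half-neighbourhood of [m] pointing away from 0 *)
pose D : set R := if 0 <= m then `[m, m + r] else `[m - r, m].
have mD : measurable D by rewrite /D; case: ifP.
have lebD : leb D = r%:E.
  rewrite /D; case: ifP => _; rewrite lebesgue_measure_itv/= lte_fin.
    by rewrite ltrDl r0 -EFinB addrAC subrr add0r.
  by rewrite gtrBl r0 -EFinB opprB addrC subrK.
have Ds s : D s -> `|m| <= `|s| /\ N * (s - m) ^+ 2 <= 1.
  have aux v : `|v| <= r -> N * v ^+ 2 <= 1.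
    by move=> vr; rewrite -[leRHS]r2 ler_wpM2l ?(ltW N0)//; exact: sqr_norm_le.
  rewrite /D; case: ifPn => [m0|]; rewrite /= in_itv/=.
    move=> /andP[ms smr]; rewrite !ger0_norm ?(le_trans m0)//; split => //.
    by apply: aux; rewrite ger0_norm ?subr_ge0// lerBlDl.
  rewrite -ltNge => m0 /andP[ms sm]; rewrite !ler0_norm ?(le_trans sm)// ?(ltW m0)//.
  split; first by rewrite lerN2.
  by apply: aux; rewrite ler0_norm ?subr_le0// opprB lerBlDl -lerBlDr.
have low : ((c * r)%:E <= \int[leb]_s F Phi (u, s))%E.
  apply: (@le_trans _ _ (\int[leb]_(s in D) F Phi (u, s))%E); last first.
    apply: ge0_subset_integral => //.
      by apply: measurableT_comp; [exact: mF|exact: pair1_measurable].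
    by move=> s _; exact: F_ge0.
  rewrite EFinM -lebD -integral_cst//; apply: ge0_le_integral => //.
    apply: measurable_funTS.
    by apply: measurableT_comp; [exact: mF|exact: pair1_measurable].
  move=> s /Ds[ms Nsm]; rewrite lee_fin completed_square expRD -/m /c -mulrA.
  apply: ler_pM; rewrite ?mulr_ge0 ?expR_ge0 ?Phi_mono//.
  by rewrite ler_wpM2l ?expR_ge0// ler_expR lerN2 -[leRHS]mul1r ler_wpM2r ?invr_ge0.
apply: le_trans (lee_wpmul2l _ low); last by rewrite lee_fin mulr_ge0 ?expR_ge0.
rewrite -EFinM lee_fin /c /r le_eqVlt; apply/orP; left; apply/eqP.
have sN : Num.sqrt N != 0 by rewrite gt_eqF// sqrtr_gt0.
transitivity (Phi m * cw_exp N (S u) * (expR 2^-1 * expR (- 2^-1)) *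
  (Num.sqrt N * (Num.sqrt N)^-1)); last by ring.
by rewrite expRxMexpNx_1 divff// !mulr1.
Qed.

(** With [Phi = 1] the Gaussian integral is exact. *)
Lemma gauss_lower :
  (\int[leb]_s (expR (- (N * h s)))%:E <=
   (Num.sqrt (2 * pi) / Num.sqrt N * \int[Pn]_u cw_exp N (S u))%:E)%E.
Proof.
have m1 : measurable_fun setT ((fun=> 1) : R -> R) by exact: measurable_cst.
have bW := bmfun_cw_exp.
have -> : (\int[leb]_s (expR (- (N * h s)))%:E =
    \int[leb]_s (1 * expR (- (N * h s)))%:E)%E.
  by apply: eq_integral => s _; rewrite mul1r.
rewrite -tonelli// -RintZl// EFin_Rint; last first.
  by apply: bmfunM => //; exact: bmfun_cst.
rewrite le_eqVlt; apply/orP; left; apply/eqP; apply: eq_integral => u _.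
have rne : r != 0 by rewrite gt_eqF.
have pk := normal_peak_gt0 rne.
have := @integral_normal_pdf R (S u / N) r.
have -> : (\int[leb]_x (normal_pdf (S u / N) r x)%:E =
   (normal_peak r / cw_exp N (S u))%:E * \int[leb]_s F (fun=> 1%R) (u, s))%E.
  rewrite -ge0_integralZl//; first last.
  - by rewrite lee_fin divr_ge0 ?expR_ge0// ltW.
  - by move=> s _; exact: F_ge0.
  - by apply: measurableT_comp; [exact: mF|exact: pair1_measurable].
  apply: eq_integral => s _; rewrite normal_pdfE// /F/= mul1r completed_square -EFinM.
  congr EFin; rewrite -[RHS]mulrA; congr (_ * _).
  have cw0 : cw_exp N (S u) != 0 by rewrite gt_eqF ?expR_gt0.
  apply: (mulfI cw0); rewrite mulrA divff// mul1r -expRD; congr expR.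
  rewrite r2i.
  by field; rewrite gt_eqF.
move=> I1; have E0 : 0 < cw_exp N (S u) by exact: expR_gt0.
have -> : Num.sqrt (2 * pi) / Num.sqrt N * cw_exp N (S u) = cw_exp N (S u) / normal_peak r.
  rewrite mulrC /normal_peak invrK; congr (_ * _).
  have -> : r ^+ 2 * pi *+ 2 = (2 * pi) * r ^+ 2 by rewrite -mulr_natl; ring.
  by rewrite [RHS]sqrtrM ?mulr_ge0 ?pi_ge0// sqrtr_sqr gtr0_norm.
transitivity ((cw_exp N (S u) / normal_peak r)%:E * 1)%E; last by rewrite mule1.
rewrite -I1 muleA -EFinM.
have -> : cw_exp N (S u) / normal_peak r * (normal_peak r / cw_exp N (S u)) = 1.
  by field; rewrite !gt_eqF.
by rewrite mul1e.
Qed.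

End hubbard_stratonovich.

Section cw_moments.

(** On [0, 1 / b] the exponent [N * h] is bounded. *)
Lemma cw_partition_lower : exists2 c, 0 < c & forall n (b : R), 1 <= b ->
  b ^+ (2 * k) = n.+1%:R ->
  c * (Num.sqrt n.+1%:R / b) <=
    \int[pair_law n]_u cw_exp n.+1%:R (spin_total u).
Proof.
have [C C0 HC] := gap_taylor 1.
have p0 : 0 < Num.sqrt (2 * pi) :> R by rewrite sqrtr_gt0 mulr_gt0 ?pi_gt0.
exists (expR (- (a + C)) / Num.sqrt (2 * pi)); first by rewrite divr_gt0 ?expR_gt0.
move=> n b b1 bn; have b0 : 0 < b by rewrite (lt_le_trans ltr01).
have N0 : 0 < n.+1%:R :> R by rewrite ltr0n.
have sN : 0 < Num.sqrt n.+1%:R :> R by rewrite sqrtr_gt0.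
have mh : measurable_fun setT (fun s => expR (- (n.+1%:R * h s))).
  apply: measurableT_comp => //; apply: measurableT_comp => //.
  apply: measurable_funM => //; apply: continuous_measurable_fun.
  by apply: is_derive_continuous => s; exact: (is_derive_cumulant_gap P (bmfun_spin)).
have h1 : ((expR (- (a + C)) * b^-1)%:E <= \int[leb]_s (expR (- (n.+1%:R * h s)))%:E)%E.
  set c := b^-1; have bi : 0 < c by rewrite invr_gt0.
  apply: (@le_trans _ _ (\int[leb]_(s in `[0%R, c]) (expR (- (n.+1%:R * h s)))%:E)%E); last first.
    by apply: ge0_subset_integral => //; apply/measurable_EFinP.
  have lebc : c%:E = leb `[0%R, c].
    by rewrite lebesgue_measure_itv/= lte_fin bi oppr0 adde0.
  rewrite EFinM lebc -integral_cst//; apply: ge0_le_integral => //.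
    by move=> s _; rewrite lee_fin expR_ge0.
    by apply/measurable_EFinP; exact: measurable_funTS.
  move=> s; rewrite /= in_itv/= => /andP[s0 sb]; rewrite lee_fin ler_expR lerN2.
  have s1 : s <= 1 by rewrite (le_trans sb)// /c invf_le1.
  have := HC s; rewrite ger0_norm// => /(_ s1); rewrite ler_norml => /andP[_ hup].
  have p2 : s ^+ (2 * k + 2) <= s ^+ (2 * k) by rewrite ler_wiXn2l// leq_addr.
  have hs : h s <= (a + C) * s ^+ (2 * k).
    have : C * s ^+ (2 * k + 2) <= C * s ^+ (2 * k) by rewrite ler_wpM2l.
    by rewrite mulrDl; move: hup; lra.
  apply: (le_trans (ler_wpM2l (ltW N0) hs)); rewrite mulrCA -[leRHS]mulr1.
  rewrite ler_wpM2l ?addr_ge0 ?(ltW a_gt0)// -bn -exprMn exprn_ile1 ?mulr_ge0 ?(ltW b0)//.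
  by rewrite mulrC -ler_pdivlMr// div1r.
have := le_trans h1 (gauss_lower n); rewrite lee_fin => h2.
have : expR (- (a + C)) / b * Num.sqrt n.+1%:R <= Num.sqrt (2 * pi) *
    \int[pair_law n]_u cw_exp n.+1%:R (spin_total u).
  by rewrite -ler_pdivlMr// mulrAC.
rewrite mulrC -ler_pdivrMl// => /(le_trans _); apply.
by apply: ler_eq; ring.
Qed.

(** The normalisation [cw_partition_lower] has the same factor [sqrt N / b] as the
upper bound. One power of [1 + z] is lost to the width of the majorant. *)
Lemma cw_moment j (K : R) : 1 <= K -> exists2 C, 0 < C & forall n (b z : R),
  1 <= b -> b ^+ (2 * k) = n.+1%:R ->
  (1 + Num.max z 0) ^+ (2 * k + 2) <= K * b ^+ 2 ->
  \int[pair_law n]_u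
    ((1 + `|b * (spin_total u / n.+1%:R)|) ^+ j *
     trunc_exp a k z (b * (spin_total u / n.+1%:R)) *
     cw_exp n.+1%:R (spin_total u)) <=
  C * (1 + Num.max z 0) ^+ j.+1 *
    \int[pair_law n]_u cw_exp n.+1%:R (spin_total u).
Proof.
move=> K1.
have [C C0 HC] := gap_integrand_le j K1.
have [c c0 Hc] := cw_partition_lower.
exists (expR 2^-1 * (2 * C) / c); first by rewrite !mulr_gt0 ?expR_gt0 ?invr_gt0.
move=> n b z b1 bn zK; have b0 : 0 < b by rewrite (lt_le_trans ltr01).
have N0 : 0 < n.+1%:R :> R by rewrite ltr0n.
have sN : 0 < Num.sqrt n.+1%:R :> R by rewrite sqrtr_gt0.
set z1 := 1 + Num.max z 0 in zK *.
have z10 : 0 < z1 by rewrite ltr_wpDr// le_max lexx orbT.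
pose Phi (s : R) := (1 + `|b * s|) ^+ j * trunc_exp a k z (b * s).
have cPhi : continuous Phi.
  have cb : continuous (fun s : R => b * s).
    exact: (continuousMr (@continuous_cstr R b) (@continuous_idr R)).
  have c1 := continuous_compr cb (@continuous_norm1_pow R j).
  exact: (continuousMr c1 (continuous_compr cb (@continuous_trunc_exp _ a k z))).
have mPhi : measurable_fun setT Phi by exact: continuous_measurable_fun.
have Phi0 s : 0 <= Phi s by rewrite mulr_ge0 ?expR_ge0// exprn_ge0// addr_ge0.
have Phi_mono x y : `|x| <= `|y| -> Phi x <= Phi y.
  move=> xy; have bxy : `|b * x| <= `|b * y| by rewrite !normrM ler_wpM2l.
  apply: ler_pM; rewrite ?exprn_ge0 ?addr_ge0 ?expR_ge0//.
    by rewrite lerXn2r ?nnegrE ?addr_ge0// lerD2l.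
  have [zp0 minle] : 0 <= Num.max z 0 /\ forall zp, Num.min `|b * x| zp <= Num.min `|b * y| zp.
    split; first by rewrite le_max lexx orbT.
    by move=> zp; rewrite le_min !ge_min bxy lexx !orbT.
  rewrite ler_expR ler_wpM2l ?(ltW a_gt0)//.
  move: (Num.max z 0) zp0 (minle (Num.max z 0)) => zp zp0 mle.
  by rewrite lerXn2r ?nnegrE// le_min normr_ge0.
have bS := bmfun_spin_total n.
have bSn : bmfun (fun u : T * n.-tuple T => spin_total u / n.+1%:R).
  by apply: bmfunM => //; exact: bmfun_cst.
have bE := bmfun_cw_exp n.
have bI : bmfun (fun u : T * n.-tuple T => Phi (spin_total u / n.+1%:R) * cw_exp n.+1%:R (spin_total u)).
  by apply: bmfunM bE; exact: bmfun_continuous_comp cPhi bSn.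
rewrite -lee_fin (EFin_Rint _ bI).
have gu := gauss_upper n mPhi Phi0 Phi_mono.
apply: (le_trans gu).
have mD : measurable_fun setT (fun s : R => (((1 + b / z1 * `|s|) ^+ 2)^-1)%:E).
  apply/measurable_EFinP; apply: continuous_measurable_fun.
  by apply: continuous_inv_sqr; rewrite divr_ge0// ltW.
have Dint : (\int[leb]_s (Phi s * expR (- (n.+1%:R * h s)))%:E <=
    (C * z1 ^+ j * (2 / (b / z1)))%:E)%E.
  rewrite EFinM -integral_inv_sqr ?divr_gt0// -ge0_integralZl//; first last.
  - by rewrite lee_fin mulr_ge0 ?exprn_ge0// ltW.
  - by move=> s _; rewrite lee_fin invr_ge0 exprn_ge0// addr_ge0// mulr_ge0// divr_ge0// ltW.
  have mh : measurable_fun setT (fun s => expR (- (n.+1%:R * h s))).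
    apply: measurableT_comp => //; apply: measurableT_comp => //.
    apply: measurable_funM => //; apply: continuous_measurable_fun.
    by apply: is_derive_continuous => s; exact: (is_derive_cumulant_gap P (bmfun_spin)).
  apply: ge0_le_integral => //.
  - by move=> s _; rewrite lee_fin mulr_ge0 ?expR_ge0.
  - by apply/measurable_EFinP; exact: measurable_funM.
  - by apply: emeasurable_funM; [exact: measurable_cst|exact: mD].
  - by move=> s _; rewrite -EFinM lee_fin; exact: HC.
apply: le_trans (lee_wpmul2l _ Dint) _.
  by rewrite lee_fin mulr_ge0 ?expR_ge0// ltW.
rewrite -EFinM lee_fin.
apply: (@le_trans _ _ (expR 2^-1 * (2 * C) / c * z1 ^+ j.+1 * (c * (Num.sqrt n.+1%:R / b)))); last first.
  rewrite ler_wpM2l ?Hc// !mulr_ge0 ?expR_ge0 ?invr_ge0 ?exprn_ge0 ?ltW//.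
rewrite exprSr le_eqVlt; apply/orP; left; apply/eqP; field.
by rewrite !gt_eqF.
Qed.

End cw_moments.

(** * Conditional mean and variance of a spin *)

Section spin_coefficients.


(** Since [h' s = s - spin_mean 0 s], the deviation of [s] from the conditional mean
is [h' s] up to [O(s / n)]; rescaled by [n / b] it becomes the drift of the limit
law at [b * s]. The conditional variance is [1 + O(s ^+ 2 + 1 / n)]. *)
Lemma spin_coeff_bounds : exists2 C, 0 < C & forall n (b s : R),
  1 <= b -> b ^+ (2 * k) = n.+1%:R -> `|s| <= L ->
  let r := (n.+1%:R * s - n%:R * spin_mean n.+1%:R^-1 s) / b in
  let c := n%:R / n.+1%:R * spin_var n.+1%:R^-1 s in
  [/\ `|r - target_drift a k (b * s)| <= C * (b ^- 2 * (1 + `|b * s|) ^+ (2 * k + 1)),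
      `|r| <= C * (1 + `|b * s|) ^+ m,
      `|1 - c| <= C * (b ^- 2 * (1 + `|b * s|) ^+ 2) & `|c| <= C].
Proof.
have ek : (2 * k + 1 = m + 2)%N by lia.
have em : (m.+1 = 2 * k)%N by lia.
have k2 : (2 <= 2 * k)%N by lia.
have k1 : (1 <= 2 * k + 1)%N by lia.
have [C1 C10 H1] := spin_mean_bounds L0.
have [C2 C20 H2] := gap_derive1_taylor L.
have [C3 C30 H3] := spin_var_bound L0.
pose Cr := C2 + 2 * C1; pose Cv := 1 + C3 * (L ^+ 2 + 1).
have Cr0 : 0 <= Cr by rewrite addr_ge0// mulr_ge0.
have Cv0 : 0 <= Cv by rewrite addr_ge0// mulr_ge0// addr_ge0 ?sqr_ge0.
pose Cg := (2 * k)%:R * a + Cr * (1 + L) ^+ 2.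
have Cg0 : 0 <= Cg by apply: addr_ge0; apply: mulr_ge0; rewrite ?ler0n ?sqr_ge0 ?(ltW a_gt0).
exists (1 + (Cr + Cg + (C3 + Cv) + Cv)).
  by move: Cr0 Cg0 C30 Cv0; clear; generalize Cr Cg Cv; intros; lra.
move=> n b s b1 bn sL r c; have b0 : 0 < b by rewrite (lt_le_trans ltr01).
have N0 : 0 < n.+1%:R :> R by rewrite ltr0n.
set N : R := n.+1%:R in bn N0 r c *; set eps := N^-1 in r c *.
have nN : n%:R = N - 1 by rewrite /N -[n.+1]addn1 natrD addrK.
have e0 : 0 < eps by rewrite invr_gt0.
have bb0 : 0 < b ^+ 2 by rewrite exprn_gt0.
have eb : eps <= b ^- 2.
  by rewrite lef_pV2 ?posrE// -bn ler_weXn2l.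
have bV1 : b ^- 2 <= 1 by rewrite invf_le1// exprn_ege1.
have e01 : 0 <= eps <= 1 by rewrite (ltW e0) (le_trans eb).
have [m1 m2] := H1 _ _ e01 sL; have hd := H2 _ sL; have hv := H3 _ _ e01 sL.
have bm : b ^+ (2 * k) = b ^+ m * b by rewrite -exprSr em.
set V := b * s; have V0 : 0 <= `|V| by [].
have sV : s = V / b by rewrite /V mulrC mulKf// gt_eqF.
have nsV : `|s| = `|V| / b by rewrite sV normrM normfV (gtr0_norm b0).
have Vb : 1 + `|V| <= b * (1 + L).
  by rewrite mulrDr mulr1 lerD// /V normrM (gtr0_norm b0) ler_wpM2l// ltW.
have eVn0 j : 0 <= b ^- 2 * (1 + `|V|) ^+ j.
  by rewrite mulr_ge0 ?invr_ge0 ?exprn_ge0 ?addr_ge0 ?(ltW b0).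
have bnd : `|r - target_drift a k V| <= Cr * (b ^- 2 * (1 + `|V|) ^+ (2 * k + 1)).
  have -> : r - target_drift a k V =
      b ^+ m * (h^`()%classic s - (2 * k)%:R * a * s ^+ m) +
      (b ^+ m * (spin_mean 0 s - spin_mean eps s) + spin_mean eps s / b).
    rewrite (gap_derive1E) /r nN -bn bm /target_drift /V exprMn.
    by move: (h^`(2 * k)%classic 0 / (2 * k)`!%:R) => aa; field; rewrite gt_eqF.
  have t1 : `|b ^+ m * (h^`()%classic s - (2 * k)%:R * a * s ^+ m)| <=
      C2 * (b ^- 2 * (1 + `|V|) ^+ (2 * k + 1)).
    rewrite normrM (ger0_norm (exprn_ge0 _ (ltW b0))).
    apply: le_trans (ler_wpM2l (exprn_ge0 m (ltW b0)) hd) _.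
    have -> : b ^+ m * (C2 * `|s| ^+ (2 * k + 1)) = C2 * (b ^- 2 * `|V| ^+ (2 * k + 1)).
      rewrite nsV expr_div_n ek.
      by rewrite (exprD b); field; rewrite !gt_eqF// exprn_gt0.
    apply: ler_wpM2l => //; apply: ler_wpM2l; first by rewrite invr_ge0 ltW.
    by rewrite lerXn2r ?nnegrE ?addr_ge0// lerDr.
  have V1 : `|V| <= (1 + `|V|) ^+ (2 * k + 1).
    apply: (@le_trans _ _ ((1 + `|V|) ^+ 1)); first by rewrite expr1 lerDr.
    exact: pow1_le.
  have bbV : b ^- 2 * `|V| <= b ^- 2 * (1 + `|V|) ^+ (2 * k + 1).
    by rewrite ler_wpM2l// invr_ge0 ltW.
  have sb : `|s| / b = b ^- 2 * `|V| by rewrite nsV; field; rewrite gt_eqF.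
  have t2 : `|b ^+ m * (spin_mean 0 s - spin_mean eps s)| <=
      C1 * (b ^- 2 * (1 + `|V|) ^+ (2 * k + 1)).
    rewrite normrM (ger0_norm (exprn_ge0 _ (ltW b0))) distrC.
    apply: le_trans (ler_wpM2l (exprn_ge0 m (ltW b0)) m2) _.
    have -> : b ^+ m * (C1 * (eps * `|s|)) = C1 * (b ^- 2 * `|V|).
      rewrite -sb /eps -bn bm; field.
      by rewrite !gt_eqF// exprn_gt0.
    by rewrite ler_wpM2l.
  have t3 : `|spin_mean eps s / b| <= C1 * (b ^- 2 * (1 + `|V|) ^+ (2 * k + 1)).
    rewrite normrM normfV (gtr0_norm b0) ler_pdivrMr//.
    apply: le_trans m1 _; rewrite -mulrA ler_wpM2l// -ler_pdivrMr//.
    by rewrite sb.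
  apply: le_trans (ler_normD _ _) _.
  apply: le_trans (lerD t1 (le_trans (ler_normD _ _) (lerD t2 t3))) _.
  by apply: ler_eq; rewrite /Cr; ring.
have rb : `|r| <= Cg * (1 + `|V|) ^+ m.
  have -> : r = target_drift a k V + (r - target_drift a k V) by ring.
  apply: le_trans (ler_normD _ _) _; rewrite mulrDl; apply: lerD.
    exact: target_drift_le.
  apply: (le_trans bnd); rewrite -mulrA ler_wpM2l//.
  rewrite mulrC ler_pdivrMr// ek.
  rewrite exprD [leLHS]mulrC [leRHS]mulrAC ler_wpM2r ?exprn_ge0 ?addr_ge0//.
  rewrite -exprMn lerXn2r ?nnegrE ?addr_ge0 ?mulr_ge0 ?addr_ge0 ?(ltW b0)//.
  by rewrite mulrC.
have s2 : s ^+ 2 = b ^- 2 * `|V| ^+ 2.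
  by rewrite -(real_normK (num_real s)) nsV; field; rewrite gt_eqF.
have vb : `|spin_var eps s| <= Cv.
  have -> : spin_var eps s = 1 + (spin_var eps s - 1) by ring.
  rewrite (le_trans (ler_normD _ _))// normr1 lerD2l (le_trans hv)// ler_wpM2l//.
  by case/andP: e01 => _ e1; apply: lerD e1; exact: sqr_norm_le.
have cE : c = spin_var eps s - eps * spin_var eps s.
  by rewrite /c nN /eps; field; rewrite gt_eqF.
have bnV : b ^- 2 <= b ^- 2 * (1 + `|V|) ^+ 2.
  by rewrite ler_peMr ?invr_ge0 ?(ltW bb0)// exprn_ege1// lerDl.
have b1c : `|1 - c| <= (C3 + Cv) * (b ^- 2 * (1 + `|V|) ^+ 2).
  have -> : 1 - c = eps * spin_var eps s - (spin_var eps s - 1) by rewrite cE; ring.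
  rewrite (le_trans (ler_normB _ _))// addrC [leRHS]mulrDl; apply: lerD.
    apply: le_trans hv _; rewrite ler_wpM2l// s2.
    apply: (@le_trans _ _ (b ^- 2 * (1 + `|V| ^+ 2))).
      by rewrite mulrDr mulr1 addrC lerD2r.
    rewrite ler_wpM2l ?invr_ge0 ?(ltW bb0)// sqrrD expr1n mul1r.
    by move: V0; generalize `|V|; intros y y0; rewrite mulr2n; lra.
  rewrite normrM (gtr0_norm e0) mulrC; apply: ler_pM => //; first exact: ltW.
  exact: le_trans eb bnV.
have bc : `|c| <= Cv.
  have -> : c = (1 - eps) * spin_var eps s by rewrite cE; ring.
  case/andP: e01 => _ e1.
  rewrite normrM ger0_norm ?subr_ge0// -[leRHS]mul1r ler_pM ?subr_ge0//.
  by rewrite lerBlDr lerDl ltW.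
have up (x y z : R) : 0 <= z -> x <= y -> x * z <= y * z by move=> *; exact: ler_wpM2r.
have C30' : 0 <= C3 + Cv by exact: addr_ge0.
have [w1 w2 w3 w4] : [/\ Cr <= 1 + (Cr + Cg + (C3 + Cv) + Cv),
   Cg <= 1 + (Cr + Cg + (C3 + Cv) + Cv), C3 + Cv <= 1 + (Cr + Cg + (C3 + Cv) + Cv)
   & Cv <= 1 + (Cr + Cg + (C3 + Cv) + Cv)].
  by move: Cr0 Cg0 C30 Cv0; clear; generalize Cr Cg Cv; intros; split; lra.
split.
- by apply: le_trans bnd _; exact: up.
- by apply: le_trans rb _; apply: up => //; rewrite exprn_ge0// addr_ge0.
- by apply: le_trans b1c _; exact: up.
- exact: le_trans bc _.
Qed.

End spin_coefficients.

(** * The leave-one-out identity *)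

Section exchange.


(** By exchangeability every spin of the sum contributes what the first one does.
Induction on [n] needs only the swap of two independent spins: the first of the
others is exchanged by Fubini, the rest by the induction hypothesis. *)
Lemma spin_exchange n (F : R -> R) : continuous F ->
  \int[pair_law n]_u (spin_sum u.2 * F (spin_total u)) =
  n%:R * \int[pair_law n]_u (X u.1 * F (spin_total u)).
Proof.
elim: n F => [|n IH] F cF.
  rewrite mul0r -[RHS](@Rint_cst _ _ _ (pair_law 0) 0).
  by apply: eq_Rintegral => u _; rewrite /spin_sum big_ord0 mul0r.
have bT := bmfun_spin_total.
have bF m : bmfun (fun u : T * m.-tuple T => F (spin_total u)).
  exact: bmfun_continuous_comp cF (bT m).
have cFx x : continuous (fun s => F (X x + s)).
  exact: (continuous_compr (continuousDr (@continuous_cstr R _) (@continuous_idr R)) cF).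
have bFx x : bmfun (fun v : T * n.-tuple T => F (X x + spin_total v)).
  exact: bmfun_continuous_comp (cFx x) (bT n).
pose Q (p : T * T) := \int[power_prob P n]_t F (X p.1 + (X p.2 + spin_sum t)).
have bQ3 : bmfun (fun z : (T * T) * n.-tuple T =>
    F (X z.1.1 + (X z.1.2 + spin_sum z.2))).
  apply: (bmfun_continuous_comp cF); apply: bmfunD.
    by apply: (bmfun_comp bX); apply: measurableT_comp => //; exact: measurable_fst.
  apply: bmfunD.
    by apply: (bmfun_comp bX); apply: measurableT_comp => //; exact: measurable_snd.
  split; first by apply: measurableT_comp => //; case: (bmfun_spin_sum n).
  by exists (n%:R * L) => z; exact: spin_sum_le.
have bQ : bmfun Q := bmfun_Rint1 (P \x P)%E (power_prob P n) bQ3.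
have bXQ1 : bmfun (fun p : T * T => X p.1 * Q p).
  by apply: bmfunM bQ; apply: (bmfun_comp bX); exact: measurable_fst.
have bXQ2 : bmfun (fun p : T * T => X p.2 * Q p).
  by apply: bmfunM bQ; apply: (bmfun_comp bX); exact: measurable_snd.
have Qsym p : Q (p.2, p.1) = Q p.
  by apply: eq_Rintegral => t _ /=; congr F; ring.
have inner x (c : T -> R) : bmfun c ->
    \int[pair_law n]_v (c v.1 * F (X x + spin_total v)) =
    \int[P]_y (c y * Q (x, y)).
  move=> bc; rewrite Rint_prod1; last first.
    by apply: bmfunM (bFx x); apply: (bmfun_comp bc); exact: measurable_fst.
  apply: eq_Rintegral => y _; rewrite -RintZl//.
  exact: (@bmfun_pair1 _ _ _ _ _ _ (bFx x) y).
have peel (G : T -> n.+1.-tuple T -> R) : bmfun (fun u : T * n.+1.-tuple T => G u.1 u.2) ->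
    \int[pair_law n.+1]_u G u.1 u.2 =
    \int[P]_x \int[pair_law n]_v G x (tuple_cons v).
  move=> bG; rewrite Rint_prod1//; apply: eq_Rintegral => x _.
  by rewrite Rint_power_cons//; exact: (@bmfun_pair1 _ _ _ _ _ _ bG x).
have bS := bmfun_snd (bmfun_spin_sum n.+1).
rewrite (peel (fun x t => spin_sum t * F (X x + spin_sum t))); last first.
  exact: bmfunM bS (bF n.+1).
rewrite (peel (fun x t => X x * F (X x + spin_sum t))); last first.
  exact: bmfunM (bmfun_fst n.+1) (bF n.+1).
have -> : \int[P]_x \int[pair_law n]_v
      (spin_sum (tuple_cons v) * F (X x + spin_sum (tuple_cons v))) =
    n.+1%:R * \int[P]_x \int[P]_y (X y * Q (x, y)).
  rewrite -RintZl; last exact: (bmfun_Rint1 P P bXQ2).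
  apply: eq_Rintegral => x _.
  rewrite (_ : \int[_]_v _ = \int[pair_law n]_v
    (X v.1 * F (X x + spin_total v) + spin_sum v.2 * F (X x + spin_total v))).
    rewrite RintD.
    - by rewrite (IH (fun s => F (X x + s)))// (inner x X)// -[n.+1]addn1 natrD; ring.
    - exact: bmfunM (bmfun_fst n) (bFx x).
    - exact: bmfunM (bmfun_snd (bmfun_spin_sum n)) (bFx x).
  by apply: eq_Rintegral => -[y t] _; rewrite spin_sum_cons /spin_total/=; ring.
have -> : \int[P]_x \int[pair_law n]_v
      (X x * F (X x + spin_sum (tuple_cons v))) =
    \int[P]_x \int[P]_y (X x * Q (x, y)).
  apply: eq_Rintegral => x _; rewrite -(inner x (fun=> X x)); last exact: bmfun_cst.
  by apply: eq_Rintegral => -[y t] _; rewrite spin_sum_cons /spin_total.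
congr (_ * _); rewrite -[RHS](Rint_prod1 P P bXQ1) (Rint_prod2 P P bXQ1).
by apply: eq_Rintegral => x _; apply: eq_Rintegral => y _; rewrite -Qsym.
Qed.

End exchange.

Section stein_identity.
Lemma continuous_spin_mean eps : 0 <= eps -> continuous (spin_mean eps).
Proof.
move=> e0; have bw := bmfun_spin_weight eps.
apply: continuousMr; first exact: continuous_tilt_mom.
move=> s; apply: cvgV; first by rewrite gt_eqF// spin_mom0_gt0.
exact: continuous_tilt_mom.
Qed.

Lemma continuous_spin_var eps : 0 <= eps -> continuous (spin_var eps).
Proof.
move=> e0; have bw := bmfun_spin_weight eps.
apply: continuousBr.
  apply: continuousMr; first exact: continuous_tilt_mom.
  move=> s; apply: cvgV; first by rewrite gt_eqF// spin_mom0_gt0.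
  exact: continuous_tilt_mom.
exact: (continuous_compr (continuous_spin_mean e0) (@continuous_Xn R 2)).
Qed.

Variable n : nat.
Local Notation N := (n.+1%:R : R).
Local Notation Pn := (pair_law n).
Local Notation w u := (cw_exp N (spin_total u)).
Local Notation mu t := (spin_mean N^-1 (spin_sum t / N)).
Local Notation var t := (spin_var N^-1 (spin_sum t / N)).

Let N0 : 0 < N. Proof. by rewrite ltr0n. Qed.
Let Ni0 : 0 <= N^-1. Proof. by rewrite invr_ge0. Qed.

Lemma cw_exp_split x (t : n.-tuple T) : w (x, t) = cw_exp N (spin_sum t) *
  (expR (spin_sum t / N * X x) * spin_weight N^-1 x).
Proof.
rewrite /cw_exp /spin_weight -!expRD; congr expR.
by rewrite /spin_total/=; field; rewrite gt_eqF.
Qed.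

Lemma bmfun_spin_avg (g : R -> R) : continuous g ->
  bmfun (fun t : n.-tuple T => g (spin_sum t / N)).
Proof.
move=> cg; apply: (bmfun_continuous_comp cg).
by apply: bmfunM; [exact: bmfun_spin_sum|exact: bmfun_cst].
Qed.

Lemma bmfun_avg_mean : bmfun (fun t : n.-tuple T => mu t).
Proof. exact: bmfun_spin_avg (continuous_spin_mean Ni0). Qed.

Lemma bmfun_avg_var : bmfun (fun t : n.-tuple T => var t).
Proof. exact: bmfun_spin_avg (continuous_spin_var Ni0). Qed.

Let slice (t : n.-tuple T) j :
  \int[P]_x (X x ^+ j * w (x, t)) =
  cw_exp N (spin_sum t) * tilt_mom P X (spin_weight N^-1) j (spin_sum t / N).
Proof.
rewrite /tilt_mom -RintZl; last exact: (bmfun_tilt_mom bX (bmfun_spin_weight _)).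
by apply: eq_Rintegral => x _; rewrite cw_exp_split; ring.
Qed.

(** [mu] is the conditional mean of the first spin given the others. *)
Lemma Rint_spin_centred (G : n.-tuple T -> R) : bmfun G ->
  \int[Pn]_u ((X u.1 - mu u.2) * G u.2 * w u) = 0.
Proof.
move=> bG; have bG2 := bmfun_snd bG; have bmu2 := bmfun_snd bmfun_avg_mean.
have bX1 := bmfun_fst n.
rewrite Rint_prod2; last by apply: bmfunM (bmfun_cw_exp n); apply: bmfunM bG2; exact: bmfunB.
rewrite -[RHS](@Rint_cst _ _ _ (power_prob P n)); apply: eq_Rintegral => t _ /=.
have bwt j : bmfun (fun x => X x ^+ j * w (x, t)).
  by apply: bmfunM; [exact: bmfunX|exact: (@bmfun_pair2 _ _ _ _ _ _ (bmfun_cw_exp n) t)].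
rewrite (_ : \int[_]_x _ = \int[P]_x (G t * (X x ^+ 1 * w (x, t)) -
    G t * mu t * (X x ^+ 0 * w (x, t)))); last first.
  by apply: eq_Rintegral => x _; rewrite expr1 expr0; ring.
rewrite RintB; try by apply: bmfunM; [exact: bmfun_cst|exact: bwt].
rewrite (RintZl P _ (bwt 1%N)) (RintZl P _ (bwt 0%N)) !slice /spin_mean; field.
by rewrite gt_eqF// spin_mom0_gt0.
Qed.

Lemma Rint_spin_variance (G : n.-tuple T -> R) : bmfun G ->
  \int[Pn]_u ((X u.1 - mu u.2) ^+ 2 * G u.2 * w u) =
  \int[Pn]_u (var u.2 * G u.2 * w u).
Proof.
move=> bG; have bG2 := bmfun_snd bG; have bmu2 := bmfun_snd bmfun_avg_mean.
have bX1 := bmfun_fst n; have bvar2 := bmfun_snd bmfun_avg_var.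
rewrite Rint_prod2; last first.
  by apply: bmfunM (bmfun_cw_exp n); apply: bmfunM bG2; apply: bmfunX; exact: bmfunB.
rewrite Rint_prod2; last by apply: bmfunM (bmfun_cw_exp n); exact: bmfunM.
apply: eq_Rintegral => t _ /=.
have bwt j : bmfun (fun x => X x ^+ j * w (x, t)).
  by apply: bmfunM; [exact: bmfunX|exact: (@bmfun_pair2 _ _ _ _ _ _ (bmfun_cw_exp n) t)].
have bcwt c j : bmfun (fun x => c * (X x ^+ j * w (x, t))).
  by apply: bmfunM; [exact: bmfun_cst|exact: bwt].
rewrite (_ : \int[_]_x _ = \int[P]_x (G t * (X x ^+ 2 * w (x, t)) -
    G t * (2 * mu t) * (X x ^+ 1 * w (x, t)) +
    G t * mu t ^+ 2 * (X x ^+ 0 * w (x, t)))); last first.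
  by apply: eq_Rintegral => x _; rewrite expr1 expr0; ring.
rewrite (_ : \int[P]_x (var t * G t * w (x, t)) =
   \int[P]_x (var t * G t * (X x ^+ 0 * w (x, t)))); last first.
  by apply: eq_Rintegral => x _; rewrite expr0 mul1r.
rewrite RintD ?RintB//; last exact: bmfunB.
rewrite (RintZl P _ (bwt 2%N)) (RintZl P _ (bwt 1%N)) !(RintZl P _ (bwt 0%N))
  !slice /spin_var /spin_mean; field.
by rewrite gt_eqF// spin_mom0_gt0.
Qed.

(** Exchangeability turns the sum of the others into [n] copies of the first spin;
then the test function may be centred at a point that depends on the others
only, because [X - mu] has conditional mean 0. *)
Lemma stein_identity (f : R -> R) (b : R) : continuous f ->
  \int[Pn]_u ((spin_sum u.2 - n%:R * mu u.2) * f (b * (spin_total u / N)) * w u) =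
  n%:R * \int[Pn]_u ((X u.1 - mu u.2) *
    (f (b * (spin_total u / N)) - f (b * ((spin_sum u.2 + mu u.2) / N))) * w u).
Proof.
move=> cf; have cb : continuous (fun s : R => b * (s / N)).
  apply: (continuousMr (@continuous_cstr R b)).
  exact: (continuousMr (@continuous_idr R) (@continuous_cstr R N^-1)).
have cfb := continuous_compr cb cf.
have cF : continuous (fun s : R => f (b * (s / N)) * cw_exp N s).
  exact: (continuousMr cfb (@continuous_sqr_expR R (2 * N)^-1)).
have bS := bmfun_snd (bmfun_spin_sum n).
have bX1 := bmfun_fst n; have bmu2 := bmfun_snd bmfun_avg_mean.
have bF := bmfun_continuous_comp cF (bmfun_spin_total n).
have bG : bmfun (fun t : n.-tuple T => f (b * ((spin_sum t + mu t) / N))).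
  by apply: (bmfun_continuous_comp cfb); apply: bmfunD;
    [exact: bmfun_spin_sum|exact: bmfun_avg_mean].
have bG2 := bmfun_snd bG.
pose F (u : T * n.-tuple T) := f (b * (spin_total u / N)) * w u.
transitivity (n%:R * \int[Pn]_u (X u.1 * F u) - n%:R * \int[Pn]_u (mu u.2 * F u)).
  rewrite -(spin_exchange n cF) -RintZl; last exact: bmfunM.
  rewrite -RintB; last 2 first.
  - exact: bmfunM.
  - by apply: bmfunM; [exact: bmfun_cst|exact: bmfunM].
  by apply: eq_Rintegral => u _; rewrite /F; ring.
rewrite -mulrBr; congr (_ * _); rewrite -RintB; try exact: bmfunM.
rewrite -[LHS]subr0 -(Rint_spin_centred bG) -RintB; last 2 first.
- by apply: bmfunB; exact: bmfunM.
- by apply: bmfunM (bmfun_cw_exp n); apply: bmfunM bG2; exact: bmfunB.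
by apply: eq_Rintegral => u _; rewrite /F; ring.
Qed.

Variable b : R.
Hypothesis b0 : 0 < b.
Local Notation W u := (b * (spin_total u / N)).
Local Notation Vmu u := (b * ((spin_sum u.2 + mu u.2) / N)).

Lemma bmfun_W (g : R -> R) : continuous g -> bmfun (fun u : T * n.-tuple T => g (W u)).
Proof.
move=> cg; apply: (bmfun_continuous_comp cg); apply: bmfunM; first exact: bmfun_cst.
by apply: bmfunM; [exact: bmfun_spin_total|exact: bmfun_cst].
Qed.

Lemma bmfun_V (g : R -> R) : continuous g ->
  bmfun (fun t : n.-tuple T => g (b * (spin_sum t / N))).
Proof.
move=> cg; apply: (bmfun_continuous_comp cg); apply: bmfunM; first exact: bmfun_cst.
by apply: bmfunM; [exact: bmfun_spin_sum|exact: bmfun_cst].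
Qed.

Lemma bmfun_stein_left (f : R -> R) (G : n.-tuple T -> R) : continuous f -> bmfun G ->
  bmfun (fun u : T * n.-tuple T =>
    (spin_sum u.2 - n%:R * mu u.2) / b * f (W u) - n%:R / N * var u.2 * G u.2).
Proof.
move=> cf bG.
have bmu := bmfun_snd bmfun_avg_mean.
have bvar := bmfun_snd bmfun_avg_var.
have bS := bmfun_snd (bmfun_spin_sum n).
apply: bmfunB; apply: bmfunM.
- apply: bmfunM; last exact: bmfun_cst.
  by apply: bmfunB => //; apply: bmfunM => //; exact: bmfun_cst.
- exact: bmfun_W.
- by apply: bmfunM => //; exact: bmfun_cst.
- exact: bmfun_snd bG.
Qed.

(** Once the increment of [f] is bounded by [G] times the increment of its
argument, the first spin enters only through [(X - mu) ^+ 2], which is replaced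
by the conditional variance. *)
Lemma stein_average_le (f : R -> R) (G : n.-tuple T -> R) : continuous f -> bmfun G ->
  (forall u, (X u.1 - mu u.2) * (f (W u) - f (Vmu u)) <=
    (X u.1 - mu u.2) ^+ 2 * (b / N * G u.2)) ->
  \int[Pn]_u (((spin_sum u.2 - n%:R * mu u.2) / b * f (W u) -
    n%:R / N * var u.2 * G u.2) * w u) <= 0.
Proof.
move=> cf bG fG.
have bw := bmfun_cw_exp n; have bG2 := bmfun_snd bG.
have bmu := bmfun_snd bmfun_avg_mean; have bvar := bmfun_snd bmfun_avg_var.
have bS := bmfun_snd (bmfun_spin_sum n); have bX1 := bmfun_fst n.
have cb : continuous (fun s : R => f (b * (s / N))).
  apply: (continuous_compr _ cf).
  apply: (continuousMr (@continuous_cstr R b)).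
  exact: (continuousMr (@continuous_idr R) (@continuous_cstr R N^-1)).
have bVmu : bmfun (fun u : T * n.-tuple T => f (Vmu u)).
  by apply: (bmfun_continuous_comp cb); exact: bmfunD.
have bfW := bmfun_W cf.
have bGb : bmfun (fun t : n.-tuple T => b / N * G t) by apply: bmfunM => //; exact: bmfun_cst.
have bI1 : bmfun (fun u : T * n.-tuple T =>
    (spin_sum u.2 - n%:R * mu u.2) * f (W u) * w u).
  by do 2 apply: bmfunM => //; apply: bmfunB => //; apply: bmfunM => //; exact: bmfun_cst.
have bI2 : bmfun (fun u : T * n.-tuple T => var u.2 * (b / N * G u.2) * w u).
  apply: bmfunM => //; apply: bmfunM => //; exact: bmfun_snd bGb.
have id := stein_identity b cf.
have vid := Rint_spin_variance bGb.
have le1 : \int[Pn]_u ((X u.1 - mu u.2) * (f (W u) - f (Vmu u)) * w u) <=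
    \int[Pn]_u (var u.2 * (b / N * G u.2) * w u).
  rewrite -vid; apply: ler_Rint => [||u].
  - by do 2 apply: bmfunM => //; exact: bmfunB.
  - apply: bmfunM => //; apply: bmfunM; last exact: bmfun_snd bGb.
    by apply: bmfunX; exact: bmfunB.
  - by rewrite ler_wpM2r ?expR_ge0.
rewrite (_ : \int[_]_u _ = \int[Pn]_u
    (b^-1 * ((spin_sum u.2 - n%:R * mu u.2) * f (W u) * w u) -
     n%:R / b * (var u.2 * (b / N * G u.2) * w u))); last first.
  by apply: eq_Rintegral => u _; field; rewrite !gt_eqF.
rewrite RintB; try by apply: bmfunM => //; exact: bmfun_cst.
rewrite (RintZl _ _ bI1) (RintZl _ _ bI2) id subr_le0 mulrA (mulrC b^-1).
by apply: (ler_wpM2l _ le1); rewrite divr_ge0// ltW.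
Qed.

Lemma stein_average_ge (f : R -> R) (G : n.-tuple T -> R) : continuous f -> bmfun G ->
  (forall u, (X u.1 - mu u.2) ^+ 2 * (b / N * G u.2) <=
    (X u.1 - mu u.2) * (f (W u) - f (Vmu u))) ->
  0 <= \int[Pn]_u (((spin_sum u.2 - n%:R * mu u.2) / b * f (W u) -
    n%:R / N * var u.2 * G u.2) * w u).
Proof.
move=> cf bG fG.
have cNf : continuous (fun y => - f y) by move=> y; apply: continuousN; exact: cf.
have bNG := bmfunN bG.
rewrite -oppr_le0 -mulN1r -RintZl; last first.
  by apply: bmfunM (bmfun_cw_exp n); exact: bmfun_stein_left.
rewrite (_ : \int[_]_u _ = \int[Pn]_u
  (((spin_sum u.2 - n%:R * mu u.2) / b * - f (W u) -
    n%:R / N * var u.2 * - G u.2) * w u)); last first.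
  by apply: eq_Rintegral => u _; ring.
apply: (stein_average_le cNf bNG) => u.
have := fG u; rewrite -subr_ge0 -[in X in _ -> X]subr_ge0 => /le_trans; apply.
by apply: ler_eq; ring.
Qed.

End stein_identity.

(** * Tails of the magnetization *)

Section cw_tail.
Hypothesis k2 : (2 <= k)%N.
Local Notation q := (target_tail a k).
Local Notation f := (stein_sol a k).
Local Notation g := (target_drift a k).
Local Notation E := (trunc_exp a k).


(** Insert the Stein solution in the averaged identity. Pointwise, the integrand
is the indicator of the tail minus [target_tail z] up to [stein_remainder], whose
expectation is controlled by [cw_moment]. All errors carry the factor
[target_tail z], which is why the result is a relative error. Thresholds apply
to [V], the magnetization with one spin removed. *)
Lemma cw_tail_bounds (K : R) : 1 <= K -> exists2 C, 0 < C & forall n (b z : R),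
  1 <= b -> b ^+ (2 * k) = n.+1%:R ->
  (1 + Num.max z 0) ^+ (2 * k + 2) <= K * b ^+ 2 ->
  let V (u : T * n.-tuple T) := b * (spin_sum u.2 / n.+1%:R) in
  let delta := b * L / n.+1%:R in
  let Z := \int[pair_law n]_u cw_exp n.+1%:R (spin_total u) in
  let rem := C * (b ^- 2 * (1 + Num.max z 0) ^+ (2 * k + 2)) in
  \int[pair_law n]_u
    ((z + delta < V u)%R%:R * cw_exp n.+1%:R (spin_total u)) <= q z * (1 + rem) * Z /\
  q z * (1 - rem) * Z <= \int[pair_law n]_u
    ((z - delta <= V u)%R%:R * cw_exp n.+1%:R (spin_total u)).
Proof.
move=> K1.
have K0 : 0 < K by exact: lt_le_trans K1.
have em2 : ((2 * m).+1 = m + 2 * k)%N by lia.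
have e2k : ((2 * k + 1).+1 = 2 * k + 2)%N by lia.
have e22 : (2 * k + 2 = 2 + 2 * k)%N by lia.
have [C0 C00 H0] := spin_coeff_bounds.
pose Kd := L * K ^+ m; have Kd0 : 0 <= Kd by rewrite mulr_ge0// exprn_ge0// ltW.
have [C1 C10 H1] := stein_increment a_gt0 k0 Kd0.
have [C2 C20 H2] := stein_remainder a_gt0 k0 Kd0 C00 (ltW C10).
have [C3 C30 H3] := cw_moment (2 * k + 1) K1.
have [C4 C40 H4] := cw_moment (2 * m) K1.
pose C5 := C4 * (L * K ^+ (2 * k - 3)).
have C50 : 0 <= C5 by rewrite !mulr_ge0 ?exprn_ge0 ?(ltW C40) ?(ltW K0).
exists (C2 * (C3 + C5)) => [|n b z b1 bn zK V delta Z rem].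
  by apply: mulr_gt0 => //; exact: ltr_wpDr.
have b0 : 0 < b by rewrite (lt_le_trans ltr01).
have N0 : 0 < n.+1%:R :> R by rewrite ltr0n.
set N : R := n.+1%:R in bn N0 V delta Z *.
set Pn := (pair_law n) in Z *.
pose w (u : T * n.-tuple T) := cw_exp N (spin_total u).
pose W (u : T * n.-tuple T) := b * (spin_total u / N).
pose mu (t : n.-tuple T) := spin_mean N^-1 (spin_sum t / N).
have w0 u : 0 <= w u by exact: expR_ge0.
set z1 := 1 + Num.max z 0 in zK rem *.
have z11 : 1 <= z1 by rewrite lerDl le_max lexx orbT.
have z10 : 0 < z1 by exact: lt_le_trans z11.
have z1K : z1 <= K * b := range_le K1 b1 z11 zK.
have [dE dK d2'] := shift_size_bounds k2 L0 K0 b0 z10 z1K.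
rewrite bn -/delta in dE dK d2'.
have d0 : 0 <= delta by rewrite dE divr_ge0// exprn_ge0// ltW.
have d2 : delta * z1 ^+ (2 * m).+1 <= L * K ^+ (2 * k - 3) * (b ^- 2 * z1 ^+ (2 * k + 2)).
  rewrite em2 e22 2!(exprD z1) mulrA (mulrA (b ^- 2)) [leRHS]mulrA.
  by apply: ler_wpM2r d2'; rewrite exprn_ge0// ltW.
have q0 : 0 <= q z by exact: target_tail_ge0.
have VX u : W u = V u + b * X u.1 / N by rewrite /W /V /spin_total; ring.
have dX y : `|y| <= L -> `|b * y / N| <= delta.
  by move=> yL; rewrite !normrM normfV (gtr0_norm b0) (gtr0_norm N0) ler_wpM2r ?ler_wpM2l ?invr_ge0// ltW.
have WV u : `|W u - V u| <= delta by rewrite VX addrAC subrr add0r dX.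
have muL t : `|mu t| <= L by rewrite spin_mean_le// invr_ge0 ltW.
pose Vmu (u : T * n.-tuple T) := b * ((spin_sum u.2 + mu u.2) / N).
have VmuE u : Vmu u = V u + b * mu u.2 / N by rewrite /Vmu /V; ring.
have VmuV u : `|Vmu u - V u| <= delta by rewrite VmuE addrAC subrr add0r dX.
have WVmu u : W u - Vmu u = b / N * (X u.1 - mu u.2) by rewrite VX VmuE; ring.
pose v (t : n.-tuple T) := b * (spin_sum t / N).
pose err t := C1 * (delta * (q z * (1 + `|v t|) ^+ (2 * m) * E z (v t))).
have err0 t : 0 <= err t.
  by apply: mulr_ge0; [exact: ltW|apply: mulr_ge0 => //; exact: stein_weight_ge0].
pose Gup t := g (v t) * f z (v t) + q z - (z + delta < v t)%R%:R + err t.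
pose Glo t := g (v t) * f z (v t) + q z - (z - delta <= v t)%R%:R - err t.
have cgf : continuous (fun y => g y * f z y + q z).
  have cst := @continuous_cstr R (- q z).
  have cgf0 := continuousMr (@continuous_target_drift _ a k) (@continuous_stein_sol _ a k a_gt0 k0 z).
  by move=> y; have := continuousBr cgf0 cst (x := y); under eq_fun do rewrite opprK.
have cE : continuous (E z) by exact: continuous_trunc_exp.
have cerr : continuous (fun y => C1 * (delta * (q z * (1 + `|y|) ^+ (2 * m) * E z y))).
  apply: (continuousMr (@continuous_cstr R C1)); apply: (continuousMr (@continuous_cstr R delta)).
  apply: continuousMr cE; apply: (continuousMr (@continuous_cstr R (q z))).
  exact: continuous_norm1_pow.
have bv : bmfun v by exact: (bmfun_V n b (@continuous_idr R)).
have bgf := bmfun_V n b cgf.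
have berr := bmfun_V n b cerr.
have bGup : bmfun Gup by apply: bmfunD => //; apply: bmfunB => //; exact: bmfun_lt.
have bGlo : bmfun Glo by apply: bmfunB => //; apply: bmfunB => //; exact: bmfun_le.
have incr u : (X u.1 - mu u.2) * (f z (W u) - f z (Vmu u)) <=
      (X u.1 - mu u.2) ^+ 2 * (b / N * Gup u.2) /\
    (X u.1 - mu u.2) ^+ 2 * (b / N * Glo u.2) <=
      (X u.1 - mu u.2) * (f z (W u) - f z (Vmu u)).
  (* [stein_increment] needs ordered arguments; exchanging them changes the sign
     of both factors on the left. *)
  have [le|/ltW le] := leP (mu u.2) (X u.1).
    have VW : Vmu u <= W u.
      by rewrite -subr_ge0 WVmu mulr_ge0 ?subr_ge0// divr_ge0 ?ltW.
    have [up lo] := H1 z (V u) delta _ _ d0 dK (VmuV u) (WV u) VW.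
    split.
      apply: le_trans (ler_wpM2l _ up) _; rewrite ?subr_ge0// WVmu.
      by apply: ler_eq; rewrite /Gup /err /v /V; ring.
    apply: le_trans _ (ler_wpM2l _ lo); rewrite ?subr_ge0// WVmu.
    by apply: ler_eq; rewrite /Glo /err /v /V; ring.
  have VW : W u <= Vmu u.
    by rewrite -subr_le0 WVmu mulr_ge0_le0 ?subr_le0// divr_ge0 ?ltW.
  have [up lo] := H1 z (V u) delta _ _ d0 dK (WV u) (VmuV u) VW.
  have xE : (X u.1 - mu u.2) * (f z (W u) - f z (Vmu u)) =
     (mu u.2 - X u.1) * (f z (Vmu u) - f z (W u)) by ring.
  have dE' : Vmu u - W u = b / N * (mu u.2 - X u.1) by rewrite -opprB WVmu; ring.
  rewrite xE; split.
    apply: le_trans (ler_wpM2l _ up) _; rewrite ?subr_ge0// dE'.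
    by apply: ler_eq; rewrite /Gup /err /v /V; ring.
  apply: le_trans _ (ler_wpM2l _ lo); rewrite ?subr_ge0// dE'.
  by apply: ler_eq; rewrite /Glo /err /v /V; ring.
have cf : continuous (f z) by exact: continuous_stein_sol.
have avgU := stein_average_le b0 cf bGup (fun u => proj1 (incr u)).
have avgL := stein_average_ge b0 cf bGlo (fun u => proj2 (incr u)).
pose Hw u := b ^- 2 * (q z * (1 + `|W u|) ^+ (2 * k + 1) * E z (W u)) +
  delta * (q z * (1 + `|W u|) ^+ (2 * m) * E z (W u)).
pose I j u := (1 + `|W u|) ^+ j * E z (W u) * w u.
have bw : bmfun w := bmfun_cw_exp n.
have bI j : bmfun (I j).
  exact: (bmfunM (bmfun_W n b (continuousMr (@continuous_norm1_pow _ j) cE)) bw).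
have bcI c j : bmfun (fun u => c * I j u) by apply: bmfunM => //; exact: bmfun_cst.
have HwE u : Hw u * w u = (b ^- 2 * q z) * I (2 * k + 1)%N u + (delta * q z) * I (2 * m)%N u.
  by rewrite /Hw /I; ring.
have bHw : bmfun (fun u => Hw u * w u).
  by rewrite (funext HwE); exact: bmfunD (bcI _ _) (bcI _ _).
have Z0 : 0 <= Z.
  rewrite -[leLHS](@Rint_cst _ _ _ Pn 0); apply: ler_Rint => //; exact: bmfun_cst.
have HwZ : C2 * \int[Pn]_u (Hw u * w u) <= q z * rem * Z.
  have -> : \int[Pn]_u (Hw u * w u) = b ^- 2 * q z * \int[Pn]_u I (2 * k + 1)%N u +
      delta * q z * \int[Pn]_u I (2 * m)%N u.
    rewrite -(RintZl _ _ (bI _)) -(RintZl _ _ (bI _)) -RintD//.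
    by apply: eq_Rintegral => u _; exact: HwE.
  have i1 : b ^- 2 * q z * \int[Pn]_u I (2 * k + 1)%N u <=
      q z * (C3 * (b ^- 2 * z1 ^+ (2 * k + 2))) * Z.
    apply: le_trans (ler_wpM2l _ (H3 n b z b1 bn zK)) _.
      by rewrite mulr_ge0 ?invr_ge0 ?sqr_ge0.
    by rewrite e2k le_eqVlt; apply/orP; left; apply/eqP; rewrite /Z /Pn /z1; ring.
  have i2 : delta * q z * \int[Pn]_u I (2 * m)%N u <=
      q z * (C5 * (b ^- 2 * z1 ^+ (2 * k + 2))) * Z.
    apply: le_trans (ler_wpM2l _ (H4 n b z b1 bn zK)) _; first by rewrite mulr_ge0.
    have -> : delta * q z * (C4 * (1 + Num.max z 0) ^+ (2 * m).+1 *
       \int[Pn]_u cw_exp N (spin_total u)) =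
      q z * (C4 * (delta * z1 ^+ (2 * m).+1)) * Z by rewrite /Z /z1; ring.
    apply: ler_wpM2r => //; apply: ler_wpM2l => //; rewrite /C5 -mulrA.
    by apply: ler_wpM2l; [exact: ltW|exact: d2].
  apply: le_trans (ler_wpM2l (ltW C20) (lerD i1 i2)) _.
  by apply: ler_eq; rewrite /rem; ring.
have sL (t : n.-tuple T) : `|spin_sum t / N| <= L.
  rewrite normrM normfV (gtr0_norm N0) ler_pdivrMr// mulrC.
  by apply: le_trans (spin_sum_le t) _; rewrite ler_wpM2r// ler_nat.
have Nsum t : N * (spin_sum t / N) = spin_sum t by rewrite mulrC divfK ?gt_eqF.
have Ierr t : `|err t| <= C1 * (delta * (q z * (1 + `|v t|) ^+ (2 * m) * E z (v t))).
  by rewrite ger0_norm.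
have bb0 : 0 <= b ^- 2 by rewrite invr_ge0 sqr_ge0.
have remU u := let: And4 c1 c2 c3 c4 := H0 n b _ b1 bn (sL u.2) in
  H2 z (V u) delta (W u) _ _ _ (err u.2) (z + delta < V u)%R
    d0 dK (WV u) bb0 c1 c2 c3 c4 (Ierr u.2).
have remL u := let: And4 c1 c2 c3 c4 := H0 n b _ b1 bn (sL u.2) in
  H2 z (V u) delta (W u) _ _ _ (- err u.2) (z - delta <= V u)%R
    d0 dK (WV u) bb0 c1 c2 c3 c4.
have bVu : bmfun V := bmfun_snd bv.
have bUp : bmfun (fun u => (z + delta < V u)%R%:R * w u) by apply: bmfunM => //; exact: bmfun_lt.
have bLo : bmfun (fun u => (z - delta <= V u)%R%:R * w u) by apply: bmfunM => //; exact: bmfun_le.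
have bqw : bmfun (fun u => q z * w u) by apply: bmfunM => //; exact: bmfun_cst.
have bCH : bmfun (fun u => C2 * (Hw u * w u)) by apply: bmfunM => //; exact: bmfun_cst.
split.
  have : \int[Pn]_u ((z + delta < V u)%R%:R * w u - q z * w u - C2 * (Hw u * w u)) <= 0.
    apply: le_trans _ avgU; apply: ler_Rint.
    - by do 2 apply: bmfunB => //.
    - by apply: bmfunM => //; exact: bmfun_stein_left.
    move=> u; rewrite [leLHS](_ : _ = ((z + delta < V u)%R%:R - q z - C2 * Hw u) * w u);
      last by ring.
    apply: ler_wpM2r => //.
    have zV : (z + delta < V u)%R -> z - delta <= V u.
      by move=> /ltW; apply: le_trans; rewrite lerD2l ge0_cp.
    have := remU u zV; rewrite Nsum ler_norml => /andP[lo _].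
    by move: lo; rewrite lerBrDr [leLHS]addrC => lo; exact: lo.
  rewrite RintB ?RintB//; last exact: bmfunB.
  rewrite (RintZl _ _ bw) (RintZl _ _ bHw) subr_le0 lerBlDr => /le_trans; apply.
  rewrite mulrDr mulr1 [leRHS]mulrDl addrC; apply: lerD => //.
have : 0 <= \int[Pn]_u ((z - delta <= V u)%R%:R * w u - q z * w u + C2 * (Hw u * w u)).
  apply: (le_trans avgL); apply: ler_Rint.
  - by apply: bmfunM => //; exact: bmfun_stein_left.
  - by apply: bmfunD => //; exact: bmfunB.
  move=> u; rewrite [leRHS](_ : _ = ((z - delta <= V u)%R%:R - q z + C2 * Hw u) * w u);
    last by ring.
  apply: ler_wpM2r; first exact: w0.
  have Nerr : `|- err u.2| <= C1 * (delta * (q z * (1 + `|V u|) ^+ (2 * m) * E z (V u))).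
    by rewrite normrN.
  have := remL u Nerr id; rewrite Nsum ler_norml => /andP[_ up].
  by move: up; rewrite lerBlDr [leRHS]addrC => up; exact: up.
rewrite RintD ?RintB//; last exact: bmfunB.
rewrite (RintZl _ _ bw) (RintZl _ _ bHw) => lo.
have : q z * (1 - rem) * Z = q z * Z - q z * rem * Z by ring.
by move: lo HwZ; rewrite -/Z; lra.
Qed.

Hypothesis L1 : 1 <= L.


(** Removing a spin moves the magnetization by at most [delta], so [cw_tail_bounds]
at [z - 2 * delta] and at [z + 3 * delta] encloses the tail of [W] (3, and not 2,
because that tail is a strict inequality), and [target_tail_shift] absorbs the
shift. *)
Lemma cw_tail_ratio : exists C, forall n (b z : R),
  1 <= b -> b ^+ (2 * k) = n.+1%:R -> 0 < z -> z ^+ (2 * k + 2) < b ^+ 2 ->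
  `|\int[pair_law n]_u ((z < b * (spin_total u / n.+1%:R))%R%:R *
       cw_exp n.+1%:R (spin_total u)) /
    \int[pair_law n]_u cw_exp n.+1%:R (spin_total u) / q z - 1| <=
  C * (b ^- 2 * (1 + z ^+ (2 * k + 2))).
Proof.
have aux1 (y z r l : R) : y - z <= 3 * r -> r <= l -> 0 < z -> 0 <= l ->
  (y <= z + 3 * l) && (0 <= z + 3 * l) by move=> *; apply/andP; split; lra.
have aux2 (x z l : R) : x <= z + 3 * l -> 0 <= 3 * l * z ->
  1 + x <= (1 + 3 * l) * (1 + z) by move=> *; lra.
have aux3 (r : R) : 0 < r -> (- (3 * r) <= - (2 * r) <= 3 * r) && (- (3 * r) <= 3 * r <= 3 * r).
  by move=> r0; apply/andP; split; apply/andP; split; lra.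
have aux4 (x y z r : R) : - r <= y - x -> y - x <= r -> z < y -> z - 2 * r + r < x.
  by move=> *; lra.
have aux5 (x y z r : R) : - r <= y - x -> y - x <= r -> z + 3 * r - r <= x ->
  0 < r -> z < y by move=> *; lra.
pose e := (2 * k + 2)%N.
(* The first factor of [K] pays for moving [z] by at most [3 * delta], the second
   for [(1 + z) ^+ e <= 2 ^+ e * (1 + z ^+ e)] in the range of [z]. *)
have [K KE] : exists K : R, K = (1 + 3 * L) ^+ e * (2 ^+ e * 2)
  by exists ((1 + 3 * L) ^+ e * (2 ^+ e * 2)).
have L31 : 1 <= 1 + 3 * L by rewrite lerDl mulr_ge0.
have K1 : 1 <= K by rewrite KE mulr_ege1 ?mulr_ege1 ?exprn_ege1 ?ler1n.
have K0 : 0 < K by exact: lt_le_trans K1.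
have [C0 C00 H0] := cw_tail_bounds K1.
pose Ks := 3 * (L * K ^+ m).
have Ks0 : 0 <= Ks by rewrite !mulr_ge0 ?exprn_ge0 ?(ltW K0).
have [C1 C10 H1] := target_tail_shift a_gt0 k0 Ks0.
pose D0 := C0 * (1 + 3 * L) ^+ e.
pose D1 := C1 * (3 * (L * K ^+ (2 * k - 3))).
have D00 : 0 <= D0 by rewrite mulr_ge0 ?exprn_ge0 ?addr_ge0 ?mulr_ge0// ltW.
have D10 : 0 <= D1 by rewrite !mulr_ge0 ?exprn_ge0 ?(ltW K0)// ltW.
exists ((D1 + D0 + D1 * (D0 * K)) * 2 ^+ e) => n b z b1 bn z0 zb.
have b0 : 0 < b by rewrite (lt_le_trans ltr01).
have bb0 : 0 < b ^+ 2 by rewrite exprn_gt0.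
have N0 : 0 < n.+1%:R :> R by rewrite ltr0n.
set N : R := n.+1%:R in bn N0 *.
set Pn := (pair_law n).
set Z := \int[Pn]_u cw_exp N (spin_total u).
have z11 : 1 <= 1 + z by rewrite lerDl ltW.
have z10 : 0 < 1 + z by exact: lt_le_trans z11.
have z1e : (1 + z) ^+ e <= 2 ^+ e * (1 + z ^+ e) := pow1D_le e (ltW z0).
have z1b : (1 + z) ^+ e <= 2 ^+ e * 2 * b ^+ 2.
  apply: (le_trans z1e); rewrite -mulrA; apply: ler_wpM2l; first exact: exprn_ge0.
  have : 1 <= b ^+ 2 by rewrite exprn_ege1.
  by move: zb; rewrite -/e; move: (z ^+ e) (b ^+ 2) => x y; lra.
have z1K : 1 + z <= K * b.
  apply: (@range_le _ k) => //; apply: (le_trans z1b); rewrite KE ler_wpM2r ?(ltW bb0)//.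
  by rewrite ler_peMl ?exprn_ege1// mulr_ge0 ?exprn_ge0.
pose delta := b * L / N.
have [dE dK' d3'] := shift_size_bounds k2 L0 K0 b0 z10 z1K.
rewrite bn -/delta in dE dK' d3'.
have d0 : 0 < delta by rewrite dE divr_gt0 ?exprn_gt0// (lt_le_trans ltr01).
have dL : delta <= L by rewrite dE ler_pdivrMr ?exprn_gt0// ler_peMr// exprn_ege1.
have dK : 3 * delta * (1 + z) ^+ m <= Ks by rewrite /Ks -mulrA ler_pM2l.
set eta := b ^- 2 * (1 + z) ^+ e.
have eta0 : 0 <= eta by rewrite mulr_ge0 ?invr_ge0 ?exprn_ge0 ?(ltW z10) ?(ltW b0).
have etaK : eta <= K.
  rewrite /eta mulrC ler_pdivrMr//; apply: (le_trans z1b); rewrite KE ler_wpM2r ?(ltW bb0)//.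
  by rewrite ler_peMl ?exprn_ege1// mulr_ge0 ?exprn_ge0.
have d3 : C1 * (3 * delta * (1 + z) ^+ m) <= D1 * eta.
  rewrite /D1 -(mulrA C1) (ler_pM2l C10) -(mulrA 3 delta) -(mulrA 3 (L * _)) ler_pM2l//.
  apply: (le_trans d3'); apply: ler_wpM2l.
    by rewrite mulr_ge0 ?exprn_ge0 ?(ltW K0).
  apply: ler_wpM2l; first by rewrite invr_ge0 ltW.
  by rewrite ler_weXn2l// leq_addl.
have zpos y : `|y - z| <= 3 * delta -> 1 + Num.max y 0 <= (1 + 3 * L) * (1 + z).
  rewrite ler_norml => /andP[_ yz].
  have yy : Num.max y 0 <= z + 3 * L.
    by rewrite ge_max; exact: aux1 yz dL z0 L0.
  have : 0 <= 3 * L * z by rewrite !mulr_ge0// ltW.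
  exact: aux2.
have zposX y : `|y - z| <= 3 * delta ->
    (1 + Num.max y 0) ^+ e <= (1 + 3 * L) ^+ e * (1 + z) ^+ e.
  move=> yz; rewrite -exprMn lerXn2r ?nnegrE ?mulr_ge0 ?zpos//.
  - by rewrite addr_ge0// le_max lexx orbT.
  - exact: le_trans L31.
  - exact: ltW.
have zposK y : `|y - z| <= 3 * delta -> (1 + Num.max y 0) ^+ e <= K * b ^+ 2.
  move=> yz; apply: (le_trans (zposX _ yz)); rewrite KE -mulrA.
  by apply: ler_wpM2l => //; rewrite exprn_ge0// (le_trans _ L31).
have zposR y : `|y - z| <= 3 * delta ->
    C0 * (b ^- 2 * (1 + Num.max y 0) ^+ e) <= D0 * eta.
  move=> yz; rewrite /D0 -mulrA ler_pM2l// /eta mulrCA.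
  by apply: ler_wpM2l (zposX _ yz); rewrite invr_ge0 ltW.
have bS := bmfun_spin_total n.
have bw := bmfun_cw_exp n.
have bW := bmfun_W n b (@continuous_idr R).
have bV := bmfun_snd (bmfun_V n b (@continuous_idr R)).
pose W (u : T * n.-tuple T) := b * (spin_total u / N).
pose V (u : T * n.-tuple T) := b * (spin_sum u.2 / N).
have WV u : `|W u - V u| <= delta.
  have -> : W u - V u = b * X u.1 / N by rewrite /W /V /spin_total; ring.
  by rewrite !normrM normfV (gtr0_norm b0) (gtr0_norm N0) ler_wpM2r ?ler_wpM2l ?invr_ge0// ltW.
have w0 u : 0 <= cw_exp N (spin_total u) by exact: expR_ge0.
set U := \int[Pn]_u ((z < W u)%R%:R * cw_exp N (spin_total u)).
have Z0 : 0 < Z.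
  rewrite (lt_le_trans ltr01)// -[leLHS](@Rint_cst _ _ _ Pn); apply: ler_Rint => //.
    exact: bmfun_cst.
  move=> u; rewrite -expR0 ler_expR mulr_ge0 ?sqr_ge0//.
  by rewrite invr_ge0 mulr_ge0// ltW.
have q0 : 0 < q z by rewrite divr_gt0 ?target_upper_gt0 ?target_mass_gt0// ltW.
have dz1 : `|z - 2 * delta - z| <= 3 * delta.
  by rewrite addrAC subrr add0r ler_norml; case/andP: (aux3 _ d0).
have dz2 : `|z + 3 * delta - z| <= 3 * delta.
  by rewrite addrAC subrr add0r ler_norml; case/andP: (aux3 _ d0).
have d30 : 0 <= 3 * delta by rewrite mulr_ge0// ltW.
have [up _] := H0 n b _ b1 bn (zposK _ dz1).
have [_ lo] := H0 n b _ b1 bn (zposK _ dz2).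
have Uup : U <= q z * (1 + D1 * eta) * (1 + D0 * eta) * Z.
  have : U <= q (z - 2 * delta) * (1 + D0 * eta) * Z.
    apply: le_trans (le_trans up _).
      apply: ler_Rint => [||u].
      - by apply: bmfunM => //; exact: bmfun_lt.
      - by apply: bmfunM => //; exact: bmfun_lt.
      rewrite ler_wpM2r// ler_nat; case: (ltP z (W u)) => // zW.
      move: (WV u); rewrite ler_norml => /andP[wv1 wv2].
      by rewrite (aux4 _ _ _ _ wv1 wv2 zW).
    apply: ler_wpM2r; first exact: ltW.
    by apply: ler_wpM2l; [exact: target_tail_ge0|rewrite lerD2l; exact: zposR].
  move/le_trans; apply; do 2 (apply: ler_wpM2r; first by rewrite ?(ltW Z0)// addr_ge0// mulr_ge0).
  have := H1 z (z - 2 * delta) (3 * delta) (ltW z0) d30 dK dz1.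
  rewrite ler_norml => /andP[_]; rewrite lerBlDr => /le_trans; apply.
  rewrite mulrDr mulr1 addrC lerD2l mulrC; apply: ler_wpM2l => //; exact: ltW.
have Ulo : q z * (1 - D1 * eta - D0 * eta) * Z <= U.
  apply: (@le_trans _ _ (q (z + 3 * delta) *
      (1 - C0 * (b ^- 2 * (1 + Num.max (z + 3 * delta) 0) ^+ e)) * Z)); last first.
    apply: (le_trans lo); apply: ler_Rint => [||u].
    - by apply: bmfunM => //; exact: bmfun_le.
    - by apply: bmfunM => //; exact: bmfun_lt.
    rewrite ler_wpM2r// ler_nat; case: (leP _ (b * _)) => // zV.
    move: (WV u); rewrite ler_norml => /andP[wv1 wv2].
    by rewrite (aux5 _ _ _ _ wv1 wv2 zV d0).
  apply: ler_wpM2r; first exact: ltW.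
  rewrite 2!mulrBr mulr1 [leRHS]mulrBr mulr1; apply: lerB.
    have := H1 z (z + 3 * delta) (3 * delta) (ltW z0) d30 dK dz2.
    rewrite ler_norml => /andP[+ _]; rewrite lerBrDr addrC; apply: le_trans.
    by rewrite lerD2l lerN2 (mulrC (q z)); apply: ler_wpM2r => //; exact: ltW.
  apply: ler_pM; rewrite ?target_tail_ge0//.
  - by rewrite mulr_ge0 ?(ltW C00)// mulr_ge0 ?invr_ge0 ?(ltW bb0)// exprn_ge0// addr_ge0// le_max lexx orbT.
  - rewrite ler_wpM2r ?invr_ge0 ?(ltW (target_mass_gt0 _ _))//.
    by apply: target_upper_nonincr => //; rewrite lerDl.
  - exact: zposR.
have -> : U / Z / q z - 1 = (U - q z * Z) / (q z * Z).
  by field; rewrite !gt_eqF.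
have qZ0 : 0 < q z * Z by rewrite mulr_gt0.
rewrite normrM normfV (gtr0_norm qZ0) ler_pdivrMr//.
have D2 : D1 * eta + D0 * eta + D1 * eta * (D0 * eta) <= (D1 + D0 + D1 * (D0 * K)) * eta.
  have -> : D1 * eta * (D0 * eta) = D1 * D0 * eta * eta by ring.
  have -> : (D1 + D0 + D1 * (D0 * K)) * eta = D1 * eta + D0 * eta + D1 * D0 * eta * K by ring.
  by rewrite lerD2l; apply: ler_wpM2l => //; apply: mulr_ge0 => //; exact: mulr_ge0.
have DE : 0 <= D1 * eta * (D0 * eta) by apply: mulr_ge0; exact: mulr_ge0.
apply: (@le_trans _ _ ((D1 + D0 + D1 * (D0 * K)) * eta * (q z * Z))).
  apply: (@le_trans _ _ ((D1 * eta + D0 * eta + D1 * eta * (D0 * eta)) * (q z * Z))).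
    rewrite ler_norml; apply/andP; split.
      rewrite lerBrDr; apply: le_trans Ulo.
      rewrite -subr_ge0 (_ : _ - _ = (D1 * eta * (D0 * eta)) * (q z * Z)); last by ring.
      by rewrite mulr_ge0// ltW.
    rewrite lerBlDr; apply: (le_trans Uup).
    by apply: ler_eq; ring.
  by apply: ler_wpM2r D2; exact: ltW.
apply: ler_wpM2r; first exact: ltW.
rewrite -[leRHS]mulrA; apply: ler_wpM2l.
  by apply: addr_ge0; [exact: addr_ge0|apply: mulr_ge0 => //; apply: mulr_ge0 => //; exact: ltW].
by rewrite /eta [leRHS]mulrCA; apply: ler_wpM2l; [rewrite invr_ge0 ltW|exact: z1e].
Qed.

End cw_tail.

End bounded_spin.

(** * Reduction to bounded spins *)

Section clamp.
Context {R : realType}.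
Implicit Types (L x : R).

(** The spins of the model are bounded only almost surely; composing with [clamp]
makes them bounded everywhere without changing any integral. *)
Definition clamp L (x : measurableTypeR R) : R := Num.max (- L) (Num.min L x).

Lemma clamp_id L x : `|x| <= L -> clamp L x = x.
Proof.
rewrite ler_norml => /andP[lo up].
by rewrite /clamp (min_idPr up) (max_idPr lo).
Qed.

Lemma clamp_le L x : 0 <= L -> `|clamp L x| <= L.
Proof.
move=> L0; rewrite /clamp ler_norml le_max lexx/= ge_max ge_min lexx/= andbT.
by rewrite (le_trans _ L0)// oppr_le0.
Qed.

Lemma clampN L x : 0 <= L -> clamp L (- x) = - clamp L x.
Proof.
move=> L0; rewrite /clamp oppr_max opprK oppr_min /Num.max /Num.min.
by repeat case: ifP; move: L0; lra.
Qed.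

Lemma measurable_clamp L : measurable_fun setT (clamp L).
Proof.
apply: measurable_maxr; first exact: measurable_cst.
by apply: measurable_minr; [exact: measurable_cst|exact: measurable_id].
Qed.

End clamp.

Lemma prob1_eq_integral d (T : measurableType d) (R : realType) (P : probability T R)
    (D : set T) (f g : T -> \bar R) : measurable D -> P D = 1%E ->
  measurable_fun setT f -> measurable_fun setT g -> (forall x, D x -> f x = g x) ->
  (\int[P]_x f x = \int[P]_x g x)%E.
Proof.
move=> mD PD mf mg fg; apply: ae_eq_integral => //.
exists (~` D); split; first exact: measurableC.
  by have := probability_setC P mD; rewrite PD subee.
by move=> x /= nfg Dx; apply: nfg => _; exact: fg.
Qed.

Lemma patch_bool (T : Type) (R : realType) (p : T -> bool) (f : T -> R) x :
  ((fun x => (f x)%:E) \_ [set y | p y]) x = ((p x)%:R * f x)%:E.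
Proof.
rewrite patchE; case: ifPn => [/set_mem /= ->|/negP xp]; first by rewrite mul1r.
case: (boolP (p x)) => px; last by rewrite mul0r.
by case: xp; exact: mem_set.
Qed.

Section clamped_curie_weiss.
Context {R : realType} (rho : probability (measurableTypeR R) R) (L : R).
Hypotheses (L0 : 0 <= L) (rhoL : rho `[- L, L]%classic = 1%E).

Local Notation c := (clamp L).

Let cL x : `|c x| <= L. Proof. exact: clamp_le. Qed.
Let mc : measurable_fun setT c. Proof. exact: measurable_clamp. Qed.

Let cE x : `[- L, L]%classic x -> c x = x.
Proof. by rewrite /= in_itv/= -ler_norml; exact: clamp_id. Qed.

Lemma Rint_clamp (f : R -> R) : measurable_fun setT f ->
  \int[rho]_x f x = \int[rho]_x f (c x).
Proof.
move=> mf; congr fine; apply: (prob1_eq_integral _ rhoL) => [|||x Lx].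
- exact: measurable_itv.
- exact/measurable_EFinP.
- by apply/measurable_EFinP; exact: measurableT_comp mf mc.
- by rewrite cE.
Qed.

Lemma CW_h_clamp : CW_h rho = cumulant_gap rho c.
Proof.
apply/funext => s; rewrite /CW_h /cumulant_gap; congr (_ - ln _).
rewrite (Rint_clamp (f := fun x => expR (s * x))).
  by apply: eq_Rintegral => x _; rewrite expr0 mul1r mulr1.
by apply: continuous_measurable_fun; exact: continuous_scaled_expR.
Qed.

Lemma clamp_sym : symmetric_about0 rho -> forall g : R -> R, continuous g ->
  \int[rho]_x g (- c x) = \int[rho]_x g (c x).
Proof.
move=> rho_sym g cg; rewrite /Rintegral; congr fine.
have [mgc [M gM]] := bmfun_continuous_comp cg (bmfun_spin mc cL).
have mN : measurable_fun setT (-%R : measurableTypeR R -> measurableTypeR R).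
  exact: oppr_measurable.
have pushE : (\int[pushforward rho (-%R : measurableTypeR R -> measurableTypeR R)]_x (g (c x))%:E =
    \int[rho]_x (g (c x))%:E)%E.
  by apply: eq_measure_integral => A mA _; exact: rho_sym.
rewrite -pushE integral_pushforward//.
- by apply: eq_integral => x _ /=; rewrite clampN.
- exact/measurable_EFinP.
- rewrite preimage_setT; apply: bmfun_integrable; split; last by exists M => x.
  exact: measurableT_comp mgc mN.
Qed.

Lemma measurable_tuple_sum n :
  measurable_fun setT (fun x : n.-tuple (measurableTypeR R) => \sum_(i < n) tnth x i : R).
Proof. by apply: measurable_sum => i; exact: measurable_tnth. Qed.

Lemma measurable_CW_weight beta n :
  measurable_fun setT (fun x : n.-tuple (measurableTypeR R) => CW_weight beta x).
Proof.
rewrite /CW_weight; apply: measurableT_comp; first exact: measurable_expR.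
apply: measurable_funM; first exact: measurable_cst.
by apply: measurable_funX; exact: measurable_tuple_sum.
Qed.

Lemma CW_integral_clamp n (p : R -> bool) : measurable_fun setT p ->
  (\int[power_prob rho n.+1]_(x in [set x : n.+1.-tuple (measurableTypeR R) |
      p (\sum_(i < n.+1) tnth x i)%R])
     (CW_weight 1 x)%:E =
   (\int[(rho \x power_prob rho n)%E]_u
     ((p (spin_total c u))%:R * cw_exp n.+1%:R (spin_total c u)))%:E)%E.
Proof.
move=> mp.
pose G (t : n.+1.-tuple (measurableTypeR R)) : R :=
  (p (spin_sum c t))%:R * cw_exp n.+1%:R (spin_sum c t).
have bG : bmfun G.
  apply: bmfunM.
    by apply: bmfun_bool; apply: measurableT_comp mp _; case: (bmfun_spin_sum mc cL n.+1).
  exact: (bmfun_continuous_comp (@continuous_sqr_expR R _) (bmfun_spin_sum mc cL n.+1)).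
pose D := [set x : n.+1.-tuple (measurableTypeR R) | forall i, `[- L, L]%classic (tnth x i)].
have mD : measurable D.
  rewrite (_ : D = \bigcap_(i in [set: 'I_n.+1])
      ((@tnth _ (measurableTypeR R) ^~ i) @^-1` `[- L, L]%classic)).
    apply: fin_bigcap_measurable => // i _.
    by rewrite -[X in measurable X]setTI; exact: measurable_tnth.
  by apply/seteqP; split => x /= hx i; [move=> _; exact: hx|exact: hx].
have PD : power_prob rho n.+1 D = 1%E.
  rewrite (@power_prob_box _ _ _ rho n.+1 (fun=> `[- L, L]%classic)).
    by rewrite big1.
  by move=> i; exact: measurable_itv.
rewrite integral_mkcond.
transitivity (\int[power_prob rho n.+1]_t (G t)%:E)%E; last first.
  rewrite -(EFin_Rint _ bG) Rint_power_cons//; congr (_%:E).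
  by apply: eq_Rintegral => -[x t] _; rewrite /G spin_sum_cons.
apply: (prob1_eq_integral mD PD).
- rewrite (_ : _ \_ _ = fun x : n.+1.-tuple (measurableTypeR R) =>
    ((p (\sum_(i < n.+1) tnth x i))%:R * CW_weight 1 x)%:E); last first.
    by apply/funext => x; exact: patch_bool.
  have [mb _] := @bmfun_bool _ _ R
    (fun x : n.+1.-tuple (measurableTypeR R) => p (\sum_(i < n.+1) tnth x i))
    (measurableT_comp mp (@measurable_tuple_sum n.+1)).
  by apply/measurable_EFinP; apply: measurable_funM mb _; exact: measurable_CW_weight.
- by apply/measurable_EFinP; case: bG.
- move=> x Dx.
  rewrite (patch_bool (fun y : n.+1.-tuple (measurableTypeR R) => p (\sum_(i < n.+1) tnth y i))) /G.
  have -> : spin_sum c x = \sum_(i < n.+1) tnth x i.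
    by apply: eq_bigr => i _; exact: cE.
  have -> : CW_weight 1 x = cw_exp n.+1%:R (\sum_(i < n.+1) tnth x i).
    by rewrite /CW_weight /cw_exp div1r.
  by [].
Qed.

Lemma CW_Z_clamp n : CW_Z rho 1 n.+1 =
  \int[(rho \x power_prob rho n)%E]_u cw_exp n.+1%:R (spin_total c u).
Proof.
have := CW_integral_clamp n (p := fun=> true) (measurable_cst _).
rewrite /CW_Z /Rintegral (_ : [set x | _] = setT); last by apply/seteqP; split.
by move=> ->/=; congr fine; apply: eq_integral => u _; rewrite mul1r.
Qed.

End clamped_curie_weiss.

(** * The Curie--Weiss model *)

(** The scale [b = n^(1/2k)], characterised by [b ^+ (2 * k) = n], through which
all the real powers of the statement are expressed. *)
Lemma powR_root (R : realType) (n k : nat) (e := (2 * k + 2)%N) (b := n%:R `^ (2 * k)%:R^-1 : R) :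
  (0 < n)%N -> (0 < k)%N ->
  [/\ 1 <= b, b ^+ (2 * k) = n%:R, n%:R `^ (- k%:R^-1) = b ^- 2 &
    forall z : R, 0 < z -> z < n%:R `^ (k * e)%:R^-1 -> z ^+ e < b ^+ 2].
Proof.
move=> n0 k0; have n1 : 1 <= n%:R :> R by rewrite ler1n.
have kR : k%:R != 0 :> R by rewrite pnatr_eq0 -lt0n.
have eR : e%:R != 0 :> R by rewrite pnatr_eq0 -lt0n /e addn2.
have b0 : 0 <= b by exact: powR_ge0.
have bX j : b ^+ j = n%:R `^ ((2 * k)%:R^-1 * j%:R).
  by rewrite -powR_mulrn// -powRrM.
have b2 : b ^+ 2 = n%:R `^ k%:R^-1.
  by rewrite bX natrM invfM mulrAC mulVf ?mul1r ?pnatr_eq0.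
split.
- by rewrite -(powRr0 n%:R) ler_powR// invr_ge0.
- by rewrite bX mulVf ?powRr1// pnatr_eq0 -lt0n muln_gt0 k0.
- by rewrite powRN b2.
move=> z z0 zn; have yE : (n%:R `^ (k * e)%:R^-1) ^+ e = b ^+ 2.
  by rewrite b2 -powR_mulrn ?powR_ge0// -powRrM natrM invfM -mulrA mulVf ?mulr1.
rewrite -yE ltrXn2r//; last exact: ltW.
by rewrite /e addn2.
Qed.

Lemma target_tail_density (R : realType) (rho : probability (measurableTypeR R) R) k
    (a := (CW_h rho)^`(2 * k)%classic 0 / (2 * k)`!%:R)
    (dY : measure_display) (OmegaY : measurableType dY)
    (PY : probability OmegaY R) (Y : {RV PY >-> measurableTypeR R}) (z : R) :
  0 < a -> (0 < k)%N -> has_density Y (limit_density rho k) ->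
  fine (PY [set w | z < Y w]) = target_tail a k z.
Proof.
move=> a0 k0 Y_density.
have kerE : limit_kernel rho k = target_fun a k.
  by apply/funext => y; rewrite /limit_kernel /target_fun /a mulrAC.
have -> : PY [set w | z < Y w] = distribution PY Y `]z, +oo[.
  by congr (PY _); apply/seteqP; split => w /=; rewrite in_itv/= andbT.
rewrite Y_density; last exact: measurable_itv.
rewrite /limit_density kerE -/(target_mass a k).
under eq_integral do rewrite EFinM.
have iS : lebesgue_measure.-integrable `]z, +oo[ (EFin \o target_fun a k).
  apply: integrableS (integrable_target_fun a0 k0) => //.
rewrite integralZl//.
by rewrite fineM//; [rewrite mulrC|exact: integrable_fin_num].
Qed.

Theorem theorem3p1 (R : realType) (rho : probability (measurableTypeR R) R)
    (rho_sym : symmetric_about0 rho)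
    (dXi : measure_display) (OmegaXi : measurableType dXi)
    (PXi : probability OmegaXi R) (xi : {RV PXi >-> measurableTypeR R})
    (xi_law : has_law xi rho)
    (xi_var : ('E_PXi[fun w => (xi w ^+ 2)%R] = 1)%E)
    (xi_exp : forall beta : R, 0 <= beta ->
      ('E_PXi[fun w => expR (beta * xi w ^+ 2 / 2)%R] < +oo)%E)
    (rho_supp : compactly_supported rho)
    (h_root : forall s : R, (CW_h rho)^`() s = 0 <-> s = 0)
    (k : nat) (k_ge2 : (2 <= k)%N)
    (h_flat : forall i : nat, (i <= 2 * k - 1)%N -> (CW_h rho)^`(i) 0 = 0)
    (h_pos : 0 < (CW_h rho)^`(2 * k) 0)
    (dY : measure_display) (OmegaY : measurableType dY)
    (PY : probability OmegaY R) (Y : {RV PY >-> measurableTypeR R})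
    (Y_density : has_density Y (limit_density rho k)) :
  exists C : R, forall n : nat, (0 < n)%N ->
    forall (d : measure_display) (Omega : measurableType d)
      (P : probability Omega R)
      (X : {RV P >-> n.-tuple (measurableTypeR R)}),
    has_law X (@CW_law R rho 1 n) ->
    let W w := n%:R `^ (2 * k)%:R^-1 * magnetization (X w) in
    forall z : R, 0 < z < n%:R `^ (k * (2 * k + 2))%:R^-1 ->
      `| fine (P [set w | z < W w]) / fine (PY [set w | z < Y w]) - 1 |
        <= C * (n%:R `^ (- k%:R^-1) * (1 + z ^+ (2 * k + 2))).

Proof.
have [L' rhoL'] := rho_supp.
have k0 : (0 < k)%N by exact: leq_trans k_ge2.
(* [1 <= L] makes the threshold shifts of [cw_tail_ratio] positive. *)
pose L := Num.max 1 L'.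
have L1 : 1 <= L by rewrite le_max lexx.
have L0 : 0 <= L by exact: le_trans L1.
have rhoL : rho `[- L, L]%classic = 1%E.
  apply/eqP; rewrite eq_le probability_le1/=; last exact: measurable_itv.
  rewrite -rhoL'; apply: le_measure; rewrite ?inE; try exact: measurable_itv.
  move=> x /=; rewrite !in_itv/= => /andP[lo up].
  have LL : L' <= L by rewrite le_max lexx orbT.
  by rewrite (le_trans _ lo) ?(le_trans up)// lerN2.
have hE := CW_h_clamp rhoL; rewrite hE in h_root h_flat h_pos.
have c_var : \int[rho]_x (clamp L x ^+ 2) = 1.
  have m2 : measurable_fun setT (fun x : R => x ^+ 2).
    by apply: continuous_measurable_fun; exact: continuous_Xn.
  rewrite -(Rint_clamp rhoL m2) /Rintegral.
  have -> : (\int[rho]_x (x ^+ 2)%:E = \int[distribution PXi xi]_x (x ^+ 2)%:E)%E.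
    by apply/esym; apply: eq_measure_integral => A mA _; exact: xi_law.
  rewrite ge0_integral_distribution; last 2 first.
  - exact/measurable_EFinP.
  - by move=> x; rewrite lee_fin sqr_ge0.
  by move: xi_var; rewrite unlock => ->.
have a_gt0 : 0 < (cumulant_gap rho (clamp L))^`(2 * k)%classic 0 / (2 * k)`!%:R.
  by rewrite divr_gt0// ltr0n fact_gt0.
have cL x : `|clamp L x| <= L by exact: clamp_le.
have [C HC] := cw_tail_ratio L0 (measurable_clamp L) cL (clamp_sym L0 rho_sym)
  c_var k0 h_root h_flat a_gt0 k_ge2 L1.
exists C => -[//|n] _ d Omega P X X_law W z /andP[z0 zn].
have [b1 bn bk zb] := powR_root R (ltn0Sn n) k0.
move: (zb z z0 zn) => {}zb; rewrite bk.
rewrite (target_tail_density z _ k0 Y_density); last by rewrite hE.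
set b := _ `^ _ in b1 bn zb W *.
have N0 : 0 < n.+1%:R :> R by rewrite ltr0n.
pose p s := z < b * (s / n.+1%:R).
have mp : measurable_fun setT p.
  apply: measurable_fun_ltr => //; apply: measurable_funM => //.
  exact: measurable_funM.
have -> : fine (P [set w | z < W w]) =
    \int[(rho \x power_prob rho n)%E]_u ((p (spin_total (clamp L) u))%:R *
      cw_exp n.+1%:R (spin_total (clamp L) u)) /
    \int[(rho \x power_prob rho n)%E]_u cw_exp n.+1%:R (spin_total (clamp L) u).
  pose A := [set x : n.+1.-tuple (measurableTypeR R) | p (\sum_(i < n.+1) tnth x i)%R].
  have mA : measurable A.
    by rewrite -[A]setTI; apply: (measurableT_comp mp (@measurable_tuple_sum R n.+1)).
  have -> : P [set w | z < W w] = distribution P X A.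
    congr (P _); apply/seteqP; split => w /=;
    by rewrite /p /W /magnetization (mulrC n.+1%:R^-1).
  rewrite X_law// /CW_law (CW_integral_clamp L0 rhoL n mp) (CW_Z_clamp L0 rhoL).
  by rewrite -EFinM/= mulrC.
by rewrite hE; exact: HC.
Qed.
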